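(* Let $G$ be a connected undirected graph with $n=|V(G)|$, $m=|E(G)|$, $c:E(G)\to\mathbb{R}_{>0}$, $\mathcal{T}\subseteq V(G)$ with $k=|\mathcal{T}|$, $r\in\mathcal{T}$, and $L$ a valid lower bound, and let $f_L$ be an upper bound on the time required to evaluate $L$. Then the Dijkstra–Steiner algorithm (described in the context) can be implemented to run in time $O(3^k n+2^k(n\log n+m)+2^k n f_L)$.
   Context: A Steiner tree for $X\subseteq V(G)$ is a tree $T$ in $G$ with $X\subseteq V(T)$; $\mathrm{smt}(X)$ denotes the minimum cost of such a tree. A function $L:V(G)\times 2^{\mathcal{T}}\to\mathbb{R}_{\ge0}$ is a valid lower bound (w.r.t. $r$) if $L(r,\{r\})=0$ and $L(v,I)\le L(w,I')+\mathrm{smt}((I\setminus I')\cup\{v,w\})$ for all $v,w\in V(G)$ and all $\{r\}\subseteq I'\subseteq I\subseteq\mathcal{T}$. Dijkstra–Steiner algorithm. Labels are pairs $(v,I)\in V(G)\times 2^{\mathcal{T}\setminus\{r\}}$, each with a value $l(v,I)\in\mathbb{R}_{\ge0}\cup\{\infty\}$ and backtracking data $b(v,I)$. Initialization: $l(v,I)=\infty$ for all $(v,I)$; then $l(s,\{s\})=0$ for $s\in\mathcal{T}\setminus\{r\}$; $l(v,\emptyset)=0$ for all $v$; $b\equiv\emptyset$; $N=\{(s,\{s\}):s\in\mathcal{T}\setminus\{r\}\}$; $P=V(G)\times\{\emptyset\}$. While $(r,\mathcal{T}\setminus\{r\})\notin P$: choose $(v,I)\in N$ minimizing $l(v,I)+L(v,\mathcal{T}\setminus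 I)$; move it from $N$ to $P$; for every edge $e=\{v,w\}$: if $l(v,I)+c(e)<l(w,I)$ and $(w,I)\notin P$, set $l(w,I):=l(v,I)+c(e)$, $b(w,I):=\{(v,I)\}$, add $(w,I)$ to $N$; for every nonempty $J\subseteq(\mathcal{T}\setminus\{r\})\setminus I$ with $(v,J)\in P$: if $l(v,I)+l(v,J)<l(v,I\cup J)$ and $(v,I\cup J)\notin P$, set $l(v,I\cup J):=l(v,I)+l(v,J)$, $b(v,I\cup J):=\{(v,I),(v,J)\}$, add $(v,I\cup J)$ to $N$. Finally return $\mathrm{backtrack}(r,\mathcal{T}\setminus\{r\})$, where $\mathrm{backtrack}(v,I)=\{\{v,w\}\}\cup\mathrm{backtrack}(w,I)$ if $b(v,I)=\{(w,I)\}$, and otherwise $\bigcup_{(w,I')\in b(v,I)}\mathrm{backtrack}(w,I')$. *)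

(* Defs.v *)
(* MathComp; the real numbers are an arbitrary [R : realType]. *)
From HB Require Import structures.
From mathcomp Require Import all_boot all_order all_algebra.
From mathcomp Require Import boolp reals constructive_ereal.

Set Implicit Arguments.
Unset Strict Implicit.
Unset Printing Implicit Defensive.

Import Order.TTheory GRing.Theory Num.Theory.
Local Open Scope ring_scope.

Definition upd (A : eqType) (B : Type) (f : A -> B) (a : A) (b : B) : A -> B :=
  fun x => if x == a then b else f x.

(* Finite simple graphs: the vertices are a finType [V], and an edge is the    *)
(* two-element set of its ends. A set of edges [F] has adjacency [adj F].      *)

Definition simple_graph (V : finType) (E : {set {set V}}) : Prop :=
  forall e : {set V}, e \in E -> #|e| = 2%N.

Definition adj (V : finType) (F : {set {set V}}) : rel V :=
  fun x y => [set x; y] \in F.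

Definition connected_graph (V : finType) (E : {set {set V}}) : Prop :=
  forall x y : V, connect (adj E) x y.

Definition acyclic (V : finType) (F : {set {set V}}) : Prop :=
  forall p : seq V, (2 < size p)%N -> ~~ (cycle (adj F) p && uniq p).

(* [tree_in E W F]: the subgraph (W, F) is a tree in the graph with edges E.   *)
Definition tree_in (V : finType) (E : {set {set V}})
    (W : {set V}) (F : {set {set V}}) : Prop :=
  [/\ F \subset E, cover F \subset W, W != set0,
      {in W &, forall x y, connect (adj F) x y} & acyclic F].

Section SteinerTrees.
Variables (R : realType) (V : finType).
Variables (E : {set {set V}}) (c : {set V} -> R).

Definition steiner_tree (X : {set V}) (t : {set V} * {set {set V}}) : Prop :=
  tree_in E t.1 t.2 /\ X \subset t.1.

(* +oo if there is no Steiner tree for X, which a connected graph precludes    *)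
(* for nonempty X.                                                             *)
Definition smt (X : {set V}) : \bar R :=
  \big[Order.min/+oo%E]_(t : {set V} * {set {set V}} | `[< steiner_tree X t >])
     (\sum_(e in t.2) c e)%:E.

Definition valid_lower_bound (T : {set V}) (r : V) (L : V -> {set V} -> R) : Prop :=
  [/\ forall v (I : {set V}), I \subset T -> 0 <= L v I,
      L r [set r] = 0
    & forall (v w : V) (I I' : {set V}),
        r \in I' -> I' \subset I -> I \subset T ->
        ((L v I)%:E <= (L w I')%:E + smt ((I :\: I') :|: [set v; w]))%E].

End SteinerTrees.

(* The Dijkstra-Steiner algorithm as a nondeterministic transition system:     *)
(* ties between minimizers and the orders of the two inner loops are free.     *)

Section DijkstraSteiner.
Variables (R : realType) (V : finType).
Local Notation label := (V * {set V})%type.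

Record ds_state := DSState {
  dl : label -> \bar R;
  db : label -> {set label};
  dN : {set label};
  dP : {set label} }.

Variables (E : {set {set V}}) (c : {set V} -> R) (T : {set V}) (r : V).
Variable (L : V -> {set V} -> R).

Definition ds_init : ds_state :=
  {| dl := fun x => if (x.2 == set0) || ((x.1 \in T :\ r) && (x.2 == [set x.1]))
                    then 0%E else +oo%E;
     db := fun=> set0;
     dN := [set (s, [set s]) | s in T :\ r];
     dP := [set (v, set0) | v : V] |}.

(* "If a < l(x) and x is not in P, set l(x) := a, b(x) := B, add x to N."      *)
Definition ds_improve (s : ds_state) (x : label) (a : \bar R) (B : {set label}) :
    ds_state :=
  if (a < dl s x)%E && (x \notin dP s) then
    {| dl := upd (dl s) x a;
       db := upd (db s) x B;
       dN := x |: dN s;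
       dP := dP s |}
  else s.

Definition ds_scan_edge (x : label) (s : ds_state) (w : V) : ds_state :=
  ds_improve s (w, x.2) (dl s x + (c [set x.1; w])%:E)%E [set x].

Definition ds_scan_set (x : label) (s : ds_state) (J : {set V}) : ds_state :=
  ds_improve s (x.1, x.2 :|: J) (dl s x + dl s (x.1, J))%E [set x; (x.1, J)].

Definition ds_settle (s : ds_state) (x : label) : ds_state :=
  {| dl := dl s; db := db s; dN := dN s :\ x; dP := x |: dP s |}.

Definition ds_key (s : ds_state) (x : label) : \bar R :=
  (dl s x + (L x.1 (T :\: x.2))%:E)%E.

Definition ds_step (s : ds_state) (x : label) (s' : ds_state) : Prop :=
  [/\ x \in dN s,
      forall y, y \in dN s -> (ds_key s x <= ds_key s y)%E
    & exists (ws : seq V) (Js : seq {set V}),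
      [/\ perm_eq ws (enum [set w | [set x.1; w] \in E]),
          perm_eq Js (enum [set J : {set V} |
            [&& J != set0, J \subset (T :\ r) :\: x.2
              & (x.1, J) \in dP (ds_settle s x)]])
        & s' = foldl (ds_scan_set x)
                 (foldl (ds_scan_edge x) (ds_settle s x) ws) Js]].

(* [ds_run s xs s']: from s the main loop chooses the labels xs, in this       *)
(* order, and exits in s'.                                                     *)
Inductive ds_run : ds_state -> seq label -> ds_state -> Prop :=
| ds_run_exit s : (r, T :\ r) \in dP s -> ds_run s [::] s
| ds_run_iter s x s1 xs s' :
    (r, T :\ r) \notin dP s -> ds_step s x s1 -> ds_run s1 xs s' ->
    ds_run s (x :: xs) s'.

(* The graph of the recursive procedure backtrack.                             *)
Inductive ds_backtrack (s : ds_state) : label -> {set {set V}} -> Prop :=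
| ds_backtrack_edge v w I F :
    db s (v, I) = [set (w, I)] -> ds_backtrack s (w, I) F ->
    ds_backtrack s (v, I) ([set v; w] |: F)
| ds_backtrack_union v I (F : label -> {set {set V}}) :
    (forall w, db s (v, I) <> [set (w, I)]) ->
    (forall y, y \in db s (v, I) -> ds_backtrack s y (F y)) ->
    ds_backtrack s (v, I) (\bigcup_(y in db s (v, I)) F y).

End DijkstraSteiner.

(* A unit-cost real RAM, presented as a while language. Memory consists of     *)
(* natural and real variables and of natural and real arrays, all named by     *)
(* constants of the program text. Naturals support +, truncated - and          *)
(* comparison (no multiplication or bit operations, which would be too strong  *)
(* at unit cost on unbounded words); reals support only + and comparison.      *)

Inductive nexp :=
| NConst of nat
| NVar of nat
| NGet of nat & nexp
| NAdd of nexp & nexp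
| NSub of nexp & nexp.

Inductive rexp :=
| RZero
| RVar of nat
| RGet of nat & nexp
| RAdd of rexp & rexp.

Inductive bexp :=
| NEq of nexp & nexp
| NLt of nexp & nexp
| RLt of rexp & rexp
| BNot of bexp
| BAnd of bexp & bexp.

(* [Query x v J] assigns the value of an external subroutine at (v, J) to the  *)
(* real variable x.                                                            *)
Inductive com :=
| Skip
| NSet of nat & nexp
| NPut of nat & nexp & nexp
| RSet of nat & rexp
| RPut of nat & nexp & rexp
| Query of nat & nexp & nexp
| Seq of com & com
| If of bexp & com & com
| While of bexp & com.

Fixpoint ncost (e : nexp) : nat :=
  match e with
  | NConst _ | NVar _ => 1
  | NGet _ i => (ncost i).+1
  | NAdd e1 e2 | NSub e1 e2 => (ncost e1 + ncost e2).+1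
  end.

Fixpoint rcost (e : rexp) : nat :=
  match e with
  | RZero | RVar _ => 1
  | RGet _ i => (ncost i).+1
  | RAdd e1 e2 => (rcost e1 + rcost e2).+1
  end.

Fixpoint bcost (e : bexp) : nat :=
  match e with
  | NEq e1 e2 | NLt e1 e2 => (ncost e1 + ncost e2).+1
  | RLt e1 e2 => (rcost e1 + rcost e2).+1
  | BNot e1 => (bcost e1).+1
  | BAnd e1 e2 => (bcost e1 + bcost e2).+1
  end.

Section Semantics.
Variable R : realType.

Record store := Store {
  nvar : nat -> nat;
  narr : nat -> nat -> nat;
  rvar : nat -> R;
  rarr : nat -> nat -> R }.

Fixpoint neval (s : store) (e : nexp) : nat :=
  match e with
  | NConst k => k
  | NVar x => nvar s x
  | NGet a i => narr s a (neval s i)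
  | NAdd e1 e2 => (neval s e1 + neval s e2)%N
  | NSub e1 e2 => (neval s e1 - neval s e2)%N
  end.

Fixpoint reval (s : store) (e : rexp) : R :=
  match e with
  | RZero => 0
  | RVar x => rvar s x
  | RGet a i => rarr s a (neval s i)
  | RAdd e1 e2 => reval s e1 + reval s e2
  end.

Fixpoint beval (s : store) (e : bexp) : bool :=
  match e with
  | NEq e1 e2 => neval s e1 == neval s e2
  | NLt e1 e2 => (neval s e1 < neval s e2)%N
  | RLt e1 e2 => reval s e1 < reval s e2
  | BNot e1 => ~~ beval s e1
  | BAnd e1 e2 => beval s e1 && beval s e2
  end.

Definition set_nvar (s : store) (x n : nat) : store :=
  Store (upd (nvar s) x n) (narr s) (rvar s) (rarr s).

Definition set_narr (s : store) (a i n : nat) : store :=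
  Store (nvar s) (upd (narr s) a (upd (narr s a) i n)) (rvar s) (rarr s).

Definition set_rvar (s : store) (x : nat) (q : R) : store :=
  Store (nvar s) (narr s) (upd (rvar s) x q) (rarr s).

Definition set_rarr (s : store) (a i : nat) (q : R) : store :=
  Store (nvar s) (narr s) (rvar s) (upd (rarr s) a (upd (rarr s a) i q)).

(* Value and running time of the external subroutine.                          *)
Variables (sub_val : nat -> nat -> R) (sub_time : nat -> nat -> nat).

(* [exec p s t s']: from s, the program p halts in s' after exactly t steps.   *)
Inductive exec : com -> store -> nat -> store -> Prop :=
| exec_skip s : exec Skip s 1 s
| exec_nset s x e :
    exec (NSet x e) s (ncost e).+1 (set_nvar s x (neval s e))
| exec_nput s a i e :
    exec (NPut a i e) s (ncost i + ncost e).+1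
      (set_narr s a (neval s i) (neval s e))
| exec_rset s x e :
    exec (RSet x e) s (rcost e).+1 (set_rvar s x (reval s e))
| exec_rput s a i e :
    exec (RPut a i e) s (ncost i + rcost e).+1
      (set_rarr s a (neval s i) (reval s e))
| exec_query s x v J :
    exec (Query x v J) s
      (ncost v + ncost J + sub_time (neval s v) (neval s J)).+1
      (set_rvar s x (sub_val (neval s v) (neval s J)))
| exec_seq p q s t s1 t' s' :
    exec p s t s1 -> exec q s1 t' s' -> exec (Seq p q) s (t + t').+1 s'
| exec_if b p q s t s' :
    exec (if beval s b then p else q) s t s' ->
    exec (If b p q) s (bcost b + t).+1 s'
| exec_while_exit b p s :
    ~~ beval s b -> exec (While b p) s (bcost b).+1 s
| exec_while_iter b p s t s1 t' s' :
    beval s b -> exec p s t s1 -> exec (While b p) s1 t' s' ->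
    exec (While b p) s (bcost b + t + t').+1 s'.

End Semantics.

(* Input and output conventions. An instance is presented by arbitrary         *)
(* listings vs of the vertices, es of the edges (each as an ordered pair of    *)
(* ends) and ts of the terminals with r in the last place. Vertices and edges  *)
(* are then denoted by their position in vs and es, and a set of terminals by  *)
(* the number whose j-th binary digit tells whether it contains the j-th       *)
(* terminal. Because r comes last, the subsets of T :\ r are the numbers       *)
(* below 2 ^ (#|T| - 1).                                                       *)

Section Encoding.
Variables (R : realType) (V : finType).
Variables (E : {set {set V}}) (c : {set V} -> R) (T : {set V}) (r : V).

Definition edge_of (p : V * V) : {set V} := [set p.1; p.2].

Definition presents (vs : seq V) (es : seq (V * V)) (ts : seq V) : Prop :=
  [/\ perm_eq vs (enum V),
      perm_eq [seq edge_of p | p <- es] (enum E)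
    & exists2 ts', perm_eq ts' (enum (T :\ r)) & ts = rcons ts' r].

Variables (vs : seq V) (es : seq (V * V)) (ts : seq V).

Definition vcode (v : V) : nat := index v vs.

Definition vdecode (i : nat) : V := nth r vs i.

Definition tcode (I : {set V}) : nat := (\sum_(t <- ts | t \in I) 2 ^ index t ts)%N.

Definition tdecode (J : nat) : {set V} :=
  [set t in ts | odd (J %/ 2 ^ index t ts)].

(* Natural variables 0, 1, 2: n, m, k. Natural arrays 0, 1: first and second   *)
(* ends of the edges; 2: the terminals. Real array 0: the costs of the edges.  *)
(* All other memory is 0.                                                      *)
Definition input_store : store R :=
  {| nvar := nth 0%N [:: size vs; size es; size ts];
     narr := fun a => nth 0%N (nth [::] [:: [seq vcode p.1 | p <- es];
                                            [seq vcode p.2 | p <- es];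
                                            [seq vcode t | t <- ts]] a);
     rvar := fun=> 0;
     rarr := fun a => nth 0 (nth [::] [:: [seq c (edge_of p) | p <- es]] a) |}.

(* Natural array 3: indicator of the returned edge set F. Natural variable 3   *)
(* and natural arrays 4, 5: number, vertices and terminal sets of the labels   *)
(* xs chosen by the main loop, in order.                                       *)
Definition outputs (s : store R) (xs : seq (V * {set V})) (F : {set {set V}}) :
    Prop :=
  [/\ forall e, e \in E ->
        narr s 3 (index e [seq edge_of p | p <- es]) = (e \in F),
      F \subset E,
      nvar s 3 = size xs
    & forall i, (i < size xs)%N ->
        (narr s 4 i, narr s 5 i) =
        (vcode (nth (r, set0) xs i).1, tcode (nth (r, set0) xs i).2)].

End Encoding.

(* [implements_ds ... B p]: on every presentation of the instance, p halts     *)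
(* within B steps after performing a run of the Dijkstra-Steiner algorithm,    *)
(* i.e. it reports the labels chosen by the main loop of some run of the       *)
(* algorithm and the edge set which that run returns. The bound L is available *)
(* only as a subroutine, whose evaluation at (v, I) takes time tL v I.         *)
Definition implements_ds (R : realType) (V : finType)
    (E : {set {set V}}) (c : {set V} -> R) (T : {set V}) (r : V)
    (L : V -> {set V} -> R) (tL : V -> {set V} -> nat) (B : nat) (p : com) : Prop :=
  forall (vs : seq V) (es : seq (V * V)) (ts : seq V),
    presents E T r vs es ts ->
    exists (t : nat) (s : store R) (xs : seq (V * {set V}))
           (d : ds_state R V) (F : {set {set V}}),
      [/\ exec (fun i J => L (vdecode r vs i) (tdecode ts J))
               (fun i J => tL (vdecode r vs i) (tdecode ts J))
               p (input_store c vs es ts) t s,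
          (t <= B)%N,
          ds_run E c T r L (ds_init R T r) xs d,
          ds_backtrack d (r, T :\ r) F
        & outputs E r vs es ts s xs F].

(* Main.v *)
(* An admissible program must pay O(1) per attempted improvement of a label and
   O(k + log n) per settled label.  There are O(3^k n + 2^k m) attempts, since
   every merge of two labels at a vertex splits the non-root terminals into
   three parts, and at most 2^(k-1) n labels are settled.

   The queue is a multi-root hollow heap.  Decreasing a key inserts a fresh
   node of rank r - 2 that takes over all children of the old node but the two
   of largest rank r - 1 and r - 2; the old node stays behind, hollow.  As every
   node of rank r >= 2, full or hollow, has children of ranks r - 1 and r - 2,
   counting the nodes with weights 2^(rank / 2) from the children to the
   parents shows that the weights of the roots sum up to at most the number of
   nodes, which is at most 4^(k+1) n^2; so ranks are O(k + log n).  With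
   potential 3 #(hollow nodes) + 2 #(roots) + #(occupied slots), decreasing a
   key costs O(1) and extracting the minimum O(k + log n) amortized time.

   The lower bound is queried once per label, in advance.  The supersets needed
   for merging are found by listing the codes of the subsets of the complement
   with a doubling list, which takes time proportional to their number.
   Backtracking is a scan of the settled labels in reverse order: the
   predecessors of a label were settled before it. *)
Require Import Defs.
From mathcomp Require Import all_boot all_order all_algebra zify.
From mathcomp Require Import boolp reals constructive_ereal.

Set Implicit Arguments.
Unset Strict Implicit.
Unset Printing Implicit Defensive.

Import Order.TTheory GRing.Theory Num.Theory.
Local Open Scope ring_scope.

(** A bound of constant time per attempted improvement forbids copying a list of children when a key
    decreases. Each node therefore owns a block of [W] cells addressed by rank; the new node takes
    over the whole block of the old one, which moves to a fresh block with at most two meaningful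
    entries. So [W] can be a linear expression in n and k, although the rank bound involves log n.

    The forest is never built as an inductive object. It is described by a balance equation
    quantified over all weight functions on the nodes: indicator functions give parents and
    uniqueness, exponential weights give the rank bound.

    Of the queue cost per label, the share of k is absorbed by 3^k n because k 2^(k-1) <= 3^k; only
    the share of log n shows in the bound. *)

(** * Weakest preconditions with running time *)

(* Convertible to [upd] on [nat], but reducible by [cbn] at numerals. *)
Definition updn (B : Type) (f : nat -> B) (a : nat) (b : B) : nat -> B :=
  fun x => if eqn x a then b else f x.

Section Wp.
Variables (R : realType) (f : nat -> nat -> R) (g : nat -> nat -> nat).
Local Notation store := (store R).
Implicit Types (p q : com) (s : store) (Q : store -> nat -> Prop).

Definition wp p s Q := exists t s', exec f g p s t s' /\ Q s' t.

Lemma wp_mono p s Q Q' : (forall s' t, Q s' t -> Q' s' t) -> wp p s Q -> wp p s Q'.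
Proof. by move=> QQ [t [s' [e q]]]; exists t, s'; split=> //; exact: QQ. Qed.

Lemma wp_skip s Q : Q s 1%N -> wp Skip s Q.
Proof. by move=> h; exists 1%N, s; split=> //; constructor. Qed.

Lemma wp_nset x e s Q :
  Q (Store (updn (nvar s) x (neval s e)) (narr s) (rvar s) (rarr s)) (ncost e).+1 -> wp (NSet x e) s Q.
Proof. by move=> h; do 2 eexists; split; [constructor|exact h]. Qed.

Lemma wp_nput a i e s Q :
  Q (Store (nvar s) (updn (narr s) a (upd (narr s a) (neval s i) (neval s e)))
       (rvar s) (rarr s)) (ncost i + ncost e).+1 ->
  wp (NPut a i e) s Q.
Proof. by move=> h; do 2 eexists; split; [constructor|exact h]. Qed.

Lemma wp_rset x e s Q :
  Q (Store (nvar s) (narr s) (updn (rvar s) x (reval s e)) (rarr s)) (rcost e).+1 -> wp (RSet x e) s Q.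
Proof. by move=> h; do 2 eexists; split; [constructor|exact h]. Qed.

Lemma wp_rput a i e s Q :
  Q (Store (nvar s) (narr s) (rvar s)
       (updn (rarr s) a (upd (rarr s a) (neval s i) (reval s e)))) (ncost i + rcost e).+1 ->
  wp (RPut a i e) s Q.
Proof. by move=> h; do 2 eexists; split; [constructor|exact h]. Qed.

Lemma wp_query x v J s Q :
  Q (Store (nvar s) (narr s) (updn (rvar s) x (f (neval s v) (neval s J))) (rarr s))
    (ncost v + ncost J + g (neval s v) (neval s J)).+1 ->
  wp (Query x v J) s Q.
Proof. by move=> h; do 2 eexists; split; [constructor|exact h]. Qed.

Lemma wp_seq p q s Q :
  wp p s (fun s1 t1 => wp q s1 (fun s2 t2 => Q s2 (t1 + t2).+1)) ->
  wp (Seq p q) s Q.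
Proof.
move=> [t [s1 [e [t' [s' [e' h]]]]]]; do 2 eexists; split; last exact: h.
exact: exec_seq e e'.
Qed.

Lemma wp_if b p q s Q :
  (beval s b -> wp p s (fun s' t => Q s' (bcost b + t).+1)) ->
  (~~ beval s b -> wp q s (fun s' t => Q s' (bcost b + t).+1)) ->
  wp (If b p q) s Q.
Proof.
move=> h1 h2; case: (boolP (beval s b)) => hb.
  have [t [s' [e h]]] := h1 hb; do 2 eexists; split; last exact: h.
  by constructor; rewrite hb.
have [t [s' [e h]]] := h2 hb; do 2 eexists; split; last exact: h.
by constructor; rewrite (negbTE hb).
Qed.

(* [I s B]: B time units are still available. Every test of the guard consumes *)
(* some of them, so the budget is also what makes the loop terminate.          *)
Lemma wp_while b p (I : store -> nat -> Prop) s B Q :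
  I s B ->
  (forall s B, I s B -> beval s b ->
     wp p s (fun s' t => exists2 B', I s' B' & (bcost b + t + B' < B)%N)) ->
  (forall s' B', I s' B' -> ~~ beval s' b ->
     (bcost b < B')%N /\
     (forall t, (t + B' <= B + (bcost b).+1)%N -> Q s' t)) ->
  wp (While b p) s Q.
Proof.
move=> Is Hit Hex.
suff: wp (While b p) s (fun s' t => exists B', [/\ I s' B', ~~ beval s' b
          & (t + B' <= B + (bcost b).+1)%N]).
  apply: wp_mono => s' t [B' [I' nb le]].
  exact: (proj2 (Hex s' B' I' nb)).
have Hb : forall s' B', I s' B' -> ~~ beval s' b -> (bcost b < B')%N.
  by move=> s' B' I' nb; case: (Hex s' B' I' nb).
elim/ltn_ind: B s Is {Hex Q} => B IH s Is.
case: (boolP (beval s b)) => hb; last first.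
  exists (bcost b).+1, s; split; first exact: exec_while_exit.
  by exists B; split=> //; rewrite addnC.
have [t1 [s1 [e1 [B1 I1 lt1]]]] := Hit _ _ Is hb.
have ltB : (B1 < B)%N by lia.
have [t2 [s2 [e2 [B2 [I2 nb2 le2]]]]] := IH _ ltB _ I1.
exists (bcost b + t1 + t2).+1, s2; split; first exact: exec_while_iter hb e1 e2.
exists B2; split=> //; lia.
Qed.

Fixpoint nmod p (x : nat) : bool :=
  match p with
  | NSet y _ => x == y
  | Seq p q | If _ p q => nmod p x || nmod q x
  | While _ p => nmod p x
  | _ => false
  end.

Fixpoint namod p (x : nat) : bool :=
  match p with
  | NPut y _ _ => x == y
  | Seq p q | If _ p q => namod p x || namod q x
  | While _ p => namod p x
  | _ => false
  end.

Fixpoint ramod p (x : nat) : bool :=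
  match p with
  | RPut y _ _ => x == y
  | Seq p q | If _ p q => ramod p x || ramod q x
  | While _ p => ramod p x
  | _ => false
  end.

(** Real variables are left out: the program uses only number 0, as a scratch register that is set
    shortly before each use. The conditions are computable from the program text, so at concrete
    names they are discharged by [isT]. *)
Definition frame p s s' :=
  [/\ forall x, ~~ nmod p x -> nvar s' x = nvar s x,
      forall x, ~~ namod p x -> narr s' x = narr s x
    & forall x, ~~ ramod p x -> rarr s' x = rarr s x].

Lemma exec_frame p s t s' : exec f g p s t s' -> frame p s s'.
Proof.
elim=> {p s t s'}; do ?by [].
- by move=> s x e; split=> //= y; rewrite /upd => /negbTE->.
- by move=> s a i e; split=> //= y; rewrite /upd => /negbTE->.
- by move=> s a i e; split=> //= y; rewrite /upd => /negbTE->.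
- move=> p q s t s1 t' s' _ [h1 h2 h3] _ [k1 k2 k3].
  by split=> x /= /norP[a b]; rewrite ?k1 ?k2 ?k3 // ?h1 ?h2 ?h3.
- move=> b p q s t s' _; case: (beval s b) => -[h1 h2 h3];
  by split=> x /= /norP[A B]; rewrite ?h1 ?h2 ?h3.
- move=> b p s t s1 t' s' hb _ [h1 h2 h3] _ [k1 k2 k3].
  by split=> x /= A; rewrite ?k1 ?k2 ?k3 // ?h1 ?h2 ?h3.
Qed.

Lemma wp_frame p s Q :
  wp p s (fun s' t => frame p s s' -> Q s' t) -> wp p s Q.
Proof.
by move=> [t [s' [e h]]]; exists t, s'; split=> //; apply: h; exact: exec_frame e.
Qed.

Lemma frame_trans p s1 s2 s3 : frame p s1 s2 -> frame p s2 s3 -> frame p s1 s3.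
Proof.
move=> [h1 h2 h3] [k1 k2 k3].
by split=> x A; rewrite ?k1 ?k2 ?k3 // ?h1 ?h2 ?h3.
Qed.

Lemma frame_refl p s : frame p s s. Proof. by []. Qed.

(** The frame relation to the state before the loop is carried along, so invariants only have to
    speak of what the body writes. *)
Lemma wp_whilef b p (I : store -> nat -> Prop) s B Q :
  I s B ->
  (forall s1 B, I s1 B -> frame p s s1 -> beval s1 b ->
     wp p s1 (fun s' t => frame p s s' ->
        exists2 B', I s' B' & (bcost b + t + B' < B)%N)) ->
  (forall s' B', I s' B' -> frame p s s' -> ~~ beval s' b ->
     (bcost b < B')%N /\
     (forall t, (t + B' <= B + (bcost b).+1)%N -> Q s' t)) ->
  wp (While b p) s Q.
Proof.
move=> Is Hit Hex.
apply: (wp_while (I := fun s1 B => I s1 B /\ frame p s s1) (conj Is (frame_refl p s))).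
  move=> s1 B1 [I1 F1] b1; apply: wp_frame.
  apply: wp_mono (Hit _ _ I1 F1 b1) => s' t h F.
  have F' := frame_trans F1 F.
  by case: (h F') => B' I' lt; exists B'.
by move=> s' B' [I' F'] nb; apply: Hex.
Qed.

End Wp.

Ltac sred := cbn [nvar narr rvar rarr updn eqn neval reval beval ncost rcost bcost
  addn addn_rec Nat.add subn subn_rec].

Ltac step := cbv beta; lazymatch goal with
  | |- wp _ _ (Seq _ _) _ _ => apply: wp_seq
  | |- wp _ _ Skip _ _ => apply: wp_skip
  | |- wp _ _ (NSet _ _) _ _ => apply: wp_nset; sred
  | |- wp _ _ (NPut _ _ _) _ _ => apply: wp_nput; sred
  | |- wp _ _ (RSet _ _) _ _ => apply: wp_rset; sred
  | |- wp _ _ (RPut _ _ _) _ _ => apply: wp_rput; sred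
  | |- wp _ _ (Query _ _ _) _ _ => apply: wp_query; sred
  end.
Ltac steps := repeat step.

(** * Hollow heaps *)

Lemma updE (A : eqType) (B : Type) (f : A -> B) a b : upd f a b a = b.
Proof. by rewrite /upd eqxx. Qed.

Lemma updN (A : eqType) (B : Type) (f : A -> B) a b x : x != a -> upd f a b x = f x.
Proof. by rewrite /upd => /negbTE->. Qed.

Section Heap.
Variable R : realType.
Variable W : nat.

(* [nd x] is the current node of the item [x], and [it u], [rk u], [ky u] are   *)
(* the item, rank and key of the node [u]. Node [u] owns [W] cells of [hA] from *)
(* [bs u] on; the cell [bs u + i] holds its child of rank [i]. A node that is   *)
(* not current for its item is hollow: it has lost all children but those of    *)
(* the ranks [rk u - 1] and [rk u - 2]. Node 0 is a dummy of rank 0, current    *)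
(* for the items not yet inserted; [cn] and [nb] are the first node and cell    *)
(* not yet in use.                                                              *)
Record heap := Heap {
  nd : nat -> nat; it : nat -> nat; rk : nat -> nat; bs : nat -> nat;
  hA : nat -> nat; ky : nat -> R; cn : nat; nb : nat }.

Implicit Types (h : heap) (act fr : pred nat) (key : nat -> R) (L rts : seq nat).

Definition full h u := nd h (it h u) == u.
Definition lo h u := if full h u then 0%N else (rk h u - 2)%N.
Definition kid h u i := hA h (bs h u + i)%N.

Arguments full : simpl never.
Arguments lo : simpl never.
Arguments kid : simpl never.

(* [L] lists the nodes of the forest and [rts] its roots; the items in [act]    *)
(* are in the queue and those in [fr] were never inserted. [hi_sum] states that *)
(* every node is either a root or a child of exactly one node.                  *)
Record hinv act fr key h L rts : Prop := HInv {
  hi_uniq : uniq L;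
  hi_bd : forall u, u \in L -> (0 < u < cn h)%N;
  hi_sum : forall f : nat -> nat,
    (\sum_(u <- L) f u = \sum_(u <- rts) f u
       + \sum_(u <- L) \sum_(lo h u <= i < rk h u) f (kid h u i))%N;
  hi_kid : forall u i, u \in L -> (lo h u <= i < rk h u)%N ->
    rk h (kid h u i) = i /\ ky h u <= ky h (kid h u i);
  hi_reg : forall u v, (u < cn h)%N -> (v < cn h)%N -> u != v ->
    (bs h u + W <= bs h v)%N || (bs h v + W <= bs h u)%N;
  hi_nb : forall u, (u < cn h)%N -> (bs h u + W <= nb h)%N;
  hi_rk : forall u, u \in L -> (rk h u < W)%N;
  hi_0 : (0 < cn h)%N /\ rk h 0%N = 0%N;
  hi_act : forall x, act x -> [/\ nd h x \in L, it h (nd h x) = x & ky h (nd h x) = key x];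
  hi_fr : forall x, fr x -> nd h x = 0%N;
  hi_full : forall u, u \in L -> full h u -> act (it h u) }.

Lemma hinv_perm act fr key h L rts rts' :
  perm_eq rts rts' -> hinv act fr key h L rts -> hinv act fr key h L rts'.
Proof.
move=> pq [h1 h2 h3 h4 h5 h6 h7 h8 h9 h10 h11]; split=> // f.
by rewrite h3 (perm_big _ pq).
Qed.

Lemma hinv_ext act fr key act' fr' key' h L rts :
  act =1 act' -> fr =1 fr' -> (forall x, act x -> key x = key' x) ->
  hinv act fr key h L rts -> hinv act' fr' key' h L rts.
Proof.
move=> ea ef ek [h1 h2 h3 h4 h5 h6 h7 h8 h9 h10 h11]; split=> //.
- by move=> x; rewrite -ea => ax; rewrite -ek //; exact: h9.
- by move=> x; rewrite -ef; exact: h10.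
- by move=> u uL; rewrite -ea; exact: h11.
Qed.

Lemma sum_mem (s : seq nat) u : (0 < \sum_(x <- s) (x == u))%N = (u \in s).
Proof.
elim: s => [|a s IH]; first by rewrite big_nil.
by rewrite big_cons inE eq_sym addn_gt0 IH; case: eqP.
Qed.

(** * Consequences of the balance equation; removing and linking roots *)

Section Inv.
Variables (act fr : pred nat) (key : nat -> R) (h : heap) (L rts : seq nat).
Hypothesis H : hinv act fr key h L rts.

(** Typical use of [hi_sum]: for [f] the indicator of [u], the left side counts [u] among the nodes,
    the right side among the roots and the children. *)
Lemma rts_sub u : u \in rts -> u \in L.
Proof. by rewrite -!sum_mem (hi_sum H) addn_gt0 => ->. Qed.

Lemma kid_mem u i : u \in L -> (lo h u <= i < rk h u)%N -> kid h u i \in L.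
Proof.
move=> uL ib; rewrite -sum_mem (hi_sum H) addn_gt0; apply/orP; right.
rewrite (big_rem _ uL) /= addn_gt0; apply/orP; left.
rewrite (bigD1_seq i) ?iota_uniq ?mem_index_iota //=.
by rewrite eqxx.
Qed.

Lemma parent u : u \in L -> u \notin rts ->
  exists w i, [/\ w \in L, (lo h w <= i < rk h w)%N & kid h w i = u].
Proof.
move=> uL un; move: (uL); rewrite -sum_mem (hi_sum H) addn_gt0 sum_mem (negbTE un) /=.
rewrite lt0n sum_nat_seq_neq0 => /hasP[w wL] /=.
rewrite sum_nat_seq_neq0 => /hasP[i]; rewrite mem_index_iota => ib /=.
by rewrite eqb0 negbK => /eqP e; exists w, i.
Qed.

(** A parent has larger rank and no larger key than its child, and ranks stay below [W]; so the
    climb ends, at a root. Hence the minimum over all nodes is attained at a root. *)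
Lemma climb u : u \in L -> exists2 v, v \in rts & ky h v <= ky h u.
Proof.
move: {2}(W - rk h u)%N (leqnn (W - rk h u)%N) => d.
elim: d u => [|d IH] u le uL; first by move: (hi_rk H uL) le; lia.
case: (boolP (u \in rts)) => [ur|/(parent uL)[w [i [wL ib e]]]]; first by exists u.
have [r1 k1] := hi_kid H wL ib; rewrite e in r1 k1.
have [] := IH w; rewrite //; first by move: (hi_rk H uL); lia.
by move=> v vr kv; exists v => //; exact: le_trans k1.
Qed.

(** At the indicator of [r] the left side of [hi_sum] is 1 since [L] has no repetitions. The root
    sum already uses this up, so nothing is left for the children. *)
Lemma rts_uniq_not_kid r : r \in rts ->
  (\sum_(x <- rts) (x == r) = 1 /\
   \sum_(u <- L) \sum_(lo h u <= i < rk h u) (kid h u i == r) = 0)%N.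
Proof.
move=> rr; have := hi_sum H (fun x => x == r).
have -> : (\sum_(x <- L) (x == r) = 1)%N.
  rewrite (bigD1_seq r) ?(hi_uniq H) ?(rts_sub rr) //= eqxx big1_seq // => x.
  by case/andP => /negbTE->.
have : (0 < \sum_(x <- rts) (x == r))%N by rewrite sum_mem.
by case: (\sum_(x <- rts) _)%N => // -[] //=; case: (\sum_(x <- L) _)%N.
Qed.

Lemma not_kid r u i : r \in rts -> u \in L -> (lo h u <= i < rk h u)%N -> kid h u i != r.
Proof.
move=> /rts_uniq_not_kid[_ z] uL ib; apply/negP => /eqP e; move: z.
rewrite (big_rem _ uL) /= (bigD1_seq i) ?iota_uniq ?mem_index_iota //=.
by rewrite e eqxx.
Qed.

Lemma rts_uniq : uniq rts.
Proof.
apply/count_mem_uniq => x; case: (boolP (x \in rts)) => xr; last by apply/count_memPn.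
have [e _] := rts_uniq_not_kid xr; rewrite -[RHS]e -sum1_count big_mkcond /=.
by apply: eq_bigr => i _; case: eqP.
Qed.

(** With G(i) = 2^(i/2) rounded down in the exponent, ranks 0 and 1 have weight 1, and G(i+2) = 2
    G(i) <= G(i) + G(i+1) is covered by the two children that even a hollow node keeps. So the
    weight of all nodes is at most [size L] plus the weight of all children, and by [hi_sum] the
    weight of the roots is at most [size L]. *)
Lemma size_bound u : u \in rts -> (2 ^ (rk h u)./2 <= size L)%N.
Proof.
pose G r := (2 ^ r./2)%N => ur.
suff: (\sum_(x <- rts) G (rk h x) <= size L)%N.
  apply: leq_trans; rewrite (big_rem _ ur) /=; exact: leq_addr.
have E := hi_sum H (fun x => G (rk h x)).
suff: (\sum_(x <- L) G (rk h x) <= size L +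
  \sum_(x <- L) \sum_(lo h x <= i < rk h x) G (rk h (kid h x i)))%N by lia.
rewrite -sum1_size -big_split /= big_seq [leqRHS]big_seq; apply: leq_sum => x xL.
have -> : (\sum_(lo h x <= i < rk h x) G (rk h (kid h x i)) =
           \sum_(lo h x <= i < rk h x) G i)%N.
  by apply: eq_big_nat => i ib; have [-> _] := hi_kid H xL ib.
have lo2 : (lo h x <= rk h x - 2)%N by rewrite /lo; case: ifP.
move: (lo h x) (rk h x) lo2 => l [|[|r]] lr; rewrite /G //=.
rewrite big_nat_recr /=; last by lia.
rewrite big_nat_recr /=; last by lia.
rewrite expnS; have : (2 ^ r./2 <= 2 ^ (uphalf r))%N.
  by rewrite leq_exp2l // uphalf_half leq_addl.
lia.
Qed.

Lemma size_cn : (size L < cn h)%N.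
Proof.
have : {subset 0%N :: L <= iota 0 (cn h)}.
  move=> x; rewrite inE mem_iota /= add0n => /orP[/eqP->|/(hi_bd H)/andP[]//].
  by case: (hi_0 H).
move/uniq_leq_size; rewrite size_iota; apply.
rewrite /= (hi_uniq H) andbT; apply/negP => /(hi_bd H); by rewrite ltnn.
Qed.

(** Serves twice: for a hollow root, where [act'] is [act] because no active item has it as current
    node, and for the extracted minimum, where [act'] drops its item. *)
Lemma hinv_remove u act' : u \in rts ->
  (forall x, act' x = act x && (nd h x != u)) ->
  hinv act' fr key h (rem u L)
    ([seq kid h u i | i <- index_iota (lo h u) (rk h u)] ++ rem u rts).
Proof.
move=> ur ea; have uL := rts_sub ur.
have rL : {subset rem u L <= L} by exact: mem_rem.
case: (H) => h1 h2 h3 h4 h5 h6 h7 h8 h9 h10 h11; split=> //.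
- exact: rem_uniq.
- by move=> v /rL; exact: h2.
- move=> f; move: (h3 f); rewrite (big_rem _ uL) (big_rem u ur) /=.
  rewrite (big_rem _ uL (F := fun u => \sum_(lo h u <= i < rk h u) f (kid h u i))%N) /=.
  rewrite big_cat big_map /=; lia.
- by move=> v i /rL; exact: h4.
- by move=> v /rL; exact: h7.
- move=> x; rewrite ea => /andP[/h9[a b c] d]; split=> //.
  by rewrite mem_rem_uniq // inE d a.
- move=> v; rewrite mem_rem_uniq // inE => /andP[vu vL] fv.
  by rewrite ea h11 //= (eqP fv).
Qed.

Definition hlink u v r :=
  Heap (nd h) (it h) (upd (rk h) u r.+1) (bs h) (upd (hA h) (bs h u + r)%N v)
       (ky h) (cn h) (nb h).

(** Blocks are disjoint, so writing the cell of rank [r] of [u] changes no other child; as [u] is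
    full, its children occupy all ranks below [r], and [v] is simply the next one. *)
Lemma hlink_inv u v r B : u \in rts -> v \in rts -> u != v -> full h u ->
  rk h u = r -> rk h v = r -> ky h u <= ky h v ->
  (cn h <= 2 ^ B)%N -> (2 * B + 1 < W)%N ->
  hinv act fr key (hlink u v r) L (rem v rts).
Proof.
move=> ur vr uv fu ru rv kuv cB BW.
have uL := rts_sub ur; have vL := rts_sub vr.
have Bd x : x \in L -> (x < cn h)%N by case/(hi_bd H)/andP.
have loE x : x \in L -> lo (hlink u v r) x = lo h x.
  by move=> xL; rewrite /lo /full /=; case: ifP => // nf; rewrite updN //;
     apply/negP=> /eqP xu; rewrite /full xu -/(full h u) fu in nf.
have lou : lo h u = 0%N by rewrite /lo fu.
have rkE x : x != u -> rk (hlink u v r) x = rk h x by move=> xu; rewrite /= updN.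
have kidE x i : x \in L -> (i < W)%N -> (x != u) || (i != r) ->
    kid (hlink u v r) x i = kid h x i.
  move=> xL iW ne; rewrite /kid /= updN //; apply/negP => /eqP e.
  case: (eqVneq x u) ne => /= [xu|xu _]; first by subst x => /eqP; lia.
  have := hi_reg H (Bd _ xL) (Bd _ uL) xu.
  by have := hi_rk H uL; lia.
have kidu : kid (hlink u v r) u r = v by rewrite /kid /= updE.
have sumE (f : nat -> nat) : (\sum_(x <- L) f x = \sum_(x <- rem v rts) f x
       + \sum_(x <- L) \sum_(lo (hlink u v r) x <= i < rk (hlink u v r) x)
            f (kid (hlink u v r) x i))%N.
  rewrite (hi_sum H) (big_rem _ vr) /=.
  rewrite (big_rem _ uL) /= (big_rem _ uL) /=.
  rewrite (loE u uL) lou ru updE big_nat_recr //= kidu.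
  rewrite (@eq_big_nat _ _ _ 0 r (fun i => f (kid (hlink u v r) u i))
      (fun i => f (kid h u i))); last first.
    move=> i /andP[_ ir]; rewrite kidE // ?(ltn_eqF ir) ?orbT //.
    by have := hi_rk H uL; lia.
  rewrite (@eq_big_seq _ _ _ _ (rem u L)
     (fun x => \sum_(lo (hlink u v r) x <= i < upd (rk h) u r.+1 x)
        f (kid (hlink u v r) x i))
     (fun x => \sum_(lo h x <= i < rk h x) f (kid h x i)))%N; first by rewrite -addnA addnCA; congr (_ + _)%N; rewrite (addnC _ (f v)) -!addnA.
  move=> x; rewrite mem_rem_uniq ?(hi_uniq H) // inE => /andP[xu xL].
  rewrite loE // updN //; apply: eq_big_nat => i /andP[_ ib].
  by rewrite kidE // ?xu //; have := hi_rk H xL; lia.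
have rkle : forall x, x \in L -> x != u -> (rk (hlink u v r) x < W)%N.
  by move=> x xL xu; rewrite rkE //; exact: (hi_rk H).
have kidok : forall x i, x \in L ->
    (lo (hlink u v r) x <= i < rk (hlink u v r) x)%N ->
    rk (hlink u v r) (kid (hlink u v r) x i) = i /\
    ky (hlink u v r) x <= ky (hlink u v r) (kid (hlink u v r) x i).
  move=> x i xL; rewrite loE //; case: (eqVneq x u) => [xu|xu].
    rewrite xu /= updE => ib; have [->|ir] := eqVneq i r.
      by rewrite kidu updN // eq_sym.
    have ib' : (lo h u <= i < rk h u)%N by lia.
    have := hi_rk H uL => rW; rewrite kidE // ?ir ?orbT //; last by lia.
    have nk := not_kid ur uL ib'.
    by rewrite /= updN //; exact: hi_kid H _ _ uL ib'.
  rewrite rkE // => ib; rewrite kidE ?xu //; last by have := hi_rk H xL; lia.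
  rewrite rkE; first exact: hi_kid H _ _ xL ib.
  exact: not_kid ur xL ib.
case: (H) => h1 h2 h3 h4 h5 h6 h7 h8 h9 h10 h11; split=> //.
- move=> x xL; case: (eqVneq x u) => [->|xu]; last exact: rkle.
  rewrite /= updE.
  (* The new rank must still fit into the block: [size_bound] gives r/2 < B, hence r + 1 <= 2B <
     W. *)
  have : (2 ^ r./2 < 2 ^ B)%N.
    by rewrite -ru; apply: leq_trans cB; apply: leq_ltn_trans size_cn; exact: size_bound.
  by rewrite ltn_exp2l //; lia.
- split; first by case: h8.
  rewrite /= updN; first by case: h8.
  by have := hi_bd H uL; lia.
Qed.

End Inv.

(** The new node [v] gets the old block of [u] and [u] gets the fresh one at [nb h], so only two
    cells are copied. For [r < 2] the truncated subtractions make both writes hit cell 0, which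
    holds a child of [u] only if [r = 1], and then the right one. *)
Definition hdec h x a :=
  let v := cn h in let u := nd h x in let r := rk h u in
  let A1 := upd (hA h) (nb h + (r - 1))%N (hA h (bs h u + (r - 1))%N) in
  Heap (upd (nd h) x v) (upd (it h) v x) (upd (rk h) v (r - 2)%N)
    (upd (upd (bs h) v (bs h u)) u (nb h))
    (upd A1 (nb h + (r - 2))%N (A1 (bs h u + (r - 2))%N))
    (upd (ky h) v a) (cn h).+1 (nb h + W)%N.

End Heap.

Arguments full : simpl never.
Arguments lo : simpl never.
Arguments kid : simpl never.

(** * Insertion and decrease of a key *)

Section HeapDec.
Variables (R : realType) (W : nat).
Local Notation heap := (heap R).
Local Notation hinv := (hinv W).
Local Notation hdec := (hdec W).
Implicit Types h : heap.

Section Dec.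
Variables (act fr : pred nat) (key : nat -> R) (h : heap) (L rts : seq nat).
Variables (x : nat) (a : R).
Hypothesis H : hinv act fr key h L rts.
Hypotheses (W2 : (1 < W)%N) (afx : act x || fr x) (ax : act x -> a <= key x).

Let h' := hdec h x a.
Let u := nd h x.
Let v := cn h.
Let r := rk h u.

(** A first insertion is treated as a decrease whose old node is the dummy 0 of rank 0, so both
    cases run through the same assignments. *)
Let uP : (u \in L /\ it h u = x /\ ky h u = key x /\ act x) \/ (u = 0%N /\ r = 0%N).
Proof.
case/orP: afx => [A|/(hi_fr H) e]; first by left; case: (hi_act H A).
by right; rewrite /r /u e; case: (hi_0 H).
Qed.

Let uv : (u < v)%N.
Proof.
case: uP => [[uL _]|[-> _]]; first by case/andP: (hi_bd H uL).
by case: (hi_0 H).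
Qed.

Let rW : (r < W)%N.
Proof. by case: uP => [[uL _]|[_ ->]]; [exact: (hi_rk H)|lia]. Qed.

Let Lv w : w \in L -> (w < v)%N. Proof. by case/(hi_bd H)/andP. Qed.

Let full_v : full h' v.
Proof. by rewrite /full /= !updE. Qed.

Let full_L w : w \in L -> full h' w = full h w && (w != u).
Proof.
move=> wL; rewrite /full /= (@updN _ _ (it h)); last by have := Lv wL; lia.
rewrite {1}/upd; case: (eqVneq (it h w) x) => [e|ne].
  rewrite e -/u (eq_sym u w) andbN; apply/negbTE; have := Lv wL; rewrite /v; lia.
case: (eqVneq w u) => [wu|]; last by rewrite andbT.
rewrite andbF; apply/negP => /eqP e; move: ne.
by case: uP => [[_ [ix _]]|[e0 _]]; [rewrite wu ix eqxx|have := hi_bd H wL; lia].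
Qed.

Let lo_L w : w \in L -> w != u -> lo h' w = lo h w.
Proof.
move=> wL wu; rewrite /lo full_L // wu andbT /= updN //.
by have := Lv wL; rewrite -/v; lia.
Qed.

Let rk_L w : w \in L -> rk h' w = rk h w.
Proof. by move=> wL; rewrite /= updN //; have := Lv wL; rewrite -/v; lia. Qed.

Let kid_L w i : w \in L -> w != u -> (i < W)%N -> kid h' w i = kid h w i.
Proof.
move=> wL wu iW; have wv := Lv wL; rewrite /kid /= (@updN _ _ (upd (bs h) _ _)) //.
rewrite (@updN _ _ (bs h)); last by rewrite -/v; lia.
have := hi_nb H wv => nw; rewrite updN; last by lia.
by rewrite updN //; lia.
Qed.

Let kid_v i : (i < W)%N -> kid h' v i = kid h u i.
Proof.
move=> iW; rewrite /kid /= (@updN _ _ (upd (bs h) _ _)); last by rewrite -/u; lia.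
rewrite updE -/u; have := hi_nb H uv => nw; rewrite updN; last by lia.
by rewrite updN //; lia.
Qed.

Let kid_u i : (r - 2 <= i < r)%N -> kid h' u i = kid h u i.
Proof.
move=> ir; have nw := hi_nb H uv; rewrite /kid /= updE -/u -/r.
case: (eqVneq i (r - 2)%N) => [->|ne].
  rewrite updE; case: (eqVneq (bs h u + (r - 2))%N (nb h + (r - 1))%N) => [e|ne]; first lia.
  by rewrite updN.
rewrite updN; last by lia.
have -> : i = (r - 1)%N by lia.
by rewrite updE.
Qed.

Let lo_u : u \in L -> lo h' u = (r - 2)%N.
Proof. by move=> uL; rewrite /lo full_L // eqxx andbF rk_L. Qed.

Let lo_u0 : u \in L -> lo h u = 0%N.
Proof.
case: uP => [[uL [iu _]] _|[e _] uL]; first by rewrite /lo /full iu eqxx.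
by have := hi_bd H uL; lia.
Qed.

Let sum' (f : nat -> nat) :
  (\sum_(w <- v :: L) f w = \sum_(w <- v :: rts) f w
       + \sum_(w <- v :: L) \sum_(lo h' w <= i < rk h' w) f (kid h' w i))%N.
Proof.
rewrite !big_cons {1}/lo full_v (hi_sum H) /= updE -/u -/r.
have rest (s : seq nat) : {subset s <= L} -> (u \notin s) ->
    (\sum_(w <- s) \sum_(lo h' w <= i < rk h' w) f (kid h' w i) =
     \sum_(w <- s) \sum_(lo h w <= i < rk h w) f (kid h w i))%N.
  move=> sL us; apply: eq_big_seq => w ws; have wL := sL _ ws.
  have wu : w != u by apply: contraNneq us => <-.
  rewrite lo_L // rk_L //; apply: eq_big_nat => i /andP[_ ib].
  by rewrite kid_L //; have := hi_rk H wL; lia.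
case: (boolP (u \in L)) => [uL|uL].
  rewrite (big_rem _ uL) [in RHS](big_rem _ uL) /= rest; first last.
  - by rewrite mem_rem_uniqF ?(hi_uniq H).
  - exact: mem_rem.
  rewrite lo_u // lo_u0 // updN; last by rewrite -/v; lia.
  (* The children that [u] had are split at rank [r - 2]: the lower ones are now counted under [v],
     the two top ones remain under [u]. *)
  rewrite -/r (@big_cat_nat _ _ _ (r - 2)%N) //=; last by lia.
  rewrite (@eq_big_nat _ _ _ 0 (r - 2) (fun i => f (kid h' v i)) (fun i => f (kid h u i))); last first.
    by move=> i ib; rewrite kid_v //; move: rW; lia.
  rewrite (@eq_big_nat _ _ _ (r - 2) r (fun i => f (kid h' u i)) (fun i => f (kid h u i))); last first.
    by move=> i ib; rewrite kid_u.
  by rewrite -!addnA.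
rewrite rest //.
case: uP => [[uL' _]|[_ ->]]; first by rewrite uL' in uL.
by rewrite big_geq // addnA.
Qed.

Lemma hdec_inv : hinv (upd act x true) (upd fr x false) (upd key x a) h'
   (v :: L) (v :: rts).
Proof.
split.
- by rewrite /= (hi_uniq H) andbT; apply/negP => /Lv; rewrite ltnn.
- move=> w; rewrite inE => /orP[/eqP->|/(hi_bd H)] /=; first by rewrite ltnSn; have := uv; lia.
  by lia.
- exact: sum'.
- move=> w i; rewrite inE; case: (eqVneq w v) => [-> _|wv]; last rewrite orFb => wL.
    rewrite /lo full_v /= updE -/u -/r => ib.
    rewrite kid_v; last by move: rW; lia.
    case: uP => [[uL [iu [ku Ax]]]|[_ r0]]; last by rewrite r0 in ib.
    have ib' : (lo h u <= i < rk h u)%N by rewrite lo_u0 // -/r; lia.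
    have [e k] := hi_kid H uL ib'; have kL := kid_mem H uL ib'.
    split; first by rewrite updN // -/v; have := Lv kL; lia.
    rewrite updE updN; last by rewrite -/v; have := Lv kL; lia.
    by apply: le_trans (ax Ax) _; rewrite -ku.
  rewrite rk_L //; case: (eqVneq w u) wL => [-> uL|wu wL].
    rewrite lo_u // -/r => ib; rewrite kid_u //.
    have ib' : (lo h u <= i < rk h u)%N by rewrite lo_u0 // -/r; lia.
    have [e k] := hi_kid H uL ib'; have kL := kid_mem H uL ib'.
    split; first by rewrite rk_L.
    by rewrite /= !updN //; rewrite -/v; have := Lv kL; have := Lv uL; lia.
  rewrite lo_L // => ib; rewrite kid_L //; last by have := hi_rk H wL; lia.
  have [e k] := hi_kid H wL ib; have kL := kid_mem H wL ib.
  split; first by rewrite rk_L.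
  by rewrite /= !updN //; rewrite -/v; have := Lv kL; have := Lv wL; lia.
- have old w z : (w < v)%N -> (z < v)%N -> w != z ->
    (bs h w + W <= bs h z)%N || (bs h z + W <= bs h w)%N by exact: (hi_reg H).
  have nbw w : (w < v)%N -> (bs h w + W <= nb h)%N by exact: (hi_nb H).
  move=> w z; rewrite /= !ltnS -/v => wv zv wz.
  rewrite /upd -/u; have := uv.
  case: (eqVneq w u) => wu; case: (eqVneq z u) => zu; [lia| | |].
  + case: (eqVneq z v) => zv' uv'; first by apply/orP; right; apply: nbw.
    by apply/orP; right; apply: nbw; lia.
  + case: (eqVneq w v) => wv' uv'; first by apply/orP; left; apply: nbw.
    by apply/orP; left; apply: nbw; lia.
  + case: (eqVneq w v) => wv'; case: (eqVneq z v) => zv' uv'; [lia| | |].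
    * by apply: old => //; [lia|rewrite eq_sym].
    * by apply: old => //; lia.
    * by apply: old => //; lia.
- have nbw w : (w < v)%N -> (bs h w + W <= nb h)%N by exact: (hi_nb H).
  move=> w; rewrite /= ltnS -/v /upd -/u => wv.
  case: (eqVneq w u) => wu //; case: (eqVneq w v) => wv'.
    by apply: leq_trans (nbw _ uv) _; rewrite leq_addr.
  by apply: leq_trans (nbw w _) _; [lia|rewrite leq_addr].
- move=> w; rewrite inE => /orP[/eqP->|wL]; last by rewrite rk_L // (hi_rk H).
  by rewrite /= updE -/u -/r; move: rW; lia.
- split=> //=; rewrite updN; first by case: (hi_0 H).
  by rewrite -/v; move: uv; lia.
- move=> y; rewrite /= /upd; case: (eqVneq y x) => [-> _|yx Ay].
    by rewrite /= !eqxx inE eqxx.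
  have [yL iy ky'] := hi_act H Ay.
  by rewrite -/v (ltn_eqF (Lv yL)) inE yL orbT.
- move=> y; rewrite /= /upd; case: (eqVneq y x) => [//|yx]; exact: (hi_fr H).
- move=> w; rewrite inE => /orP[/eqP-> _|wL]; first by rewrite /= !updE.
  rewrite full_L // => /andP[fw wu]; rewrite /= (@updN _ _ (it h)); last first.
    by rewrite -/v; have := Lv wL; lia.
  by rewrite /upd; case: eqP => // _; exact: (hi_full H).
Qed.

Lemma hdec_count :
  (count (fun w => ~~ full h' w) (v :: L) <= (count (fun w => ~~ full h w) L).+1)%N.
Proof.
rewrite /= full_v add0n.
have -> : count (fun w => ~~ full h' w) L =
          count (predU (fun w => ~~ full h w) (pred1 u)) L.
  by apply: eq_in_count => w wL /=; rewrite full_L // negb_and negbK.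
have := count_predUI (fun w => ~~ full h w) (pred1 u) L.
have : (count_mem u L <= 1)%N by rewrite count_uniq_mem ?(hi_uniq H) //; case: (_ \in _).
move=> h1 h2; rewrite -addn1.
apply: leq_trans (leq_add (leqnn _) h1); rewrite -h2; exact: leq_addr.
Qed.

End Dec.

End HeapDec.

(** * Codes of vertices, terminal sets and labels *)

Section Codes.
Local Open Scope nat_scope.

Section Binary.

Definition bsum (b : nat -> bool) n := \sum_(0 <= j < n) b j * 2 ^ j.

Lemma bsumS b n : bsum b n.+1 = bsum b n + b n * 2 ^ n.
Proof. by rewrite /bsum big_nat_recr. Qed.

Lemma bsumSl b n : bsum b n.+1 = b 0 + 2 * bsum (b \o succn) n.
Proof.
rewrite /bsum big_nat_recl // expn0 muln1; congr (_ + _).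
by rewrite big_distrr /=; apply: eq_bigr => i _; rewrite expnS mulnCA.
Qed.

Lemma bsum_lt b n : bsum b n < 2 ^ n.
Proof.
elim: n => [|n IH]; first by rewrite /bsum big_geq.
by rewrite bsumS expnS; case: (b n); rewrite ?mul0n ?mul1n; lia.
Qed.

Lemma bsum_bit b n j : j < n -> odd (bsum b n %/ 2 ^ j) = b j.
Proof.
elim: n j b => [|n IH] [|j] b // jn; rewrite bsumSl.
  by rewrite expn0 divn1 oddD oddM /= addbF; case: (b 0).
rewrite expnS divnMA (_ : (b 0 + 2 * _) %/ 2 = bsum (b \o succn) n) ?IH //.
by rewrite addnC mulnC divnMDl //; case: (b 0); rewrite addn0.
Qed.

(** This is how the program reads binary digits without division: from the top, by comparing with a
    power of two and subtracting it. *)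
Lemma bsum_ge b n : (2 ^ n <= bsum b n.+1) = b n.
Proof.
by rewrite bsumS; have := bsum_lt b n; case: (b n); rewrite ?mul1n ?mul0n; lia.
Qed.

Lemma bsum1 n : bsum xpredT n = 2 ^ n - 1.
Proof.
elim: n => [|n IH]; first by rewrite /bsum big_geq.
have p : 0 < 2 ^ n by rewrite expn_gt0.
by rewrite bsumS IH expnS mul1n; lia.
Qed.

End Binary.

(** The binomial theorem for (1 + 2)^|S|, obtained by expanding a product over all vertices with
    factor 1 + 2 inside [S] and 0 + 1 outside; the zeros kill the terms of sets not contained in
    [S]. This is the source of 3^k in the running time. *)
Lemma sum_subsets (V : finType) (S : {set V}) :
  \sum_(I : {set V} | I \subset S) 2 ^ #|S :\: I| = 3 ^ #|S|.
Proof.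
pose F (i : V) := nat_of_bool (i \in S); pose G (i : V) := if i \in S then 2 else 1.
have -> : 3 ^ #|S| = \prod_i (F i + G i).
  rewrite -prod_nat_const [RHS](bigID (mem S)) /= [X in _ * X]big1 ?muln1.
    by apply: eq_bigr => i iS; rewrite /F /G iS.
  by move=> i /negbTE iS; rewrite /F /G iS.
rewrite bigA_distr [RHS](bigID (fun I : {set V} => I \subset S)) /= [X in _ + X]big1 ?addn0.
  apply: eq_bigr => I IS; rewrite -prod_nat_const big_mkcond /=.
  apply: eq_bigr => i _; rewrite /F /G inE; case: (boolP (i \in I)) => //= iI.
  by rewrite (subsetP IS).
move=> I /subsetPn[i iI iS]; rewrite (bigD1 i) //= iI /F (negbTE iS).
by rewrite mul0n.
Qed.

(** * Codes of terminal sets and labels; neighbour lists *)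

Section Encode.
Variables (V : finType) (E : {set {set V}}) (T : {set V}) (r : V).
Variables (vs : seq V) (es : seq (V * V)) (ts : seq V).
Hypotheses (SG : simple_graph E) (rT : r \in T) (pres : presents E T r vs es ts).

Local Notation k := #|T|.
Local Notation T' := (T :\ r).
Local Notation vcode := (vcode vs).
Local Notation tcode := (tcode ts).
Implicit Types (I J : {set V}) (t v w : V).

Lemma vs_uniq : uniq vs. Proof. by case: pres => p _ _; rewrite (perm_uniq p) enum_uniq. Qed.
Lemma mem_vs v : v \in vs. Proof. by case: pres => p _ _; rewrite (perm_mem p) mem_enum. Qed.
Lemma size_vs : size vs = #|V|. Proof. by case: pres => p _ _; rewrite (perm_size p) cardE. Qed.
Lemma vcode_lt v : vcode v < #|V|. Proof. by rewrite -size_vs index_mem mem_vs. Qed.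
Lemma vcodeK v : vdecode r vs (vcode v) = v. Proof. by rewrite /vdecode nth_index ?mem_vs. Qed.
Lemma vcode_inj : injective vcode. Proof. exact: can_inj vcodeK. Qed.
Lemma vdecodeK i : i < #|V| -> vcode (vdecode r vs i) = i.
Proof. by move=> lt; rewrite /vcode index_uniq ?vs_uniq ?size_vs. Qed.

Lemma size_es : size es = #|E|.
Proof. by case: pres => _ p _; rewrite -(size_map (@edge_of V)) (perm_size p) cardE. Qed.
Lemma uniq_es : uniq (map (@edge_of V) es).
Proof. by case: pres => _ p _; rewrite (perm_uniq p) enum_uniq. Qed.
Lemma mem_es e : (e \in map (@edge_of V) es) = (e \in E).
Proof. by case: pres => _ p _; rewrite (perm_mem p) mem_enum. Qed.

Lemma ts_props : [/\ uniq ts, ts =i T, size ts = k, index r ts = k.-1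
  & forall t, t \in T' -> index t ts < k.-1].
Proof.
case: pres => _ _ [ts' p e]; have kE : k = #|T'|.+1 by rewrite (cardsD1 r T) rT.
have sz : size ts' = k.-1 by rewrite (perm_size p) -cardE kE.
have rn : r \notin ts' by rewrite (perm_mem p) mem_enum !inE eqxx.
split.
- by rewrite e rcons_uniq rn (perm_uniq p) enum_uniq.
- move=> t; rewrite e mem_rcons inE (perm_mem p) mem_enum !inE.
  by case: eqVneq => // ->.
- by rewrite e size_rcons sz kE.
- by rewrite e -cats1 index_cat (negbTE rn) /= eqxx addn0 sz.
- move=> t tT; rewrite e -cats1 index_cat (perm_mem p) mem_enum tT -sz index_mem.
  by rewrite (perm_mem p) mem_enum.
Qed.

Lemma k_gt0 : 0 < k. Proof. by apply/card_gt0P; exists r. Qed.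

Lemma tcodeE I : tcode I = bsum (fun j => nth r ts j \in I) k.
Proof.
have [u _ sz _ _] := ts_props.
rewrite /tcode (big_nth r) sz /bsum big_mkcond /=; apply: eq_big_nat => j jk.
by rewrite index_uniq ?sz //; case: ifP; rewrite ?mul1n ?mul0n.
Qed.

Lemma tcodeE' I : I \subset T' -> tcode I = bsum (fun j => nth r ts j \in I) k.-1.
Proof.
move=> IT; rewrite tcodeE -{1}(prednK k_gt0) bsumS.
have [u _ sz ir _] := ts_props.
have -> : nth r ts k.-1 = r by rewrite -ir nth_index //; rewrite -index_mem ir sz; have := k_gt0; lia.
case: (boolP (r \in I)) => [/(subsetP IT)|_]; last by rewrite mul0n addn0.
by rewrite !inE eqxx.
Qed.

Lemma tcode_lt I : I \subset T' -> tcode I < 2 ^ k.-1.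
Proof. by move=> IT; rewrite tcodeE' // bsum_lt. Qed.

Lemma tcodeK I : I \subset T -> tdecode ts (tcode I) = I.
Proof.
move=> IT; have [u tm sz _ _] := ts_props.
apply/setP => t; rewrite !inE tm; case: (boolP (t \in T)) => tT /=; last first.
  by apply/esym/negbTE; apply: contraNN tT; exact: (subsetP IT).
have tts : t \in ts by rewrite tm.
by rewrite tcodeE bsum_bit ?nth_index // -sz index_mem.
Qed.

(** Makes the merge of two labels at a vertex cost a single addition, and yields complements as
    differences in [tcode_compl]. *)
Lemma tcodeU I J : [disjoint I & J] -> tcode (I :|: J) = tcode I + tcode J.
Proof.
move=> dis; rewrite /tcode !(big_mkcond (fun t => t \in _)) -big_split /=.
apply: eq_bigr => t _; rewrite inE; case: (boolP (t \in I)) => tI //=.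
by rewrite (disjointFr dis tI) addn0.
Qed.

Lemma tcode_T : tcode T = 2 ^ k - 1.
Proof.
have [u tm sz _ _] := ts_props.
rewrite tcodeE -bsum1; apply: eq_big_nat => j /andP[_ jk].
by rewrite -tm mem_nth ?sz.
Qed.

Lemma tcode_compl I : I \subset T -> tcode (T :\: I) = 2 ^ k - 1 - tcode I.
Proof.
move=> IT; rewrite -tcode_T -{2}(setID T I) (setIidPr IT) tcodeU ?addKn //.
by rewrite disjoint_sym disjoints_subset setDE subsetIr.
Qed.

Lemma tcode1 t : t \in T -> tcode [set t] = 2 ^ index t ts.
Proof.
move=> tT; have [u tm _ _ _] := ts_props.
rewrite /tcode big_mkcond (bigD1_seq t) ?tm //= set11 big1 ?addn0 // => x.
by rewrite inE => /negbTE->.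
Qed.

Lemma tcode0 : tcode set0 = 0.
Proof. by rewrite /tcode big1 // => t; rewrite inE. Qed.

Lemma tcode_T' : tcode T' = 2 ^ k.-1 - 1.
Proof.
have [u tm sz ir _] := ts_props.
rewrite tcodeE' // -bsum1; apply: eq_big_nat => j /andP[_ jk].
rewrite !inE -tm mem_nth ?sz ?andbT; last by lia.
suff -> : nth r ts j != r by [].
apply/negP => /eqP e; have := index_uniq r (i := j) _ u; rewrite sz e ir => h.
by have := h (leq_trans jk (leq_pred _)); lia.
Qed.

Definition lcode (x : V * {set V}) := vcode x.1 * 2 ^ k.-1 + tcode x.2.

Definition valid (x : V * {set V}) := x.2 \subset T'.

Lemma sub_T I : I \subset T' -> I \subset T.
Proof. by move/subset_trans; apply; exact: subD1set. Qed.

Lemma lcode_inj x y : valid x -> valid y -> lcode x = lcode y -> x = y.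
Proof.
case: x y => v I [w J]; rewrite /valid /lcode /= => IT JT e.
have p : 0 < 2 ^ k.-1 by rewrite expn_gt0.
have eq1 := congr1 (fun q => q %/ 2 ^ k.-1) e.
have eq2 := congr1 (fun q => q %% 2 ^ k.-1) e.
rewrite /= !divnMDl // !(divn_small (tcode_lt _)) // !addn0 in eq1.
rewrite /= !modnMDl !(modn_small (tcode_lt _)) // in eq2.
by rewrite (vcode_inj eq1) -(tcodeK (sub_T IT)) eq2 tcodeK // sub_T.
Qed.

Lemma lcode_lt x : valid x -> lcode x < #|V| * 2 ^ k.-1.
Proof.
move=> /tcode_lt lt; rewrite /lcode; have := vcode_lt x.1; move: (2 ^ _) lt => K lt lv.
apply: leq_trans (leq_mul lv (leqnn K)); rewrite mulSn addnC; lia.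
Qed.

Lemma card_E : 2 * #|E| <= #|V| ^ 2.
Proof.
have : #|E| <= 'C(#|V|, 2).
  rewrite -card_draws; apply: subset_leq_card; apply/subsetP => e eE.
  by rewrite inE (SG eE) eqxx.
rewrite bin2; have := odd_double_half (#|V| * #|V|.-1); rewrite -mul2n.
move: (#|V|) => n; rewrite expnS expn1; have : n * n.-1 <= n * n by rewrite leq_mul2l leq_pred orbT.
lia.
Qed.

(* The neighbours of [v] along the first [i] edges, with the edges' indices, in *)
(* the order in which [adjacency_loop] links them.                              *)
Fixpoint nbl i v : seq (V * nat) :=
  if i is j.+1 then
    let p := nth (r, r) es j in
    (if p.2 == v then [:: (p.1, j)] else [::]) ++
    (if p.1 == v then [:: (p.2, j)] else [::]) ++ nbl j v
  else [::].

Lemma nblP i v w j : i <= size es -> (w, j) \in nbl i v ->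
  j < i /\ [set v; w] = edge_of (nth (r, r) es j).
Proof.
elim: i => // i IH lt /=; rewrite !mem_cat => /or3P[||/IH[]]; last 2 first.
- exact: ltnW.
- by move=> ji e; split=> //; exact: leq_trans ji _.
- case: eqP => // <-; rewrite inE => /eqP[-> ->]; split=> //.
  by rewrite /edge_of setUC.
- by case: eqP => // <-; rewrite inE => /eqP[-> ->].
Qed.

Lemma mem_nbl i v w j : j < i -> [set v; w] = edge_of (nth (r, r) es j) ->
  (w, j) \in nbl i v.
Proof.
elim: i => // i IH; rewrite ltnS leq_eqVlt => /orP[/eqP<-|ji] e; last first.
  by rewrite /= !mem_cat IH ?orbT.
rewrite /= !mem_cat; case: (nth _ _ _) e => a b; rewrite /edge_of /= => e.
suff [[-> ->]|[-> ->]] : (v = a /\ w = b) \/ (v = b /\ w = a).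
- by rewrite eqxx inE eqxx ?orbT.
- by rewrite eqxx inE eqxx.
have := set22 v w; rewrite e !inE; have := set21 v w; rewrite e !inE.
have := set21 a b; rewrite -e !inE; have := set22 a b; rewrite -e !inE.
by do 4 (case/orP=> /eqP ?); subst; auto.
Qed.

Lemma edge_of_es j : j < size es -> edge_of (nth (r, r) es j) \in E.
Proof. by move=> lt; rewrite -mem_es map_f // mem_nth. Qed.

Lemma index_edge j : j < size es ->
  index (edge_of (nth (r, r) es j)) [seq edge_of p | p <- es] = j.
Proof.
by move=> lt; rewrite -(nth_map _ set0) // index_uniq ?size_map // uniq_es.
Qed.

Lemma edge_neq v w : [set v; w] \in E -> v != w.
Proof. by move/SG; rewrite cards2; case: eqP. Qed.

(** A neighbour listed twice would give one edge two positions in the duplicate-free list [es],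
    unless both entries came from the two ends of a loop, which a simple graph excludes. *)
Lemma nbl_uniq i v : i <= size es -> uniq (map fst (nbl i v)).
Proof.
elim: i => // i IH lt /=; have {}IH := IH (ltnW lt).
have := edge_of_es lt; have := @nblP i v _ _ (ltnW lt).
case E1: (nth _ _ _) => [a b] nP; rewrite /edge_of /= => /edge_neq ab.
have notin w : [set v; w] = [set a; b] -> w \notin map fst (nbl i v).
  move=> e; apply/negP => /mapP[[w' j] /nP[ji e'] /= we].
  have := index_edge (ltn_trans ji lt); rewrite -e' -we e -[[set a; b]]/(edge_of (a, b)) -E1.
  by rewrite index_edge // => ij; rewrite ij ltnn in ji.
case: (eqVneq b v) => [bv|bv]; case: (eqVneq a v) => [av|av] /=.
- by rewrite av bv eqxx in ab.
- by rewrite IH andbT notin // -bv setUC.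
- by rewrite IH andbT notin // -av.
- by [].
Qed.

Lemma nbl_perm v : perm_eq (map fst (nbl (size es) v)) (enum [set w | [set v; w] \in E]).
Proof.
apply: uniq_perm; rewrite ?enum_uniq ?nbl_uniq // => w; rewrite mem_enum inE.
apply/mapP/idP => [[[w' j] /nblP[//|lt e] /= ->]|]; first by rewrite e edge_of_es.
rewrite -mem_es => /mapP[p pes e].
exists (w, index p es) => //; apply: mem_nbl; first by rewrite index_mem.
by rewrite nth_index.
Qed.

Lemma nbl_index v w j : (w, j) \in nbl (size es) v ->
  [set v; w] \in E /\ index [set v; w] [seq edge_of p | p <- es] = j.
Proof. by case/nblP => // lt e; rewrite e edge_of_es // index_edge. Qed.

(** Double counting of the ends of edges. *)
Lemma nbl_sum : \sum_v size (nbl (size es) v) = 2 * #|E|.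
Proof.
rewrite -size_es; elim: (size es) => [|i IH]; first by rewrite big1.
have one (z : V) : \sum_v (z == v) = 1.
  by rewrite (bigD1 z) //= eqxx big1 // => v; rewrite eq_sym => /negbTE->.
pose p := nth (r, r) es i.
have -> : 2 * i.+1 = \sum_v (p.2 == v) + (\sum_v (p.1 == v) + 2 * i).
  by rewrite !one; lia.
rewrite -IH -!big_split /=; apply: eq_bigr => v _; rewrite !size_cat -/p.
by case: ifP => _; case: ifP.
Qed.

End Encode.

End Codes.

(** * Invariants of the algorithm *)

Section Runs.
Variables (R : realType) (V : finType) (E : {set {set V}}) (c : {set V} -> R).
Variables (T : {set V}) (r : V) (L : V -> {set V} -> R).
Local Notation label := (V * {set V})%type.
Local Notation state := (ds_state R V).
Local Notation T' := (T :\ r).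
Implicit Types (d : state) (x y : label) (xs : seq label).

Definition reached d x := (x \in dN d) || (x \in dP d).

(** The inequalities matter when [I] and [J] coincide: the pair is then a singleton, and only
    [I != x.2] prevents it from being read as a step along an edge. *)
Definition back_shape (B : {set label}) x :=
  [\/ B = set0,
      exists2 w, [set x.1; w] \in E & B = [set (w, x.2)]
    | exists I J, [/\ I != x.2, J != x.2 & B = [set (x.1, I); (x.1, J)]]].

Record core d xs : Prop := Core {
  co_P : forall x, (x \in dP d) = (x.2 == set0) || (x \in xs);
  co_N : forall x, x \in dN d -> [/\ x.2 \subset T', x.2 != set0 & x \notin dP d];
  co_uniq : uniq xs;
  co_xs : forall x, x \in xs -> x.2 \subset T' /\ x.2 != set0;
  co_fin : forall x, reached d x = (dl d x < +oo)%E;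
  co_dbN : forall x, x \in dN d -> {subset db d x <= xs};
  co_dbP : forall x, x \in xs -> {subset db d x <= take (index x xs) xs};
  co_db : forall x, back_shape (db d x) x }.

(** Just enough closure to show, in [progress], that the queue cannot run empty before the target
    label is settled. *)
Record closed_run d xs : Prop := Closed {
  cl_init : forall s, s \in T' -> reached d (s, [set s]);
  cl_edge : forall x w, x \in xs -> [set x.1; w] \in E -> reached d (w, x.2);
  cl_join : forall v (I J : {set V}), (v, I) \in xs -> (v, J) \in xs ->
    [disjoint I & J] -> reached d (v, I :|: J) }.

Lemma init_core : core (ds_init R T r) [::].
Proof.
split=> //=.
- move=> [v I]; rewrite orbF; apply/imsetP/eqP => /= [[w _ [_ ->]]//|->].
  by exists v.
- move=> x /imsetP[s sT ->] /=; rewrite sub1set sT; split=> //.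
    by apply/set0Pn; exists s; rewrite set11.
  apply/negP => /imsetP[v _ [_ /setP/(_ s)]].
  by rewrite !inE eqxx.
- move=> [v I]; rewrite /reached /=.
  have -> : ((v, I) \in [set (v0, set0 : {set V}) | v0 : V]) = (I == set0).
    by apply/imsetP/eqP => [[w _ [_ ->]]//|->]; exists v.
  have -> : ((v, I) \in [set (s, [set s]) | s in T']) = (v \in T') && (I == [set v]).
    by apply/imsetP/andP => [[w wT [-> ->]]//|[vT /eqP->]]; exists v.
  by rewrite orbC; case: ifP; rewrite ?ltry ?ltxx.
- by move=> x _ y; rewrite inE.
- by move=> x; constructor 1.
Qed.

Lemma init_closed : closed_run (ds_init R T r) [::].
Proof.
split=> // s sT; rewrite /reached; apply/orP; left; apply/imsetP.
by exists s.
Qed.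

Lemma improve_core d xs y (a : \bar R) (B : {set label}) : core d xs -> y.2 \subset T' -> y.2 != set0 ->
  (a < +oo)%E -> {subset B <= xs} -> back_shape B y ->
  let d' := ds_improve d y a B in
  [/\ core d' xs, dP d' = dP d, reached d' y,
      forall x, reached d x -> reached d' x
    & forall x, x \in dP d -> dl d' x = dl d x].
Proof.
move=> C yT y0 afin Bxs By; rewrite /ds_improve.
case: ifP => [/andP[lt yP]|nlt] /=; last first.
  split=> //; rewrite /reached; case: (boolP (y \in dP d)) nlt => [_ _|yP /=].
    by rewrite orbT.
  rewrite orbF => /negbT; rewrite andbT -leNgt => le.
  have := co_fin C y; rewrite /reached (negbTE yP) orbF => ->.
  exact: le_lt_trans le afin.
have reachE x : reached {| dl := upd (dl d) y a; db := upd (db d) y B;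
    dN := y |: dN d; dP := dP d |} x = (x == y) || reached d x.
  by rewrite /reached /= in_setU1 orbA.
split=> //.
- case: C => c1 c2 c3 c4 c5 c6 c7 c8; split=> //=.
  + by move=> x; rewrite !inE => /orP[/eqP->|/c2].
  + by move=> x; rewrite reachE /upd; case: eqP => //= _; rewrite afin.
  + by move=> x; rewrite !inE /upd; case: (eqVneq x y) => //= _; exact: c6.
  + move=> x xxs; rewrite updN; first exact: c7.
    by apply: contraNneq yP => <-; rewrite c1 xxs orbT.
  + by move=> x; rewrite /upd; case: eqP => // ->.
- by rewrite reachE eqxx.
- by move=> x rx; rewrite reachE rx orbT.
- by move=> x xP; rewrite updN //; apply: contraNneq yP => <-.
Qed.

(** Common to both inner loops: an improvement never touches settled labels, so the values from
    which the candidates are computed stay finite throughout the loop. *)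
Lemma improve_fold (A : eqType) (F : state -> A -> state) (s : seq A)
    (z : A -> label) d xs :
  core d xs ->
  (forall d' i, core d' xs -> dP d' = dP d -> i \in s ->
     (forall x, x \in dP d -> dl d' x = dl d x) ->
     exists a B, [/\ F d' i = ds_improve d' (z i) a B, (z i).2 \subset T', (z i).2 != set0,
       (a < +oo)%E & {subset B <= xs} /\ back_shape B (z i)]) ->
  let d' := foldl F d s in
  [/\ core d' xs, dP d' = dP d, forall i, i \in s -> reached d' (z i),
      forall x, reached d x -> reached d' x
    & forall x, x \in dP d -> dl d' x = dl d x].
Proof.
elim: s d => [|i s IH] d C H /=; first by split.
have [a [B [e z1 z2 afin [Bx Bs]]]] := H d i C erefl (mem_head _ _) (fun x _ => erefl).
have [C1 P1 r1 m1 l1] := improve_core C z1 z2 afin Bx Bs.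
rewrite -e in C1 P1 r1 m1 l1.
have [|C2 P2 r2 m2 l2] := IH _ C1.
  move=> d' j Cd' Pd' js ld'; apply: H => //; first by rewrite Pd' P1.
    by rewrite inE js orbT.
  by move=> x xP; rewrite ld' ?P1 // l1.
split=> //.
- by rewrite P2 P1.
- by move=> j; rewrite inE => /orP[/eqP->|/r2//]; exact: m2.
- by move=> x /m1/m2.
- by move=> x xP; rewrite l2 ?P1 // l1.
Qed.

Lemma step_inv d xs x d' : simple_graph E -> core d xs -> closed_run d xs ->
  ds_step E c T r L d x d' -> core d' (rcons xs x) /\ closed_run d' (rcons xs x).
Proof.
move=> SG C Cl [xN _ [ws [Js [pws pJs ->]]]].
have [xT x0 xP] := co_N C xN.
have xxs : x \notin xs by move: xP; rewrite (co_P C) negb_or => /andP[].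
set xs' := rcons xs x; set d0 := ds_settle d x.
have r0 y : reached d0 y = reached d y.
  rewrite /reached /= !inE; case: (eqVneq y x) => [->|] //=.
  by rewrite xN.
have C0 : core d0 xs'.
  case: (C) => c1 c2 c3 c4 c5 c6 c7 c8; split=> //=.
  - by move=> y; rewrite !inE mem_rcons inE c1 orbCA.
  - by move=> y; rewrite !inE negb_or => /andP[yx /c2[-> -> ->]]; rewrite yx.
  - by rewrite rcons_uniq xxs.
  - by move=> y; rewrite mem_rcons inE => /orP[/eqP->//|/c4].
  - by move=> y; rewrite r0 c5.
  - move=> y; rewrite !inE => /andP[_ yN] z zdb; rewrite mem_rcons inE.
    by rewrite (c6 y yN) ?orbT.
  - move=> y; rewrite mem_rcons inE /xs' -cats1 index_cat.
    case: (eqVneq y x) => [-> _|yx /= yxs].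
      rewrite (negbTE xxs) /= eqxx addn0 take_size_cat //; exact: c6.
    rewrite yxs take_cat index_mem yxs; exact: c7.
have xP0 : x \in dP d0 by rewrite !inE eqxx.
have xxs' : x \in xs' by rewrite mem_rcons mem_head.
have xfin : (dl d0 x < +oo)%E by rewrite -(co_fin C0) /reached xP0 orbT.
set d1 := foldl (ds_scan_edge c x) d0 ws.
have wsP w : w \in ws -> [set x.1; w] \in E by rewrite (perm_mem pws) mem_enum inE.
have [C1 P1 rch1 m1 l1] : [/\ core d1 xs', dP d1 = dP d0,
    forall w, w \in ws -> reached d1 (w, x.2),
    forall y, reached d0 y -> reached d1 y
  & forall y, y \in dP d0 -> dl d1 y = dl d0 y].
  apply: (improve_fold (z := fun w => (w, x.2)) C0) => d2 w C2 P2 wws l2 /=.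
  exists (dl d2 x + (c [set x.1; w])%:E)%E, [set x]; split=> //.
    by rewrite l2 // lte_add_pinfty // ltry.
  split; first by move=> y; rewrite inE => /eqP->.
  by constructor 2; exists x.1 => /=; [rewrite setUC wsP|rewrite -surjective_pairing].
have JsP J : J \in Js -> [/\ J != set0, J \subset T' :\: x.2 & (x.1, J) \in dP d0].
  by rewrite (perm_mem pJs) mem_enum inE => /and3P[].
set d2 := foldl _ d1 Js.
have [C2 P2 rch2 m2 l2] : [/\ core d2 xs', dP d2 = dP d1,
    forall J, J \in Js -> reached d2 (x.1, x.2 :|: J),
    forall y, reached d1 y -> reached d2 y
  & forall y, y \in dP d1 -> dl d2 y = dl d1 y].
  apply: (improve_fold (z := fun J => (x.1, x.2 :|: J)) C1) => d3 J C3 P3 JJs l3 /=.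
  have [J0 JT JP] := JsP J JJs.
  have Jxs : (x.1, J) \in xs' by move: JP; rewrite (co_P C0) (negbTE J0).
  exists (dl d3 x + dl d3 (x.1, J))%E, [set x; (x.1, J)].
  have [JT' disJ] : J \subset T' /\ [disjoint J & x.2] by apply/andP; rewrite -subsetD.
  split=> //.
  - by rewrite subUset xT JT'.
  - by rewrite setU_eq0 negb_and x0.
  - rewrite lte_add_pinfty // -(co_fin C3) /reached P3 P1 ?xP0 ?JP ?orbT //.
  split; first by move=> y; rewrite !inE => /orP[/eqP->|/eqP->].
  constructor 3; exists x.2, J; split=> /=.
  - apply: contraNneq J0 => e; rewrite -setI_eq0 e setIUr setIid in disJ.
    by move: disJ; rewrite setU_eq0 => /andP[_].
  - apply: contraNneq x0 => e; rewrite -setI_eq0 e setIUl setIid in disJ.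
    by move: disJ; rewrite setU_eq0 => /andP[].
  - by rewrite -surjective_pairing.
split=> //; split.
- by move=> s sT; apply/m2/m1; rewrite r0; exact: cl_init Cl s sT.
- move=> y w; rewrite mem_rcons inE => /orP[/eqP->|yxs] e; last first.
    by apply/m2/m1; rewrite r0; exact: cl_edge Cl _ _ yxs e.
  by apply/m2/rch1; rewrite (perm_mem pws) mem_enum inE.
(* Two disjoint labels at a vertex are joined when the later of them is settled, the other one being
   in P by then. *)
have joinx v (I J : {set V}) : (v, I) = x -> (v, J) \in xs -> [disjoint I & J] ->
    reached d2 (v, I :|: J).
  move=> e vJ dis; have [JT J0] := co_xs C vJ.
  have -> : (v, I :|: J) = (x.1, x.2 :|: J) by rewrite -e.
  have JP : (x.1, J) \in dP d0 by rewrite (co_P C0) mem_rcons inE (_ : x.1 = v) ?vJ ?orbT // -e.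
  have dis' : [disjoint J & x.2] by rewrite disjoint_sym -e.
  by apply: rch2; rewrite (perm_mem pJs) mem_enum inE J0 subsetD JT dis'.
move=> v I J; rewrite !mem_rcons !inE => /orP[/eqP e1|vI] /orP[/eqP e2|vJ] dis.
- have [eI eJ] : I = x.2 /\ J = x.2 by rewrite -[in I = _]e1 -e2.
  by move: dis x0; rewrite eI eJ -setI_eq0 setIid => ->.
- exact: joinx.
- by rewrite setUC; apply: joinx => //; rewrite disjoint_sym.
- by apply/m2/m1; rewrite r0; exact: cl_join Cl _ _ _ vI vJ dis.
Qed.

(** If N were empty, every reached label would be in P. Then connectivity spreads each singleton
    from its terminal to all vertices, and joins build every nonempty set of non-root terminals at
    every vertex by induction on its size, including the target. If there is no non-root terminal,
    the target is in P anyway. *)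
Lemma progress d xs : connected_graph E -> core d xs -> closed_run d xs ->
  (r, T') \notin dP d -> exists x, x \in dN d.
Proof.
move=> conn C Cl nP; apply/set0Pn; apply: contraNneq nP => N0.
have rP x : reached d x -> x \in dP d by rewrite /reached N0 inE.
have rX x : reached d x -> x.2 != set0 -> x \in xs.
  by move/rP; rewrite (co_P C) => /orP[->|].
have [->|T0] := eqVneq T' set0; first by rewrite (co_P C) eqxx.
suff: (r, T') \in xs by rewrite (co_P C) orbC => ->.
have spread v w (I : {set V}) : I != set0 -> (v, I) \in xs -> (w, I) \in xs.
  move=> I0; have /connectP[p + ->] := conn v w; elim: p v => //= u p IH v /andP[vu pu] vI.
  by apply: IH pu _; apply: (rX (u, I)) => //; exact: cl_edge Cl (v, I) u vI vu.
have single s v : s \in T' -> (v, [set s]) \in xs.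
  move=> sT; have s0 : [set s] != set0 by apply/set0Pn; exists s; rewrite set11.
  by apply: spread s0 (rX (s, [set s]) (cl_init Cl sT) s0).
have all n : forall (I : {set V}) v, #|I| = n.+1 -> I \subset T' -> (v, I) \in xs.
  elim: n => [|n IH] I v cI IT.
    have /cards1P[s e] : #|I| == 1%N by apply/eqP.
    by rewrite e; apply: single; rewrite -sub1set -e.
  have [s sI] : exists s, s \in I by apply/set0Pn; rewrite -card_gt0 cI.
  have sT := subsetP IT s sI.
  have cJ : #|I :\ s| = n.+1 by move: cI; rewrite (cardsD1 s) sI => -[].
  have vJ := IH _ v cJ (subset_trans (subD1set _ _) IT).
  rewrite -(setD1K sI); apply: rX; last by apply/set0Pn; exists s; rewrite setU11.
  apply: cl_join Cl _ _ _ (single s v sT) vJ _.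
  by rewrite disjoints_subset sub1set !inE eqxx.
by apply: (all #|T'|.-1) => //; rewrite prednK // card_gt0.
Qed.

End Runs.

(** * Backtracking as a recursive function *)

Section Backtrack.
Variables (R : realType) (V : finType) (E : {set {set V}}).
Variables (T : {set V}) (r : V).
Local Notation label := (V * {set V})%type.
Variables (d : ds_state R V) (xs : seq label).
Hypothesis C : core E T r d xs.
Implicit Types x y z : label.

(** [n] is fuel. Any fuel above the position of [x] in [xs] gives the same result, since each
    recursive call goes to an earlier position; [size xs] therefore serves for all settled labels at
    once, and [btree_edge] and [btree_union] are the recursion equations at that fixed fuel. *)
Fixpoint btree n x : {set {set V}} :=
  if n is n'.+1 then
    if [pick w | db d x == [set (w, x.2)]] is Some w
    then [set x.1; w] |: btree n' (w, x.2)
    else \bigcup_(y in db d x) btree n' y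
  else set0.

Lemma db_index x y : x \in xs -> y \in db d x ->
  y \in xs /\ (index y xs < index x xs)%N.
Proof.
move=> xxs /(co_dbP C xxs) yt; have yxs := mem_take yt; split=> //.
rewrite -{1}(cat_take_drop (index x xs) xs) index_cat yt.
have : (index y (take (index x xs) xs) < size (take (index x xs) xs))%N by rewrite index_mem.
by rewrite size_take index_mem xxs.
Qed.

Variant shape_spec x : {set label} -> option V -> Prop :=
| ShapeEdge w of [set x.1; w] \in E : shape_spec x [set (w, x.2)] (Some w)
| ShapeNil : shape_spec x set0 None
| ShapePair I J of I != x.2 & J != x.2 : shape_spec x [set (x.1, I); (x.1, J)] None.

Lemma shapeP x : shape_spec x (db d x) [pick w | db d x == [set (w, x.2)]].
Proof.
case: pickP => [w /eqP e|no].
  rewrite e; constructor; have [e0|[w' w'E e']|[I [J [nI _ e']]]] := co_db C x.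
  - by have := set11 (w, x.2); rewrite -e e0 inE.
  - have : (w, x.2) \in db d x by rewrite e set11.
    by rewrite e' inE => /eqP[->].
  - have : (x.1, I) \in db d x by rewrite e' set21.
    by rewrite e inE => /eqP[_ eI]; rewrite eI eqxx in nI.
have [e0|[w' w'E e']|[I [J [nI nJ e']]]] := co_db C x.
- by rewrite e0; constructor.
- by have := no w'; rewrite e' eqxx.
- by rewrite e'; constructor.
Qed.

Lemma btree_stable n1 n2 x : x \in xs -> (index x xs < n1)%N -> (index x xs < n2)%N ->
  btree n1 x = btree n2 x.
Proof.
elim: n1 n2 x => [|n1 IH] [|n2] x //= xxs l1 l2.
have st y : y \in db d x -> btree n1 y = btree n2 y.
  by move=> /(db_index xxs)[yxs ly]; apply: IH => //; exact: leq_trans ly _.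
case: shapeP st => [w _||I J _ _] st.
- by rewrite st ?set11.
- by rewrite !big_set0.
- by apply: eq_bigr => y; exact: st.
Qed.

Lemma btree_run n x : x \in xs -> (index x xs < n)%N ->
  ds_backtrack d x (btree n x) /\ btree n x \subset E.
Proof.
elim: n x => [|n IH] x //= xxs l1.
have st y : y \in db d x -> ds_backtrack d y (btree n y) /\ btree n y \subset E.
  by move=> /(db_index xxs)[yxs ly]; apply: IH => //; exact: leq_trans ly _.
have := shapeP x; case: pickP => [w /eqP e|no] sh.
  have [|wB wE] := st (w, x.2); first by rewrite e set11.
  have xE : [set x.1; w] \in E.
    by move: sh; rewrite e => sh; inversion sh.
  split; last by rewrite subUset sub1set xE.
  by case: x e wB {st xE xxs l1 wE sh} => v I /= e wB; exact: ds_backtrack_edge.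
split; last by apply/bigcupsP => y /st[].
case: x no st {xxs l1 sh} => v I no st; apply: ds_backtrack_union.
  by move=> w e; have := no w; rewrite e eqxx.
by move=> y /st[].
Qed.

Local Notation B := (btree (size xs)).

Lemma btree_edge x w : x \in xs -> db d x = [set (w, x.2)] ->
  B x = [set x.1; w] |: B (w, x.2).
Proof.
move=> xxs e; have ix : (index x xs < size xs)%N by rewrite index_mem.
have [yxs iy] : (w, x.2) \in xs /\ (index (w, x.2) xs < index x xs)%N.
  by apply: db_index => //; rewrite e set11.
case: (size xs) ix => // n ix /=; rewrite e.
case: pickP => [w' /eqP e'|/(_ w)]; last by rewrite eqxx.
have -> : w' = w by have := set11 (w', x.2); rewrite -e' inE => /eqP[].
rewrite -/(btree n.+1 _); congr (_ |: _); apply: btree_stable => //; lia.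
Qed.

Lemma btree_union x : x \in xs -> (forall w, db d x <> [set (w, x.2)]) ->
  B x = \bigcup_(y in db d x) B y.
Proof.
move=> xxs e; have ix : (index x xs < size xs)%N by rewrite index_mem.
have st := db_index xxs.
case: (size xs) ix => // n ix /=.
case: pickP => [w' /eqP e'|_]; first by case: (e w').
apply: eq_bigr => y /st[yxs ly]; rewrite -/(btree n.+1 _); apply: btree_stable => //; lia.
Qed.

End Backtrack.

(** * The priority queue as a program *)

Declare Scope com_scope.
Delimit Scope com_scope with com.
Notation "$ x" := (NVar x) (at level 8, format "$ x") : com_scope.
Notation "# x" := (NConst x) (at level 8, format "# x") : com_scope.
Notation "a `[ e ]" := (NGet a e) (at level 8, format "a `[ e ]") : com_scope.
Notation "a `r[ e ]" := (RGet a e) (at level 8, format "a `r[ e ]") : com_scope.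
Notation "e1 + e2" := (NAdd e1 e2) : com_scope.
Notation "e1 - e2" := (NSub e1 e2) : com_scope.
Notation "x ::= e" := (NSet x e) (at level 70) : com_scope.
Notation "a `< i > ::= e" := (NPut a i e) (at level 70, i at level 60) : com_scope.
Notation "p ;; q" := (Seq p q) (at level 90, right associativity) : com_scope.

(* The natural variables 0-3, the natural arrays 0-5 and the real array 0 are   *)
(* those of the input and output conventions. The label (v, I) is denoted by    *)
(* the number v * 2 ^ (k - 1) + I. Array aST holds 0, 1, 2 for a label outside  *)
(* N and P, in N, in P. Array aBT holds 0, 1, 2 if b(x) is empty, {(w, I)},     *)
(* {(v, I), (v, J)}; its elements are in aBA and aBB, except that in the second *)
(* case aBB holds the index of the edge {v, w}. The heap is made of aND, aIT,   *)
(* aRK, aBS, aA, rKY, xCN, xNB; its roots are on the stack aSK of height xSP,   *)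
(* and during [extract_min] in the slots aSL, at most one root for each rank.   *)
Notation xN := 0%N (only parsing).
Notation xM := 1%N (only parsing).
Notation xT := 2%N (only parsing).
Notation xC := 3%N (only parsing).
Notation xK := 4%N (only parsing).
Notation xW := 5%N (only parsing).
Notation xCN := 6%N (only parsing).
Notation xNB := 7%N (only parsing).
Notation xSP := 8%N (only parsing).
Notation xMR := 9%N (only parsing).
Notation xFU := 10%N (only parsing).
Notation xX := 11%N (only parsing).
Notation xBT := 12%N (only parsing).
Notation xBA := 13%N (only parsing).
Notation xBB := 14%N (only parsing).
Notation xU := 15%N (only parsing).
Notation xR := 16%N (only parsing).
Notation xI := 17%N (only parsing).
Notation xJ := 18%N (only parsing).
Notation xV := 19%N (only parsing).
Notation xQ := 20%N (only parsing).
Notation xS := 21%N (only parsing).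
Notation xH := 22%N (only parsing).
Notation xL := 23%N (only parsing).
Notation xP := 24%N (only parsing).
Notation xD := 25%N (only parsing).
Notation xB := 28%N (only parsing).
Notation xZ := 29%N (only parsing).
Notation aE1 := 0%N (only parsing).
Notation aE2 := 1%N (only parsing).
Notation aTE := 2%N (only parsing).
Notation aF := 3%N (only parsing).
Notation aXV := 4%N (only parsing).
Notation aXS := 5%N (only parsing).
Notation aHD := 6%N (only parsing).
Notation aNX := 7%N (only parsing).
Notation aTG := 8%N (only parsing).
Notation aHE := 9%N (only parsing).
Notation aLB := 10%N (only parsing).
Notation aST := 11%N (only parsing).
Notation aBT := 12%N (only parsing).
Notation aBA := 13%N (only parsing).
Notation aBB := 14%N (only parsing).
Notation aPW := 15%N (only parsing).
Notation aSU := 16%N (only parsing).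
Notation aND := 17%N (only parsing).
Notation aIT := 18%N (only parsing).
Notation aRK := 19%N (only parsing).
Notation aBS := 20%N (only parsing).
Notation aA := 21%N (only parsing).
Notation aSK := 22%N (only parsing).
Notation aSL := 23%N (only parsing).
Notation aMK := 24%N (only parsing).
Notation aLV := 25%N (only parsing).
Notation aLS := 26%N (only parsing).
Notation rC := 0%N (only parsing).
Notation rL := 1%N (only parsing).
Notation rLB := 2%N (only parsing).
Notation rKY := 3%N (only parsing).

(** The guard is a disjunction written with negations: status 0 stands for the value infinity, where
    every finite candidate improves; status 1 calls for a comparison; status 2, settled, excludes
    the update. *)
Definition improve : com := (
  If (BNot (BAnd (BNot (NEq aST`[$xX] #0))
                 (BNot (BAnd (NEq aST`[$xX] #1) (RLt (RVar 0) rL`r[$xX])))))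
  ( RPut rL $xX (RVar 0) ;;
    aBT`<$xX> ::= $xBT ;;
    aBA`<$xX> ::= $xBA ;;
    aBB`<$xX> ::= $xBB ;;
    aST`<$xX> ::= #1 ;;
    xU ::= aND`[$xX] ;;
    xR ::= aRK`[$xU] ;;
    aA`<$xNB + ($xR - #1)> ::= aA`[aBS`[$xU] + ($xR - #1)] ;;
    aA`<$xNB + ($xR - #2)> ::= aA`[aBS`[$xU] + ($xR - #2)] ;;
    aBS`<$xCN> ::= aBS`[$xU] ;;
    aBS`<$xU> ::= $xNB ;;
    aRK`<$xCN> ::= $xR - #2 ;;
    aIT`<$xCN> ::= $xX ;;
    RPut rKY $xCN (RAdd (RVar 0) rLB`r[$xX]) ;;
    aND`<$xX> ::= $xCN ;;
    aSK`<$xSP> ::= $xCN ;;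
    xSP ::= $xSP + #1 ;;
    xCN ::= $xCN + #1 ;;
    xNB ::= $xNB + $xW )
  Skip)%com.

(** Works like the carry in binary addition: while the slot of the current rank is occupied, the two
    trees are linked and the rank grows by one. An empty slot holds 0, which is never a real
    node. *)
Definition link_loop : com := (
  While (NLt #0 aSL`[$xR])
  ( xV ::= aSL`[$xR] ;;
    aSL`< $xR > ::= #0 ;;
    If (RLt rKY`r[$xV] rKY`r[$xU])
      (xZ ::= $xU ;; xU ::= $xV ;; xV ::= $xZ) Skip ;;
    aA`< aBS`[$xU] + $xR > ::= $xV ;;
    xR ::= $xR + #1 ;;
    aRK`< $xU > ::= $xR ))%com.

Definition pop_loop : com := (
  While (NLt #0 $xSP)
  ( xSP ::= $xSP - #1 ;;
    xU ::= aSK`[$xSP] ;;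
    xR ::= aRK`[$xU] ;;
    If (NEq aND`[aIT`[$xU]] $xU)
    ( link_loop ;;
      aSL`< $xR > ::= $xU ;;
      If (NLt $xR $xMR) Skip (xMR ::= $xR + #1) )
    ( If (NLt #0 $xR)
        ( aSK`< $xSP > ::= aA`[aBS`[$xU] + ($xR - #1)] ;; xSP ::= $xSP + #1 ) Skip ;;
      If (NLt #1 $xR)
        ( aSK`< $xSP > ::= aA`[aBS`[$xU] + ($xR - #2)] ;; xSP ::= $xSP + #1 ) Skip )))%com.

Definition scan_loop : com := (
  While (NLt #0 $xI)
  ( xI ::= $xI - #1 ;;
    xU ::= aSL`[$xI] ;;
    aSL`< $xI > ::= #0 ;;
    If (NLt #0 $xU)
    ( If (NEq $xB #0) (xB ::= $xU)
      ( If (RLt rKY`r[$xU] rKY`r[$xB])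
          ( aSK`< $xSP > ::= $xB ;; xB ::= $xU )
          ( aSK`< $xSP > ::= $xU ) ;;
        xSP ::= $xSP + #1 ) )
    Skip ))%com.

Definition kids_loop : com := (
  While (NLt #0 $xI)
  ( xI ::= $xI - #1 ;;
    aSK`< $xSP > ::= aA`[aBS`[$xB] + $xI] ;;
    xSP ::= $xSP + #1 ))%com.

Definition extract_min : com := (
  xMR ::= #0 ;;
  pop_loop ;;
  xI ::= $xMR ;;
  xB ::= #0 ;;
  scan_loop ;;
  xQ ::= aIT`[$xB] ;;
  aST`< $xQ > ::= #2 ;;
  xI ::= aRK`[$xB] ;;
  kids_loop)%com.

Lemma mkseq_upd (f : nat -> nat) n a : mkseq (upd f n a) n.+1 = rcons (mkseq f n) a.
Proof.
rewrite mkseqS updE; congr rcons; apply/eq_in_map => i.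
by rewrite mem_iota /= add0n => lt; rewrite updN // neq_ltn lt.
Qed.

(** * Amortized analysis of an improvement *)

Section HeapProg.
Variables (R : realType) (sv : nat -> nat -> R) (sc : nat -> nat -> nat).
Local Notation store := (store R).
Local Notation wp := (wp sv sc).
Implicit Types s : store.

Definition heap_of s :=
  Heap (narr s aND) (narr s aIT) (narr s aRK) (narr s aBS) (narr s aA)
       (rarr s rKY) (nvar s xCN) (nvar s xNB).

Definition act s : pred nat := fun q => narr s aST q == 1%N.
Definition fr s : pred nat := fun q => narr s aST q == 0%N.
Definition key s : nat -> R := fun q => rarr s rL q + rarr s rLB q.
Definition stk s := mkseq (narr s aSK) (nvar s xSP).
Definition hollow s L := count (fun u => ~~ full (heap_of s) u) L.

(** Between operations all slots are empty, so two terms of the potential remain. [phi] and [gam]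
    are mere upper bounds for the potential and the number of nodes, which lets every attempted
    improvement be charged alike, successful or not. *)
Definition heap_ok s phi gam :=
  (forall i, narr s aSL i = 0%N) /\
  exists L, [/\ hinv (nvar s xW) (act s) (fr s) (key s) (heap_of s) L (stk s),
    (3 * hollow s L + 2 * nvar s xSP <= phi)%N
  & (nvar s xCN <= gam)%N].

Definition improvable s :=
  (narr s aST (nvar s xX) == 0%N) ||
  ((narr s aST (nvar s xX) == 1%N) && (rvar s 0%N < rarr s rL (nvar s xX))).

(** The 5 units are 2 for the new root and 3 for the one node that may become hollow. *)
Lemma improve_spec s phi gam : (1 < nvar s xW)%N -> heap_ok s phi gam ->
  wp improve s (fun s' t => (t <= 200)%N /\
    if improvable s then
      [/\ narr s' aST = upd (narr s aST) (nvar s xX) 1%N,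
          rarr s' rL = upd (rarr s rL) (nvar s xX) (rvar s 0%N),
          narr s' aBT = upd (narr s aBT) (nvar s xX) (nvar s xBT)
        & narr s' aBA = upd (narr s aBA) (nvar s xX) (nvar s xBA)] /\
      [/\ narr s' aBB = upd (narr s aBB) (nvar s xX) (nvar s xBB)
        & heap_ok s' (phi + 5)%N gam.+1]
    else s' = s).
Proof.
move=> W2 [Sl [L [H le1 le2]]]; apply: wp_if.
  rewrite /= negb_and !negbK -/(improvable s) => imp; rewrite imp.
  steps; split; first by [].
  split; first by split.
  split; first by [].
  set s' := Store _ _ _ _.
  pose X := nvar s xX; pose b := rvar s 0%N + rarr s rLB X.
  have hE : heap_of s' = hdec (nvar s xW) (heap_of s) X b.
    by rewrite /heap_of /hdec /s'; sred; rewrite addn1.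
  have afx : act s X || fr s X by move: imp; rewrite /improvable /act /fr -/X => /orP[->|/andP[-> _]]; rewrite ?orbT.
  have ax : act s X -> b <= key s X.
    rewrite /act => /eqP A; move: imp; rewrite /improvable -/X A /= => lt.
    by rewrite lerD2r ltW.
  split; first by move=> i; exact: Sl.
  exists (nvar s xCN :: L); split; last by rewrite /s'; sred; lia.
    rewrite hE; apply: (hinv_perm (rts := nvar s xCN :: stk s)).
      by rewrite /stk /s'; sred; rewrite addn1 mkseq_upd perm_sym perm_rcons.
    have -> : nvar s' xW = nvar s xW by [].
    apply: (hinv_ext _ _ _ (hdec_inv H W2 afx ax)).
    - by move=> q; rewrite /act /s'; sred; rewrite /upd; case: ifP.
    - by move=> q; rewrite /fr /s'; sred; rewrite /upd; case: ifP.
    - by move=> q _; rewrite /key /s'; sred; rewrite /upd; case: eqP => // ->.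
  rewrite /hollow hE /s'; sred.
  move: (hdec_count H W2 afx ax); rewrite -/(hollow s L) -[cn (heap_of s)]/(nvar s xCN).
  move: (count _ (_ :: _)) => k; lia.
rewrite /= negb_and !negbK -/(improvable s) => /negbTE ->.
by step.
Qed.

End HeapProg.

Lemma perm_rem_cat (T : eqType) (v : T) (s1 s2 : seq T) : v \in s2 ->
  perm_eq (s1 ++ s2) (v :: s1 ++ rem v s2).
Proof.
by move=> vs; rewrite perm_sym -cat1s perm_catCA perm_cat2l perm_sym perm_to_rem.
Qed.

(** * Consolidation: removing hollow roots and linking equal ranks *)

Section Link.
Variables (R : realType) (sv : nat -> nat -> R) (sc : nat -> nat -> nat).
Local Notation store := (store R).
Local Notation wp := (wp sv sc).
Implicit Types s : store.

(** [sl] lists the occupants of the slots: each sits in the slot of its own rank, so there is at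
    most one per rank. *)
Definition slots_ok s (sl : seq nat) :=
  (forall u, u \in sl -> narr s aSL (narr s aRK u) = u /\ full (heap_of s) u) /\
  (forall i, narr s aSL i != 0%N -> narr s aSL i \in sl /\ narr s aRK (narr s aSL i) = i).

Section Fixed.
Variables (W B : nat) (A F : pred nat) (K : nat -> R).
Hypothesis BW : (2 * B + 1 < W)%N.
Local Notation hinv := (hinv W A F K).

(** Every round empties a slot and thus shortens [sl], which pays for it. Both candidates are full,
    so [hlink_inv] applies whichever has the smaller key. *)
Lemma link_spec s L sl : (nvar s xCN <= 2 ^ B)%N ->
  hinv (heap_of s) L (nvar s xU :: stk s ++ sl) -> slots_ok s sl ->
  full (heap_of s) (nvar s xU) -> narr s aRK (nvar s xU) = nvar s xR ->
  wp link_loop s (fun s' t => exists sl',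
    [/\ hinv (heap_of s') L (nvar s' xU :: stk s' ++ sl'), slots_ok s' sl',
        full (heap_of s') (nvar s' xU), narr s' aRK (nvar s' xU) = nvar s' xR
      & narr s' aSL (nvar s' xR) = 0%N] /\
    (forall w, w \in sl' -> w \in sl /\ narr s' aRK w = narr s aRK w) /\
    (t + 100 * size sl' <= 100 * size sl + 20)%N).
Proof.
move=> cB H so fu ru; pose Inv s' Bud := nvar s' xCN = nvar s xCN /\ exists2 sl' : seq nat,
    forall w, w \in sl' -> w \in sl /\ narr s' aRK w = narr s aRK w &
    [/\ hinv (heap_of s') L (nvar s' xU :: stk s' ++ sl'), slots_ok s' sl',
        full (heap_of s') (nvar s' xU), narr s' aRK (nvar s' xU) = nvar s' xR
      & (100 * size sl' + 20 <= Bud)%N].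
apply: (wp_whilef (I := Inv) (B := (100 * size sl + 20)%N)).
- by split=> //; exists sl.
- move=> {H so fu ru} s1 Bud [c1 [sl1 sub1 [H so fu ru le]]] _; sred => gt0.
  set u := nvar s1 xU in H fu ru *; set r := nvar s1 xR in ru gt0 *.
  set v := narr s1 aSL r in gt0 *.
  have v0 : v != 0%N by lia.
  have [vsl rv] := so.2 r v0; rewrite -/v in vsl rv.
  have [_ fv] := so.1 v vsl.
  have ur : u \in u :: stk s1 ++ sl1 by rewrite inE eqxx.
  have vr : v \in u :: stk s1 ++ sl1 by rewrite inE mem_cat vsl !orbT.
  have := rts_uniq H; rewrite /= => /andP[]; rewrite mem_cat => /norP[ust usl].
  rewrite cat_uniq => /and3P[_ /hasPn dis usl'].
  have vst : v \notin stk s1 by apply: dis.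
  have uv : u != v by apply: contraNneq usl => ->.
  have cn1 : (cn (heap_of s1) <= 2 ^ B)%N by rewrite /= c1.
  have lesz : (size sl1 = (size (rem v sl1)).+1)%N.
    by rewrite size_rem // prednK //; case: (sl1) vsl.
  have slok (s2 : store) u' : u' \in [:: u; v] ->
      narr s2 aSL = upd (narr s1 aSL) r 0%N -> narr s2 aRK = upd (narr s1 aRK) u' r.+1 ->
      narr s2 aND = narr s1 aND -> narr s2 aIT = narr s1 aIT ->
      slots_ok s2 (rem v sl1) /\ forall w, w \in rem v sl1 ->
        w \in sl /\ narr s2 aRK w = narr s aRK w.
    move=> u'in e1 e2 e3 e4.
    have nu' w : w \in rem v sl1 -> (w != u') && (w \in sl1).
      rewrite mem_rem_uniq // inE => /andP[wv wsl]; rewrite wsl andbT.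
      apply: contraNneq wv => wu; move: u'in; rewrite -wu !inE => /orP[/eqP wu'|//].
      by rewrite wu' (negbTE usl) in wsl.
    split; last first.
      move=> w /nu' /andP[wu' /sub1[a b]]; split=> //.
      by rewrite e2 updN.
    split=> [w wr|i].
      have /andP[wu wsl] := nu' w wr; have [a b] := so.1 w wsl.
      split; last by move: b; rewrite /full /= e3 e4.
      rewrite e1 e2 (updN _ _ wu) updN //; apply: contraTneq wr => e.
      by rewrite mem_rem_uniq // inE negb_and negbK -a e eqxx.
    rewrite e1 /upd; case: (eqVneq i r) => // ir si0.
    have [a b] := so.2 i si0.
    have m : narr s1 aSL i \in rem v sl1.
      rewrite mem_rem_uniq // inE a andbT; apply: contraNneq ir => e.
      by rewrite -b e rv.
    by split=> //; rewrite e2 updN //; case/andP: (nu' _ m).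
  steps.
  apply: wp_if; sred; rewrite -/u -/v -/r => lt.
    steps; sred; rewrite -/u -/v -/r; move=> _.
    exists (100 * size (rem v sl1) + 20)%N; last by rewrite lesz in le; lia.
    split; first by sred.
    set s2 := Store _ _ _ _.
  have [slo sub2] : slots_ok s2 (rem v sl1) /\ forall w, w \in rem v sl1 ->
        w \in sl /\ narr s2 aRK w = narr s aRK w.
    by apply: (slok _ v); rewrite ?inE ?eqxx ?orbT //; rewrite /s2; sred; rewrite ?addn1.
  exists (rem v sl1) => //.
    have hE : heap_of s2 = hlink (heap_of s1) v u r.
      by rewrite /heap_of /hlink /s2; sred; rewrite addn1.
    have Hl := hlink_inv H vr ur _ fv rv ru (ltW lt) cn1 BW.
    rewrite eq_sym in Hl; have {}Hl := Hl uv.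
    split.
    + rewrite hE; apply: hinv_perm Hl; rewrite /s2; sred.
      by rewrite -/v /= eqxx; exact: perm_rem_cat.
    + exact: slo.
    + by rewrite hE; exact: fv.
    + by rewrite /s2; sred; rewrite updE addn1.
    + by [].
  steps; sred; rewrite -/u -/v -/r; move=> _.
  exists (100 * size (rem v sl1) + 20)%N; last by rewrite lesz in le; lia.
  split; first by sred.
  set s2 := Store _ _ _ _.
  have [slo sub2] : slots_ok s2 (rem v sl1) /\ forall w, w \in rem v sl1 ->
        w \in sl /\ narr s2 aRK w = narr s aRK w.
    by apply: (slok _ u); rewrite ?inE ?eqxx ?orbT //; rewrite /s2; sred; rewrite ?addn1.
  exists (rem v sl1) => //.
  have hE : heap_of s2 = hlink (heap_of s1) u v r.
    by rewrite /heap_of /hlink /s2; sred; rewrite addn1.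
  have luv : ky (heap_of s1) u <= ky (heap_of s1) v by rewrite leNgt.
  have Hl := hlink_inv H ur vr uv fu ru rv luv cn1 BW.
  split.
  + rewrite hE; apply: hinv_perm Hl; rewrite /s2; sred; rewrite -/u.
    rewrite -(perm_cons v); apply: (perm_trans (y := u :: stk s1 ++ sl1)).
      by rewrite perm_sym perm_to_rem.
    by rewrite -!cat_cons; apply: perm_rem_cat.
  + exact: slo.
  + by rewrite hE; exact: fu.
  + by rewrite /s2; sred; rewrite updE addn1.
  + by [].
- move=> s' Bud [c1 [sl' sub' [H' so' fu' ru' le']]] _; sred => nz; split; first by lia.
  move=> t le1; exists sl'; split; first by split=> //; lia.
  by split; [exact: sub'|lia].
Qed.

End Fixed.
End Link.

Section Pop.
Variables (R : realType) (sv : nat -> nat -> R) (sc : nat -> nat -> nat).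
Local Notation store := (store R).
Local Notation wp := (wp sv sc).
Implicit Types s : store.

Section Fixed.
Variables (W B : nat) (A F : pred nat) (K : nat -> R).
Hypothesis BW : (2 * B + 1 < W)%N.
Local Notation hinv := (hinv W A F K).

Lemma root_rank (h : heap R) L rts u : hinv h L rts -> (cn h <= 2 ^ B)%N ->
  u \in rts -> (rk h u < 2 * B)%N.
Proof.
move=> H cB ur; have := leq_ltn_trans (size_bound H ur) (size_cn H).
by move/leq_trans/(_ cB); rewrite ltn_exp2l //; lia.
Qed.

Lemma hollow_remove (h : heap R) L rts u : hinv h L rts -> u \in rts -> ~~ full h u ->
  hinv h (rem u L) ([seq kid h u i | i <- index_iota (rk h u - 2) (rk h u)] ++ rem u rts).
Proof.
move=> H ur nf; have := hinv_remove (act' := A) H ur; rewrite /lo (negbTE nf); apply.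
move=> x; case: (boolP (A x)) => //= Ax; have [_ b _] := hi_act H Ax.
by apply/esym; apply: contraNneq nf => e; rewrite /full -e b.
Qed.

Lemma hollow_rem s L u : u \in L -> ~~ full (heap_of s) u ->
  (hollow s L = (hollow s (rem u L)).+1)%N.
Proof.
by move=> uL nf; rewrite /hollow (permP (perm_to_rem uL)) /= nf.
Qed.

(** One unit of potential pays for 200 steps. A full root passes from the stack, weight 2, to a
    slot, weight 1, and every link on the way frees a further slot. A hollow root releases 3 + 2
    units and puts at most two children of weight 2 on the stack. So each round releases at least
    one unit. *)
Lemma pop_spec s L : (nvar s xCN <= 2 ^ B)%N ->
  hinv (heap_of s) L (stk s) -> (forall i, narr s aSL i = 0%N) -> nvar s xMR = 0%N ->
  wp pop_loop s (fun s' t => exists L' sl,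
    [/\ hinv (heap_of s') L' sl, slots_ok s' sl, nvar s' xSP = 0%N, (nvar s' xMR <= 2 * B)%N
      & forall u, u \in sl -> (narr s' aRK u < nvar s' xMR)%N] /\
    (t + 200 * (3 * hollow s' L') <= 200 * (3 * hollow s L + 2 * nvar s xSP) + 50)%N).
Proof.
move=> cB H0 sz mr0; pose Inv s' Bud := nvar s' xCN = nvar s xCN /\ exists L' sl,
    [/\ hinv (heap_of s') L' (stk s' ++ sl), slots_ok s' sl, (nvar s' xMR <= 2 * B)%N,
        forall u, u \in sl -> (narr s' aRK u < nvar s' xMR)%N
      & (200 * (3 * hollow s' L' + 2 * nvar s' xSP + size sl) + 50 <= Bud)%N].
pose Bud0 := (200 * (3 * hollow s L + 2 * nvar s xSP) + 50)%N.
apply: (wp_whilef (I := Inv) (B := Bud0)).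
- split=> //; exists L, [::]; rewrite cats0 mr0; split=> //.
  + by split=> // i; rewrite sz.
  + by rewrite /Bud0 /=; lia.
- move=> {H0 sz mr0} s1 Bud [c1 [L1 [sl [H so mr1 rkm le]]]] _; sred => sp0.
  set p := (nvar s1 xSP - 1)%N; set u := narr s1 aSK p.
  have spE : nvar s1 xSP = p.+1 by rewrite /p; lia.
  have stE : stk s1 = rcons (mkseq (narr s1 aSK) p) u by rewrite /stk spE mkseqS.
  have H' : hinv (heap_of s1) L1 (u :: mkseq (narr s1 aSK) p ++ sl).
    by apply: hinv_perm H; rewrite stE -cat_cons perm_cat2r perm_rcons.
  have ur : u \in u :: mkseq (narr s1 aSK) p ++ sl by rewrite inE eqxx.
  have uL := rts_sub H' ur.
  have cn1 : (cn (heap_of s1) <= 2 ^ B)%N by rewrite /= c1.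
  steps; apply: wp_if; sred; rewrite -/p -/u => fu.
    apply: wp_seq; set s2 := Store _ _ _ _.
    have cB2 : (nvar s2 xCN <= 2 ^ B)%N by rewrite /s2; sred; rewrite c1.
    have so2 : slots_ok s2 sl by [].
    have H2 : hinv (heap_of s2) L1 (nvar s2 xU :: stk s2 ++ sl).
      by rewrite /s2; sred; rewrite -/p -/u.
    apply: wp_frame; apply: wp_mono (link_spec _ _ BW cB2 H2 so2 fu (erefl _)).
    move=> s3 t3 [sl3 [[H3 so3 fu3 ru3 sz3] [sub3 le3]]] [fr1 fr2 fr3].
    have e6 : nvar s3 xCN = nvar s1 xCN by rewrite (fr1 xCN isT).
    have e8 : nvar s3 xSP = p by rewrite (fr1 xSP isT).
    have e9 : nvar s3 xMR = nvar s1 xMR by rewrite (fr1 xMR isT).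
    have hol : hollow s3 L1 = hollow s1 L1.
      by apply: eq_count => w; rewrite /full /= (fr2 aND isT) (fr2 aIT isT).
    set u3 := nvar s3 xU in H3 fu3 ru3; set r3 := nvar s3 xR in ru3 sz3.
    have ur3 : u3 \in u3 :: stk s3 ++ sl3 by rewrite inE eqxx.
    have r3B : (r3 < 2 * B)%N.
      by rewrite -ru3; apply: (root_rank H3 _ ur3); rewrite /= e6 c1.
    have := rts_uniq H3; rewrite /= mem_cat => /andP[/norP[_ u3sl] _].
    have slr w : w \in sl3 -> narr s3 aRK w != r3.
      move=> wsl; apply: contraTneq (wsl) => e; have [a _] := so3.1 w wsl.
      have /(hi_bd H3) : w \in L1 by apply: (rts_sub H3); rewrite inE mem_cat wsl !orbT.
      by rewrite -a e sz3.
    have so4 (s4 : store) : narr s4 aSL = upd (narr s3 aSL) r3 u3 ->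
        narr s4 aRK = narr s3 aRK -> narr s4 aND = narr s3 aND ->
        narr s4 aIT = narr s3 aIT -> slots_ok s4 (u3 :: sl3).
      move=> e1 e2 e3 e4; split=> [w|k].
        rewrite inE e2 e1 /full /= e3 e4 => /orP[/eqP->|wsl].
          by rewrite ru3 updE; split=> //; exact: fu3.
        by rewrite updN ?slr //; exact: so3.1 w wsl.
      rewrite e1 e2 /upd; case: (eqVneq k r3) => [-> _|_ kz].
        by rewrite inE eqxx.
      by have [a b] := so3.2 k kz; rewrite inE a orbT.
    have H4 : hinv (heap_of s3) L1 (stk s3 ++ u3 :: sl3).
      apply: hinv_perm H3; by rewrite -cat1s perm_catCA.
    have e8' : nvar s2 xSP = p by [].
    steps; apply: wp_if; sred; rewrite -/u3 -/r3 => mrc.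
      steps; move=> _.
      exists (200 * (3 * hollow s1 L1 + 2 * p + (size sl3).+1) + 50)%N.
        split; first by sred; rewrite e6.
        exists L1, (u3 :: sl3); split=> //.
        + by apply: so4.
        + by sred; rewrite e9.
        + by move=> w; rewrite inE; sred => /orP[/eqP->|wsl]; rewrite ?ru3 //;
          rewrite e9; have [a ->] := sub3 w wsl; exact: rkm.
        + by rewrite -hol; sred; rewrite e8 /=; apply: leqnn.
      by move: le3 le; rewrite spE; lia.
    steps; move=> _.
    exists (200 * (3 * hollow s1 L1 + 2 * p + (size sl3).+1) + 50)%N.
      split; first by sred; rewrite e6.
      exists L1, (u3 :: sl3); split=> //.
      + by apply: so4.
      + by sred; lia.
      + move=> w; rewrite inE; sred => /orP[/eqP->|wsl]; first by rewrite ru3; lia.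
        have [a ->] := sub3 w wsl; have := rkm w a; move: mrc.
        by rewrite e9 -[narr s2 aRK]/(narr s1 aRK); lia.
      + by rewrite -hol; sred; rewrite e8 /=; apply: leqnn.
    by move: le3 le; rewrite spE; lia.
  have nf : ~~ full (heap_of s1) u by [].
  have Hr := hollow_remove H' ur nf.
  have hE := hollow_rem uL nf.
  set r := narr s1 aRK u in Hr *.
  rewrite /= eqxx -/r in Hr.
  pose Ph := (200 * (3 * hollow s1 (rem u L1) + 2 * (p + 2) + size sl) + 50)%N.
  steps; apply: wp_if; sred; rewrite -/p -/u -/r => r0.
    steps; apply: wp_if; sred; rewrite -/p -/u -/r => r1.
      steps; move=> _; exists Ph; last first.
        by rewrite /Ph; move: le; rewrite spE hE; lia.
      split; first by sred.
      exists (rem u L1), sl; split=> //.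
      + apply: hinv_perm Hr; rewrite /stk; sred.
        rewrite !addn1 !mkseq_upd -/r (_ : index_iota _ _ = [:: (r - 2)%N; (r - 1)%N]); last first.
          by rewrite /index_iota (_ : r - (r - 2) = 2)%N /=; [congr [:: _; _]|]; lia.
        apply/permP => q; rewrite /= -!cats1 !count_cat /= /kid /=; lia.
      + by rewrite /Ph -[hollow (Store _ _ _ _) _]/(hollow s1 (rem u L1)); sred; lia.
    steps; move=> _; exists Ph; last first.
      by rewrite /Ph; move: le; rewrite spE hE; lia.
    split; first by sred.
    exists (rem u L1), sl; split=> //.
    + apply: hinv_perm Hr; rewrite /stk; sred.
      have r1' : r = 1%N by lia.
      rewrite !addn1 !mkseq_upd -/r r1' /index_iota /=.
      apply/permP => q; rewrite /= -!cats1 !count_cat /= /kid /= (_ : 1 - 2 = 0)%N ?subnn ?addn0 //; lia.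
    + by rewrite /Ph -[hollow (Store _ _ _ _) _]/(hollow s1 (rem u L1)); sred; lia.
  steps; apply: wp_if; sred; rewrite -/p -/u -/r => r1; first by lia.
  steps; move=> _; exists Ph; last first.
    by rewrite /Ph; move: le; rewrite spE hE; lia.
  split; first by sred.
  exists (rem u L1), sl; split=> //.
  + by move: Hr; rewrite (_ : r = 0)%N; [|lia].
  + by rewrite /Ph -[hollow (Store _ _ _ _) _]/(hollow s1 (rem u L1)); sred; lia.
- move=> s' Bud [c1 [L' [sl' [H' so' mr' rkm' le']]]] _; sred => nz; split; first by lia.
  have sp0 : nvar s' xSP = 0%N by lia.
  move=> t le1; exists L', sl'; split; last by rewrite /Bud0 in le1; lia.
  by split=> //; move: H'; rewrite /stk sp0.
Qed.

End Fixed.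
End Pop.

(** * Choosing the best root and exposing its children *)

Section ScanKids.
Variables (R : realType) (sv : nat -> nat -> R) (sc : nat -> nat -> nat).
Local Notation store := (store R).
Local Notation wp := (wp sv sc).
Implicit Types s : store.

Section Fixed.
Variables (W B : nat) (A F : pred nat) (K : nat -> R).
Local Notation hinv := (hinv W A F K).

Definition best s := if nvar s xB == 0%N then [::] else [:: nvar s xB].

(** The occupied slots carry distinct ranks below [2 * B], so at most that many roots return to the
    stack. The loop does not alter the heap, hence the invariant is stated for [heap_of s]
    throughout. *)
Lemma scan_spec s L sl : hinv (heap_of s) L sl -> slots_ok s sl ->
  nvar s xSP = 0%N -> nvar s xB = 0%N -> (nvar s xI <= 2 * B)%N ->
  (forall u, u \in sl -> (narr s aRK u < nvar s xI)%N) ->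
  wp scan_loop s (fun s' t =>
    [/\ hinv (heap_of s) L (best s' ++ stk s'), forall i, narr s' aSL i = 0%N,
        (nvar s' xSP <= 2 * B)%N,
        forall w, w \in best s' ++ stk s' -> rarr s rKY (nvar s' xB) <= rarr s rKY w
      & forall w, w \in best s' -> full (heap_of s) w] /\
    (nvar s' xB = 0%N -> stk s' = [::]) /\
    (t <= 200 * B + 30)%N).
Proof.
move=> H0 so0 sp0 b0 iB rk0.
pose Inv s' Bud := heap_of s' = heap_of s /\ exists sl' : seq nat,
  [/\ hinv (heap_of s) L (best s' ++ stk s' ++ sl'), slots_ok s' sl',
      forall u, u \in sl' -> (narr s aRK u < nvar s' xI)%N,
      (nvar s' xSP + nvar s' xI <= 2 * B)%N
    & forall w, w \in best s' ++ stk s' -> rarr s rKY (nvar s' xB) <= rarr s rKY w] /\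
  [/\ forall w, w \in best s' -> full (heap_of s) w,
      nvar s' xB = 0%N -> stk s' = [::]
    & (100 * nvar s' xI + 20 <= Bud)%N].
apply: (wp_whilef (I := Inv) (B := (200 * B + 20)%N)).
- split=> //; exists sl; rewrite /best b0 /= /stk sp0 /=; split; split=> //; rewrite ?sp0; lia.
- move=> s1 Bud [hE [sl1 [[H so rkI spI mn] [fb b0s le]]]] _; sred => I0.
  set i := (nvar s1 xI - 1)%N; set u := narr s1 aSL i.
  have slL w : w \in sl1 -> w \in L.
    by move=> wsl; apply: (rts_sub H); rewrite !mem_cat wsl !orbT.
  have rkE : narr s1 aRK = narr s aRK := congr1 (@rk R) hE.
  have fullE : full (heap_of s1) =1 full (heap_of s) by rewrite hE.
  have so1 u' : u' \in sl1 -> narr s1 aSL (narr s aRK u') = u'.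
    by move=> /(so.1)[]; rewrite rkE.
  have so2 j : narr s1 aSL j != 0%N ->
      narr s1 aSL j \in sl1 /\ narr s aRK (narr s1 aSL j) = j.
    by move=> /(so.2)[]; rewrite rkE.
  have usl1 : uniq sl1.
    by have := rts_uniq H; rewrite catA cat_uniq => /and3P[].
  (* The slot [i] is cleared whether or not it was occupied. *)
  pose sl2 := rem u sl1.
  have sl2P w : w \in sl2 -> (w != u) && (w \in sl1) by rewrite mem_rem_uniq.
  have rk2 w : w \in sl2 -> (narr s aRK w < i)%N.
    move=> /sl2P/andP[wu wsl]; have := rkI w wsl.
    suff: narr s aRK w != i by rewrite /i; lia.
    by apply: contraNneq wu => e; rewrite /u -e so1.
  have slok (s2 : store) : narr s2 aSL = upd (narr s1 aSL) i 0%N ->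
      heap_of s2 = heap_of s1 -> slots_ok s2 sl2.
    move=> e1 e2; have rkE2 : narr s2 aRK = narr s aRK.
      by rewrite -rkE; exact (congr1 (@rk R) e2).
    split=> [w w2|j].
      have /andP[wu wsl] := sl2P w w2; rewrite rkE2 e1 updN; last first.
        by rewrite neq_ltn rk2.
      by rewrite so1 // e2; split=> //; have [] := so.1 w wsl.
    rewrite e1 rkE2 /upd; case: (eqVneq j i) => // ji /so2[a b].
    rewrite mem_rem_uniq // inE a andbT; split=> //.
    apply: contraNneq ji => e; rewrite -b e; have [|_ ->] := so2 i; last exact: eqxx.
    by rewrite -/u; have := hi_bd H (slL _ a); rewrite e; lia.
  pose Bud' := (100 * i + 20)%N.
  steps; apply: wp_if; sred; rewrite -/i -/u => u0; last first.
    have uz : u = 0%N by lia.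
    have sl2E : sl2 = sl1.
      rewrite /sl2 rem_id // uz; apply/negP => /slL/(hi_bd H); by rewrite ltnn.
    steps; move=> _; exists Bud'; last by move: le; rewrite /Bud' /i; lia.
    split; first exact hE.
    exists sl2; split; split=> //.
    + by rewrite sl2E.
    + exact: slok.
    + by sred; lia.
  have ui : u \in sl1 /\ narr s aRK u = i by apply: so2; rewrite -/u; lia.
  have [usl ru] := ui.
  have fu : full (heap_of s) u by rewrite -fullE; have [] := so.1 u usl.
  have uL := slL u usl.
  apply: wp_if; sred => xb.
    have {}xb : nvar s1 xB = 0%N by apply/eqP.
    have st0 := b0s xb.
    steps; move=> _; exists Bud'; last by move: le; rewrite /Bud' /i; lia.
    split; first exact hE.
    have un0 : (u == 0%N) = false by lia.
    exists sl2; split; split=> //.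
    + rewrite /best; sred; rewrite -/u un0 (_ : stk _ = [::]); last exact st0.
      by apply: hinv_perm H; rewrite /best xb eqxx st0; exact: perm_to_rem.
    + exact: slok.
    + by sred; lia.
    + move=> w; rewrite /best; sred; rewrite -/u un0 (_ : stk _ = [::]) ?cats0 ?inE; last exact st0.
      by move/eqP->.
    + by move=> w; rewrite /best; sred; rewrite -/u un0 inE => /eqP->.
  have xbF : (nvar s1 xB == 0%N) = false by apply/negbTE.
  have spm : (nvar s1 xSP + i + 1 <= 2 * B)%N by rewrite /i; lia.
  have un0 : (u == 0%N) = false by lia.
  rewrite /best xbF in H mn fb.
  steps; apply: wp_if; sred; rewrite -/i -/u => lt.
    have {}lt : rarr s rKY u < rarr s rKY (nvar s1 xB).
      by rewrite -[rarr s rKY](congr1 (@ky R) hE : rarr s1 rKY = _).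
    steps; move=> _; exists Bud'; last by move: le; rewrite /Bud' /i; lia.
    split; first exact hE.
    exists sl2; split; split=> //.
    + rewrite /best; sred; rewrite -/u un0 /stk; sred; rewrite addn1 mkseq_upd.
      apply: hinv_perm H; apply/permP => q; rewrite -cats1 !count_cat.
      rewrite (permP (perm_to_rem usl)) /= -/sl2 -/(stk s1); lia.
    + exact: slok.
    + by sred; lia.
    + move=> w; rewrite /best; sred; rewrite -/u un0 /stk; sred; rewrite addn1 mkseq_upd.
      rewrite inE mem_rcons inE => /or3P[/eqP->//|/eqP->|wst]; first exact: ltW.
      by apply: le_trans (ltW lt) (mn _ _); rewrite inE wst orbT.
    + by move=> w; rewrite /best; sred; rewrite -/u un0 inE => /eqP->.
    + by sred; rewrite -/i -/u => e; rewrite e in un0.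
  have {}lt : rarr s rKY (nvar s1 xB) <= rarr s rKY u.
    by rewrite leNgt -[rarr s rKY](congr1 (@ky R) hE : rarr s1 rKY = _).
  steps; move=> _; exists Bud'; last by move: le; rewrite /Bud' /i; lia.
  split; first exact hE.
  exists sl2; split; split=> //.
  + rewrite /best; sred; rewrite xbF /stk; sred; rewrite addn1 mkseq_upd.
    apply: hinv_perm H; apply/permP => q; rewrite -cats1 !count_cat.
    rewrite (permP (perm_to_rem usl)) /= -/sl2 -/(stk s1); lia.
  + exact: slok.
  + by sred; lia.
  + move=> w; rewrite /best; sred; rewrite xbF /stk; sred; rewrite addn1 mkseq_upd.
    rewrite inE mem_rcons inE => /or3P[/eqP->//|/eqP->//|wst].
    by apply: mn; rewrite inE wst orbT.
  + by move=> w; rewrite /best; sred; rewrite xbF => /fb.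
  + by sred => e; rewrite e in xbF.
- move=> s' Bud [hE [sl' [[H so rkI spI mn] [fb b0s le]]]] _; sred => nz; split; first by lia.
  have sl0 : sl' = [::].
    by case: (sl') rkI => // a l /(_ a); rewrite inE eqxx => /(_ isT); lia.
  move=> t le1; split; last by split=> //; lia.
  split=> //; first by move: H; rewrite sl0 cats0.
  - move=> i; apply/eqP; apply/negP => /negP/(so.2)[]; by rewrite sl0.
  - by lia.
Qed.

Lemma kids_spec s : nvar s xI = narr s aRK (nvar s xB) ->
  wp kids_loop s (fun s' t =>
    perm_eq (stk s') ([seq kid (heap_of s) (nvar s xB) j | j <- index_iota 0 (nvar s xI)]
                      ++ stk s) /\
    (nvar s' xSP = nvar s xSP + nvar s xI /\ t <= 50 * nvar s xI + 10)%N).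
Proof.
move=> Ie; set b := nvar s xB; set kd := kid (heap_of s) b.
pose Inv s' Bud := perm_eq (map kd (index_iota 0 (nvar s' xI)) ++ stk s')
    (map kd (index_iota 0 (nvar s xI)) ++ stk s) /\
  [/\ (nvar s' xSP + nvar s' xI = nvar s xSP + nvar s xI)%N, nvar s' xB = b,
    narr s' aBS = narr s aBS, narr s' aA = narr s aA & (50 * nvar s' xI + 5 <= Bud)%N].
apply: (wp_whilef (I := Inv) (B := (50 * nvar s xI + 5)%N)).
- by [].
- move=> s1 Bud [pq [e1 e2 e3 e4 le]] _; sred => I0; steps; move=> _.
  exists (50 * (nvar s1 xI - 1) + 5)%N; last by lia.
  split; last by split; sred => //; lia.
  sred; set i := (nvar s1 xI - 1)%N.
  have E : nvar s1 xI = i.+1 by rewrite /i; lia.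
  have iE : index_iota 0 i.+1 = rcons (index_iota 0 i) i.
    by rewrite /index_iota !subn0 -addn1 iotaD cats1.
  rewrite E iE map_rcons in pq; apply: perm_trans pq.
  rewrite /stk; sred; rewrite (addn1 (nvar s1 xSP)) mkseq_upd e2 e3 e4 -/i.
  apply/permP => q; rewrite -!cats1 !count_cat /= addn0 -addnA; congr (_ + _)%N.
  by rewrite addnC.
- move=> s' Bud [pq [e1 e2 e3 e4 le]] _; sred => nz; split; first by lia.
  have i0 : nvar s' xI = 0%N by lia.
  by move=> t le1; split; [move: pq; rewrite i0 /=|split; lia].
Qed.

End Fixed.
End ScanKids.

Section ExtractMin.
Variables (R : realType) (sv : nat -> nat -> R) (sc : nat -> nat -> nat).
Local Notation store := (store R).
Local Notation wp := (wp sv sc).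
Implicit Types s : store.

(** An active item has a node and thus, by [climb], a root below or equal to it in key; the best
    root is therefore minimal among all active items, and as it is full it is the current node of an
    active item. *)
Lemma extract_min_spec s phi gam B : heap_ok s phi gam -> (gam <= 2 ^ B)%N ->
  (2 * B + 1 < nvar s xW)%N -> (exists y, act s y) ->
  wp extract_min s (fun s' t =>
    [/\ act s (nvar s' xQ),
        forall y, act s y -> key s (nvar s' xQ) <= key s y
      & narr s' aST = upd (narr s aST) (nvar s' xQ) 2] /\
    exists phi', heap_ok s' phi' gam /\
      (t + 200 * phi' <= 200 * phi + 3000 * B + 1000)%N).
Proof.
move=> [sz [L [H le1 le2]]] gB BW [y0 ay0].
pose W := nvar s xW; pose A := act s; pose F := fr s; pose K := key s.
rewrite -/W -/A -/F -/K in H BW.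
have cB : (nvar s xCN <= 2 ^ B)%N by apply: leq_trans gB.
rewrite /extract_min; steps; set s0 := Store _ _ _ _.
have cB0 : (nvar s0 xCN <= 2 ^ B)%N by [].
have H0 : hinv W A F K (heap_of s0) L (stk s0) by exact H.
apply: wp_frame; apply: wp_mono (pop_spec _ _ BW cB0 H0 sz (erefl _)).
move=> s1 t1 [L1 [sl [[H1 so1 sp1 mr1 rk1] tm1]]] [f1 f2 f3].
steps; set s2 := Store _ _ _ _.
have H2 : hinv W A F K (heap_of s2) L1 sl by exact H1.
apply: wp_frame; apply: wp_mono (scan_spec _ _ H2 so1 sp1 (erefl _) mr1 rk1).
move=> s3 t3 [[H3 sz3 sp3 mn3 fb3] [b03 tm3]] [g1 g2 g3].
have hE : heap_of s3 = heap_of s2.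
  by rewrite /heap_of (g1 xCN isT) (g1 xNB isT) (g2 aND isT) (g2 aIT isT)
     (g2 aRK isT) (g2 aBS isT) (g2 aA isT) (g3 rKY isT).
have [ndL _ _] := hi_act H3 (ay0 : A y0).
have [v vr _] := climb H3 ndL.
set b := nvar s3 xB in mn3 fb3 *.
have b0 : b != 0%N.
  by apply/negP => /eqP b0; move: vr; rewrite /best -/b b0 eqxx b03.
have bE : best s3 = [:: b] by rewrite /best -/b (negbTE b0).
have br : b \in best s3 ++ stk s3 by rewrite bE inE eqxx.
have fb : full (heap_of s2) b by apply: fb3; rewrite bE inE eqxx.
have Aq := hi_full H3 (rts_sub H3 br) fb.
set q := it (heap_of s2) b in Aq.
have qE : q = narr s3 aIT b by exact (esym (congr1 (fun h => it h b) hE)).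
have ndq : nd (heap_of s2) q = b by exact/eqP.
have mnq y : A y -> K q <= K y.
  move=> Ay; have [yL _ <-] := hi_act H3 Ay; have [_ _ <-] := hi_act H3 Aq.
  have [w wr wk] := climb H3 yL; apply: le_trans wk; rewrite ndq; exact: mn3.
steps; rewrite -/b -qE; set s4 := Store _ _ _ _.
have eI : nvar s4 xI = narr s4 aRK (nvar s4 xB) by [].
apply: wp_frame; apply: wp_mono (kids_spec _ _ eI).
move=> s5 t5 [pq5 [sp5 tm5]] [k1 k2 k3].
have {}pq5 : perm_eq (stk s5)
    ([seq kid (heap_of s3) b j | j <- index_iota 0 (rk (heap_of s3) b)] ++ stk s3).
  exact pq5.
rewrite hE in pq5.
have eQ : nvar s5 xQ = q by rewrite (k1 xQ isT).
have stE : narr s5 aST = upd (narr s aST) q 2%N.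
  rewrite (k2 aST isT) /s4; sred.
  by rewrite (g2 aST isT) /s2; sred; rewrite (f2 aST isT).
have hE5 : heap_of s5 = heap_of s2.
  rewrite -hE /heap_of (k1 xCN isT) (k1 xNB isT) (k2 aND isT) (k2 aIT isT).
  by rewrite (k2 aRK isT) (k2 aBS isT) (k2 aA isT) (k3 rKY isT).
have WE : nvar s5 xW = W by rewrite (k1 xW isT) /s4; sred; rewrite (g1 xW isT) /s2; sred; rewrite (f1 xW isT).
have FE : fr s5 =1 F.
  move=> y; rewrite /fr stE /upd; case: (eqVneq y q) => [->|//].
  have /eqP e : narr s aST q == 1%N := Aq.
  by rewrite /F /fr e.
have KE : key s5 =1 K.
  move=> y; rewrite /key (k3 rL isT) (k3 rLB isT) /s4; sred.
  by rewrite (g3 rL isT) (g3 rLB isT) /s2; sred; rewrite (f3 rL isT) (f3 rLB isT).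
have AE y : act s5 y = A y && (nd (heap_of s2) y != b).
  rewrite /act stE /upd; case: (eqVneq y q) => [->|yq]; first by rewrite ndq eqxx andbF.
  rewrite -/(act s y) -/(A y); case: (boolP (A y)) => // Ay.
  have [_ e _] := hi_act H3 Ay; apply/esym; apply: contraNneq yq => e2.
  by rewrite -e e2.
have Hr := hinv_remove H3 br AE.
have rkB : (rk (heap_of s2) b < 2 * B)%N.
  apply: (root_rank BW H3 _ br); rewrite -[cn _]/(nvar s1 xCN) (f1 xCN isT).
  exact: cB.
split; first by rewrite eQ; split.
have holE : hollow s1 L1 = hollow s5 (rem b L1).
  rewrite /hollow hE5 (permP (perm_to_rem (rts_sub H3 br))) /= fb add0n.
  by [].
(* At most [2 * B] roots survive the scan and fewer than [2 * B] children of the minimum join them: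
   [4 * B] roots of weight 2. *)
exists (3 * hollow s5 (rem b L1) + 8 * B)%N; split.
  split.
    by move=> i; rewrite (k2 aSL isT); exact: sz3.
  exists (rem b L1); split.
  - rewrite hE5 WE; apply: (hinv_ext _ _ _ (hinv_perm _ Hr)) => //.
    + rewrite (_ : rem b _ = stk s3); last by rewrite bE /= eqxx.
      by rewrite /lo fb perm_sym.
  - have : (nvar s5 xSP <= 4 * B)%N; last by lia.
    rewrite sp5 /s4; sred; rewrite -[narr s3 aRK](congr1 (@rk R) (esym hE)).
    by move: sp3 rkB; rewrite /=; lia.
  - rewrite (k1 xCN isT) /s4; sred; rewrite (g1 xCN isT) /s2; sred.
    by rewrite (f1 xCN isT) /s0.
move: tm1 tm3 tm5; rewrite -holE -[hollow s0 L]/(hollow s L) -[nvar s0 xSP]/(nvar s xSP).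
have -> : nvar s4 xI = rk (heap_of s2) b by rewrite -hE.
lia.
Qed.
End ExtractMin.

(** * The program *)

Definition edge_loop : com := (
  xH ::= aHD`[$xV] ;;
  While (NLt #0 $xH)
  ( xX ::= aLB`[aTG`[$xH]] + $xS ;;
    RSet 0 (RAdd rL`r[$xQ] rC`r[aHE`[$xH]]) ;;
    xBT ::= #1 ;;
    xBA ::= $xQ ;;
    xBB ::= aHE`[$xH] ;;
    improve ;;
    xH ::= aNX`[$xH] ))%com.

Definition double_loop : com := (
  xI ::= #0 ;;
  xZ ::= $xL ;;
  While (NLt $xI $xZ)
  ( aSU`< $xL > ::= aSU`[$xI] + $xP ;;
    xL ::= $xL + #1 ;;
    xI ::= $xI + #1 ))%com.

(** [xD] is what remains of the code of the set after its higher digits are removed. A digit 0 marks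
    a terminal of the complement, for which the list of codes is doubled. *)
Definition subset_loop : com := (
  aSU`< #0 > ::= #0 ;;
  xL ::= #1 ;;
  xD ::= $xS ;;
  xJ ::= $xT - #1 ;;
  While (NLt #0 $xJ)
  ( xJ ::= $xJ - #1 ;;
    xP ::= aPW`[$xJ] ;;
    If (NLt $xD $xP)
    double_loop
    ( xD ::= $xD - $xP )))%com.

(** Entry 0 of the list is the empty set, which is not to be merged; hence the start at 1. *)
Definition set_loop : com := (
  xI ::= #1 ;;
  While (NLt $xI $xL)
  ( xZ ::= aLB`[$xV] + aSU`[$xI] ;;
    If (NEq aST`[$xZ] #2)
    ( xX ::= $xQ + aSU`[$xI] ;;
      RSet 0 (RAdd rL`r[$xQ] rL`r[$xZ]) ;;
      xBT ::= #2 ;;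
      xBA ::= $xQ ;;
      xBB ::= $xZ ;;
      improve )
    Skip ;;
    xI ::= $xI + #1 ))%com.

Definition main_loop : com := (
  While (BNot (NEq aST`[$xFU] #2))
  ( extract_min ;;
    xV ::= aLV`[$xQ] ;;
    xS ::= aLS`[$xQ] ;;
    aXV`< $xC > ::= $xV ;;
    aXS`< $xC > ::= $xS ;;
    xC ::= $xC + #1 ;;
    edge_loop ;;
    subset_loop ;;
    set_loop ))%com.

Definition back_loop : com := (
  aMK`< $xFU > ::= #1 ;;
  xI ::= $xC ;;
  While (NLt #0 $xI)
  ( xI ::= $xI - #1 ;;
    xQ ::= aLB`[aXV`[$xI]] + aXS`[$xI] ;;
    If (NLt #0 aMK`[$xQ])
    ( If (NEq aBT`[$xQ] #1)
      ( aF`< aBB`[$xQ] > ::= #1 ;;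
        aMK`< aBA`[$xQ] > ::= #1 )
      ( If (NEq aBT`[$xQ] #2)
        ( aMK`< aBA`[$xQ] > ::= #1 ;;
          aMK`< aBB`[$xQ] > ::= #1 )
        Skip ) )
    Skip ))%com.

Definition power_loop : com := (
  xK ::= #1 ;;
  xJ ::= #0 ;;
  While (NLt ($xJ + #1) $xT)
  ( aPW`< $xJ > ::= $xK ;;
    xK ::= $xK + $xK ;;
    xJ ::= $xJ + #1 ))%com.

(** As [xK] is 2^(k-1), the second argument of the query is 2^k - 1 - I, the code of the complement
    of I in the whole terminal set, root included. *)
Definition row_loop : com := (
  xI ::= #0 ;;
  While (NLt $xI $xK)
  ( aLV`< $xQ > ::= $xV ;;
    aLS`< $xQ > ::= $xI ;;
    Query 0 $xV ($xK + $xK - #1 - $xI) ;;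
    RPut rLB $xQ (RVar 0) ;;
    xQ ::= $xQ + #1 ;;
    xI ::= $xI + #1 ))%com.

(** The first label of each row has the empty set and is settled from the start, with value 0 by
    default. The row offsets stored in [aLB] replace multiplication. *)
Definition label_loop : com := (
  xV ::= #0 ;;
  xQ ::= #0 ;;
  While (NLt $xV $xN)
  ( aLB`< $xV > ::= $xQ ;;
    aST`< $xQ > ::= #2 ;;
    row_loop ;;
    xV ::= $xV + #1 ))%com.

Definition half_edge a b : com := (
  aTG`< $xH > ::= b`[$xI] ;;
  aHE`< $xH > ::= $xI ;;
  aNX`< $xH > ::= aHD`[a`[$xI]] ;;
  aHD`< a`[$xI] > ::= $xH ;;
  xH ::= $xH + #1)%com.

(** Half-edges are numbered from 1, so that 0 can end a linked list and the zero-initialized heads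
    denote empty lists. *)
Definition adjacency_loop : com := (
  xI ::= #0 ;;
  xH ::= #1 ;;
  While (NLt $xI $xM)
  ( half_edge aE1 aE2 ;;
    half_edge aE2 aE1 ;;
    xI ::= $xI + #1 ))%com.

Definition terminal_loop : com := (
  xBT ::= #0 ;;
  xJ ::= #0 ;;
  While (NLt ($xJ + #1) $xT)
  ( RSet 0 RZero ;;
    xX ::= aLB`[aTE`[$xJ]] + aPW`[$xJ] ;;
    improve ;;
    xJ ::= $xJ + #1 ))%com.

Definition program : com := (
  power_loop ;;
  (* The width 4n + 4k + 20 exceeds 2B + 1 for the exponent B = 2k + 2 log n + 2 bounding the number
     of nodes, and additions suffice to compute it. The first block, like node number 0, belongs to
     the dummy. *)
  xW ::= $xN + $xN + $xN + $xN + $xT + $xT + $xT + $xT + #20 ;;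
  xCN ::= #1 ;;
  xNB ::= $xW ;;
  label_loop ;;
  adjacency_loop ;;
  terminal_loop ;;
  xFU ::= aLB`[aTE`[$xT - #1]] + ($xK - #1) ;;
  main_loop ;;
  back_loop)%com.

Fixpoint chain (nx : nat -> nat) h (hs : seq nat) : Prop :=
  if hs is a :: hs' then [/\ h = a, a <> 0%N & chain nx (nx a) hs'] else h = 0%N.

(** * Representation of the states of the algorithm in memory *)

Section Representation.
Variables (R : realType) (V : finType) (E : {set {set V}}) (c : {set V} -> R).
Variables (T : {set V}) (r : V) (L : V -> {set V} -> R).
Variables (vs : seq V) (es : seq (V * V)) (ts : seq V).
Variables (sv : nat -> nat -> R) (sc : nat -> nat -> nat).
Hypotheses (rT : r \in T) (pres : presents E T r vs es ts).
Local Notation label := (V * {set V})%type.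
Local Notation store := (store R).
Local Notation wp := (wp sv sc).
Local Notation K := (2 ^ #|T|.-1)%N.
Local Notation T' := (T :\ r).
Local Notation lcode := (lcode T vs ts).
Local Notation valid := (valid T r).
Local Notation nbl := (nbl r es (size es)).
Local Notation eindex e := (index e [seq edge_of p | p <- es]).
Implicit Types (s : store) (d : ds_state R V) (x y : label).

(** The tables made before the main loop. That later code does not write them is a syntactic check,
    [static_frame]. *)
Record static s : Prop := Static {
  sk_K : nvar s xK = K;
  sk_T : nvar s xT = #|T|;
  sk_W : nvar s xW = (4 * #|V| + 4 * #|T| + 20)%N;
  sk_FU : nvar s xFU = lcode (r, T');
  sk_LB : forall v, narr s aLB (vcode vs v) = (vcode vs v * K)%N;
  sk_LV : forall x, valid x -> narr s aLV (lcode x) = vcode vs x.1;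
  sk_LS : forall x, valid x -> narr s aLS (lcode x) = tcode ts x.2;
  sk_PW : forall j, (j < #|T|.-1)%N -> narr s aPW j = (2 ^ j)%N;
  sk_adj : forall v, exists2 hs, chain (narr s aNX) (narr s aHD (vcode vs v)) hs
    & [seq (narr s aTG h, narr s aHE h) | h <- hs] = [seq (vcode vs p.1, p.2) | p <- nbl v];
  sk_C : forall j, (j < size es)%N -> rarr s rC j = c (edge_of (nth (r, r) es j));
  sk_L : forall x, valid x -> rarr s rLB (lcode x) = L x.1 (T :\: x.2) }.

Lemma static_frame p s s' : frame p s s' ->
  all (fun z => ~~ nmod p z) [:: xK; xT; xW; xFU] ->
  all (fun z => ~~ namod p z) [:: aLB; aLV; aLS; aPW; aNX; aHD; aTG; aHE] ->
  all (fun z => ~~ ramod p z) [:: rC; rLB] ->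
  static s -> static s'.
Proof.
move=> [f1 f2 f3] /= /and5P[a1 a2 a3 a4 _] /and5P[b1 b2 b3 b4 /and5P[b5 b6 b7 b8 _]].
move=> /and3P[c1 c2 _] [h1 h2 h3 h4 h5 h6 h7 h8 h9 h10 h11].
by split; rewrite ?f1 ?f2 ?f3.
Qed.

Definition back_code s q (B : {set label}) x : Prop :=
  match narr s aBT q with
  | 0 => B = set0
  | 1 => exists w, [/\ [set x.1; w] \in E, narr s aBA q = lcode (w, x.2),
           narr s aBB q = eindex [set x.1; w] & B = [set (w, x.2)]]
  | 2 => exists y z, [/\ valid y /\ valid z, y.2 != x.2, narr s aBA q = lcode y,
           narr s aBB q = lcode z & B = [set y; z]]
  | _ => False
  end.

(** The heap returns bare numbers; [re_code] turns any of them back into a label. Values are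
    compared only where the status is nonzero, because memory has no infinity. *)
Record represents s d : Prop := Rel {
  re_st : forall q, (narr s aST q <= 2)%N;
  re_dl : forall x, valid x -> dl d x =
    if narr s aST (lcode x) == 0%N then +oo%E else (rarr s rL (lcode x))%:E;
  re_N : forall x, valid x -> (x \in dN d) = (narr s aST (lcode x) == 1%N);
  re_P : forall x, valid x -> (x \in dP d) = (narr s aST (lcode x) == 2%N);
  re_code : forall q, narr s aST q != 0%N -> exists2 x, valid x & q = lcode x;
  re_NP : forall x, x \in dN d -> valid x;
  re_back : forall x, valid x -> back_code s (lcode x) (db d x) x }.

Definition back_args s (B : {set label}) x : Prop :=
  match nvar s xBT with
  | 0 => B = set0
  | 1 => exists w, [/\ [set x.1; w] \in E, nvar s xBA = lcode (w, x.2),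
           nvar s xBB = eindex [set x.1; w] & B = [set (w, x.2)]]
  | 2 => exists y z, [/\ valid y /\ valid z, y.2 != x.2, nvar s xBA = lcode y,
           nvar s xBB = lcode z & B = [set y; z]]
  | _ => False
  end.

Lemma improve_rel s d x a B phi gam : (1 < nvar s xW)%N -> represents s d -> heap_ok s phi gam ->
  valid x -> nvar s xX = lcode x -> rvar s 0%N = a -> back_args s B x ->
  wp improve s (fun s' t => [/\ (t <= 200)%N, represents s' (ds_improve d x a%:E B)
     & heap_ok s' (phi + 5) gam.+1]).
Proof.
move=> W2 Re Ho xv eX ea Bx; apply: wp_mono (improve_spec _ _ W2 Ho) => s' t [le].
have impE : improvable s = (a%:E < dl d x)%E && (x \notin dP d).
  rewrite /improvable eX (re_dl Re xv) (re_P Re xv) ea.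
  have := re_st Re (lcode x); case: (narr s aST (lcode x)) => [|[|[|]]] //= _.
  - by rewrite ltry.
  - by rewrite andbT lte_fin.
  by rewrite andbF.
rewrite impE /ds_improve; case: ifP => [/andP[_ xP]|_]; last first.
  move=> ->; split=> //; case: Ho => sz [L0 [h1 h2 h3]]; split=> //.
  by exists L0; split=> //; lia.
move=> [[e1 e2 e3 e4] [e5 Ho']]; split=> //.
rewrite eX in e1 e2 e3 e4 e5.
have inj y : valid y -> (lcode y == lcode x) = (y == x).
  by move=> yv; apply/eqP/eqP => [/(lcode_inj rT pres yv xv)|->].
have eX' y : valid y -> y != x -> lcode y != lcode x by move=> yv; rewrite inj.
case: (Re) => h1 h2 h3 h4 h5 h6 h7; split=> /=.
- by move=> q; rewrite e1 /upd; case: eqP.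
- move=> y yv; rewrite e1 e2; case: (eqVneq y x) => [->|yx]; first by rewrite !updE ea.
  by rewrite !updN ?eX' // h2.
- move=> y yv; rewrite e1 in_setU1; case: (eqVneq y x) => [->|yx]; first by rewrite updE.
  by rewrite updN ?eX' //= h3.
- move=> y yv; rewrite e1; case: (eqVneq y x) => [->|yx]; first by rewrite updE (negbTE xP).
  by rewrite updN ?eX' //= h4.
- by move=> q; rewrite e1 /upd; case: (eqVneq q (lcode x)) => [-> _|_ /h5//]; exists x.
- by move=> y; rewrite in_setU1 => /orP[/eqP->|/h6].
- move=> y yv; rewrite /back_code e3 e4 e5; case: (eqVneq y x) => [->|yx].
    by rewrite !updE; exact: Bx.
  by rewrite !updN ?eX' //; exact: h7.
Qed.

End Representation.

Lemma heap_ok_le (R : realType) (s : store R) phi gam phi' gam' :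
  heap_ok s phi gam -> (phi <= phi')%N -> (gam <= gam')%N -> heap_ok s phi' gam'.
Proof.
move=> [sz [L [h1 h2 h3]]] le1 le2; split=> //; exists L; split=> //; lia.
Qed.

Lemma dP_scan_edge (R : realType) (V : finType) (c : {set V} -> R) x d w :
  dP (ds_scan_edge c x d w) = dP d.
Proof. by rewrite /ds_scan_edge /ds_improve; case: ifP. Qed.

Lemma dP_scan_set (R : realType) (V : finType) x (d : ds_state R V) J :
  dP (ds_scan_set x d J) = dP d.
Proof. by rewrite /ds_scan_set /ds_improve; case: ifP. Qed.

(** * The inner loops of one iteration *)

Section EdgeLoop.
Variables (R : realType) (V : finType) (E : {set {set V}}) (c : {set V} -> R).
Variables (T : {set V}) (r : V) (L : V -> {set V} -> R).
Variables (vs : seq V) (es : seq (V * V)) (ts : seq V).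
Variables (sv : nat -> nat -> R) (sc : nat -> nat -> nat).
Hypotheses (rT : r \in T) (pres : presents E T r vs es ts).
Local Notation label := (V * {set V})%type.
Local Notation store := (store R).
Local Notation wp := (wp sv sc).
Local Notation lcode := (lcode T vs ts).
Local Notation valid := (valid T r).
Local Notation nbl := (nbl r es (size es)).
Local Notation static := (static c T r L vs es ts).
Local Notation represents := (represents E T r vs es ts).
Implicit Types (s : store) (d : ds_state R V) (x y : label).

Lemma rel_ext s s' d : narr s' aST = narr s aST -> narr s' aBT = narr s aBT ->
  narr s' aBA = narr s aBA -> narr s' aBB = narr s aBB -> rarr s' rL = rarr s rL ->
  represents s d -> represents s' d.
Proof.
move=> e1 e2 e3 e4 e5 [h1 h2 h3 h4 h5 h6 h7]; split; rewrite ?e1 ?e5 //.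
by move=> x xv; rewrite /back_code e2 e3 e4; exact: h7.
Qed.

Lemma static_W s : static s -> (1 < nvar s xW)%N.
Proof. by move/sk_W->; rewrite ltn_addl. Qed.

Lemma edge_spec s d x phi gam : static s -> represents s d -> heap_ok s phi gam ->
  valid x -> x \in dP d ->
  nvar s xV = vcode vs x.1 -> nvar s xQ = lcode x -> nvar s xS = tcode ts x.2 ->
  wp edge_loop s (fun s' t =>
    [/\ represents s' (foldl (ds_scan_edge c x) d (map fst (nbl x.1))),
        heap_ok s' (phi + 5 * size (nbl x.1)) (gam + size (nbl x.1))
      & (t <= 400 * size (nbl x.1) + 50)%N]).
Proof.
move=> St Re Ho xv xP eV eQ eS; rewrite /edge_loop; steps.
set dfin := foldl _ _ _; set s0 := Store _ _ _ _.
have St0 : static s0 by case: St.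
pose Inv s1 Bud := exists (hs : seq nat) (nbs : seq (V * nat)) d1 phi1 gam1,
  [/\ chain (narr s1 aNX) (nvar s1 xH) hs,
      [seq (narr s0 aTG h, narr s0 aHE h) | h <- hs] = [seq (vcode vs p.1, p.2) | p <- nbs],
      {subset nbs <= nbl x.1}, represents s1 d1 & heap_ok s1 phi1 gam1] /\
  [/\ x \in dP d1, foldl (ds_scan_edge c x) d1 (map fst nbs) = dfin,
      (phi1 + 5 * size nbs <= phi + 5 * size (nbl x.1))%N,
      (gam1 + size nbs <= gam + size (nbl x.1))%N & (400 * size nbs + 10 <= Bud)%N].
have [hs0 ch0 mp0] := sk_adj St0 x.1.
apply: (wp_whilef (I := Inv) (B := (400 * size (nbl x.1) + 10)%N)).
- exists hs0, (nbl x.1), d, phi, gam; split; split=> //.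
  + by move: ch0; rewrite /s0; sred; rewrite eV.
  + by apply: rel_ext Re.
- move=> s1 Bud [hs [nbs [d1 [phi1 [gam1 [[ch mp sub Re1 Ho1] [xP1 fo le1 le2 le3]]]]]]] Fr.
  sred => H0.
  have St1 : static s1 by apply: static_frame Fr _ _ _ St0.
  case: hs ch mp => [/= e|h hs /= [eh h0 ch]]; first by rewrite e in H0.
  case: nbs sub fo le1 le2 le3 => [//|[w j] nbs] sub fo le1 le2 le3 /= [etg ehe mp].
  have [f1 f2 f3] := Fr.
  have wj : (w, j) \in nbl x.1 by apply: sub; rewrite mem_head.
  have [wE jE] := nbl_index pres wj.
  have [jlt je] := nblP (leqnn _) wj.
  have {}etg : narr s1 aTG h = vcode vs w by rewrite (f2 aTG isT).
  have {}ehe : narr s1 aHE h = j by rewrite (f2 aHE isT).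
  have eX : (narr s1 aLB (vcode vs w) + tcode ts x.2)%N = lcode (w, x.2).
    by rewrite (sk_LB St1).
  have stx : narr s1 aST (lcode x) == 2%N by rewrite -(re_P Re1).
  have dlx : dl d1 x = (rarr s1 rL (lcode x))%:E.
    by rewrite (re_dl Re1) // (eqP stx).
  steps; rewrite eh etg ehe (f1 xS isT) (f1 xQ isT) /s0; sred; rewrite eQ eS eX.
  rewrite (sk_C St1 jlt) -je.
  set s2 := Store _ _ _ _.
  have W2 : (1 < nvar s2 xW)%N by exact (static_W St1).
  have Re2 : represents s2 d1 by apply: rel_ext Re1.
  have wv : valid (w, x.2) by [].
  have Ba : back_args E T r vs es ts s2 [set x] (w, x.2).
    exists x.1; split; cbn [fst snd];
      by rewrite -?surjective_pairing ?[[set w; x.1]]setUC ?jE.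
  have sE : ds_scan_edge c x d1 w = ds_improve d1 (w, x.2) (rvar s2 0%N)%:E [set x].
    by rewrite /ds_scan_edge dlx.
  have iR := improve_rel sv sc rT pres W2 Re2 Ho1 wv (erefl _) (erefl _) Ba.
  apply: wp_frame; apply: wp_mono iR => s3 t3 [le4 Re3 Ho3] [g1 g2 g3].
  steps; move=> _; exists (400 * size nbs + 10)%N; last by move: le3 => /=; lia.
  exists hs, nbs, (ds_scan_edge c x d1 w), (phi1 + 5)%N, gam1.+1; split; split=> //.
  + by sred; rewrite (g2 aNX isT) (g1 xH isT) /s2; sred; rewrite eh.
  + by move=> p ps; apply: sub; rewrite inE ps orbT.
  + by rewrite sE; apply: rel_ext Re3.
  + by rewrite dP_scan_edge.
  + by move: le1 => /=; lia.
  + by move: le2 => /=; lia.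
- move=> s' Bud [hs [nbs [d1 [phi1 [gam1 [[ch mp sub Re1 Ho1] [xP1 fo le1 le2 le3]]]]]]] Fr.
  sred => H0; split; first by lia.
  case: hs ch mp => [/= e|h hs /= [eh h0 ch]]; last by move: H0; rewrite eh; lia.
  case: nbs sub fo le1 le2 le3 => [|//] sub fo le1 le2 le3 _ t le4.
  split; [by rewrite -fo| |lia].
  by apply: heap_ok_le Ho1 _ _; move: le1 le2 => /=; lia.
Qed.

End EdgeLoop.

Section SubsetLoop.
Variables (R : realType) (V : finType) (E : {set {set V}}) (c : {set V} -> R).
Variables (T : {set V}) (r : V) (L : V -> {set V} -> R).
Variables (vs : seq V) (es : seq (V * V)) (ts : seq V).
Variables (sv : nat -> nat -> R) (sc : nat -> nat -> nat).
Hypotheses (rT : r \in T) (pres : presents E T r vs es ts).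
Local Notation label := (V * {set V})%type.
Local Notation store := (store R).
Local Notation wp := (wp sv sc).
Local Notation T' := (T :\ r).
Local Notation static := (static c T r L vs es ts).
Implicit Types (s : store) (d : ds_state R V) (J S : {set V}).

Lemma double_spec s : wp double_loop s (fun s' t =>
  [/\ nvar s' xL = (nvar s xL + nvar s xL)%N,
      forall i, (i < nvar s xL)%N -> narr s' aSU i = narr s aSU i,
      forall i, (i < nvar s xL)%N ->
        narr s' aSU (nvar s xL + i)%N = (narr s aSU i + nvar s xP)%N
    & (t <= 30 * nvar s xL + 20)%N]).
Proof.
rewrite /double_loop; steps; set s0 := Store _ _ _ _.
set l := nvar s xL.
pose Inv s1 Bud := [/\ nvar s1 xL = (l + nvar s1 xI)%N,
   forall i, (i < l)%N -> narr s1 aSU i = narr s aSU i,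
   forall i, (i < nvar s1 xI)%N -> narr s1 aSU (l + i)%N = (narr s aSU i + nvar s xP)%N,
   (nvar s1 xI <= l)%N & (30 * (l - nvar s1 xI) + 5 <= Bud)%N].
apply: (wp_whilef (I := Inv) (B := (30 * l + 5)%N)).
- by split=> //; rewrite /s0; sred; lia.
- move=> s1 Bud [e1 h1 h2 il le] [f1 f2 f3]; sred.
  rewrite (f1 xZ isT) {1}/s0; sred; rewrite -/l => lt.
  steps; move=> _; exists (30 * (l - (nvar s1 xI).+1) + 5)%N; last by lia.
  split; sred; rewrite ?addn1 //; first by rewrite e1 addnS.
  - by move=> i il'; rewrite updN ?h1 // e1; lia.
  - move=> i; rewrite ltnS leq_eqVlt => /orP[/eqP->|ilt].
      by rewrite e1 updE h1 // (f1 xP isT).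
    by rewrite e1 updN ?h2 //; lia.
- move=> s' Bud [e1 h1 h2 il le] [f1 f2 f3]; sred.
  rewrite (f1 xZ isT) {1}/s0; sred; rewrite -/l => lt; split; first by lia.
  have e : nvar s' xI = l by lia.
  move=> t le'; split=> //; first by rewrite e1 e.
    by move=> i il'; apply: h2; rewrite e.
  by lia.
Qed.

(** Before digit j is read, the list holds the codes of all subsets of [D] at j + 1, the terminals
    outside [S] of larger index. Doubling a list of length l takes O(l) time and adds l entries, so
    the growth of the list pays for it and the total is linear in the final length. *)
Lemma subset_spec s S : static s -> S \subset T' -> nvar s xS = tcode ts S ->
  wp subset_loop s (fun s' t => exists Jl : seq {set V},
    [/\ uniq Jl, forall J, (J \in Jl) = (J \subset T' :\: S), nth set0 Jl 0 = set0,
        nvar s' xL = size Jl & forall i, (i < size Jl)%N ->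
          narr s' aSU i = tcode ts (nth set0 Jl i)] /\
    (size Jl = 2 ^ #|T' :\: S| /\ t <= 60 * #|T| + 60 * 2 ^ #|T' :\: S| + 50)%N).
Proof.
move=> St ST eS; rewrite /subset_loop; steps; set s0 := Store _ _ _ _.
have St0 : static s0 by case: St.
have [uts tsm szts irts tlt] := ts_props rT pres.
pose D j := [set t in T' :\: S | (j <= index t ts)%N].
pose Fin := (2 ^ #|T' :\: S|)%N.
have szl (Jl : seq {set V}) j : uniq Jl -> (forall J, (J \in Jl) = (J \subset D j)) ->
    (size Jl = 2 ^ #|D j|)%N.
  move=> u m; rewrite -card_powerset -(card_uniqP u).
  by apply: eq_card => J; rewrite m powersetE.
have szF (Jl : seq {set V}) j : uniq Jl -> (forall J, (J \in Jl) = (J \subset D j)) ->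
    (size Jl <= Fin)%N.
  move=> u m; rewrite (szl _ _ u m) leq_exp2l //; apply: subset_leq_card.
  by apply/subsetP => t; rewrite inE => /andP[].
pose Inv s1 Bud := exists Jl : seq {set V},
  [/\ uniq Jl, forall J, (J \in Jl) = (J \subset D (nvar s1 xJ)), nth set0 Jl 0 = set0,
      nvar s1 xL = size Jl & forall i, (i < size Jl)%N ->
          narr s1 aSU i = tcode ts (nth set0 Jl i)] /\
  [/\ nvar s1 xD = bsum (fun i => nth r ts i \in S) (nvar s1 xJ),
      (nvar s1 xJ <= #|T|.-1)%N &
      (60 * nvar s1 xJ + 40 * (Fin - size Jl) + 10 <= Bud)%N].
apply: (wp_whilef (I := Inv) (B := (60 * #|T| + 40 * Fin + 10)%N)).
- exists [:: set0]; rewrite /s0; sred; rewrite (sk_T St) subn1.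
  split; split=> //.
  + move=> J; rewrite inE -subset0 (_ : D _ = set0) //; apply/setP => t.
    rewrite !inE; apply/negP => /andP[/andP[_ tT] le].
    by have := tlt t; rewrite !inE tT => /(_ isT); lia.
  + by case=> // _; rewrite /= updE tcode0.
  + by rewrite eS (tcodeE' rT pres).
  + by lia.
- move=> s1 Bud [Jl [[u m n0 eL aS] [eD jk le]]] Fr; sred => j0.
  have St1 : static s1 by apply: static_frame Fr _ _ _ St0.
  set j := (nvar s1 xJ - 1)%N.
  have jE : nvar s1 xJ = j.+1 by rewrite /j; lia.
  have jlt : (j < #|T|.-1)%N by lia.
  rewrite jE in m eD le.
  have jts : (j < size ts)%N by rewrite szts; lia.
  pose tj := nth r ts j.
  have ij : index tj ts = j by rewrite index_uniq.
  have tjT : tj \in T'.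
    rewrite !inE -tsm mem_nth // andbT; apply/eqP => e; move: irts; rewrite -e ij; lia.
  have Dj t : t \in D j = (t \in D j.+1) || ((t == tj) && (tj \notin S)).
    rewrite !inE; have [->|ne] := eqVneq t tj.
      by rewrite ij leqnn ltnn !andbF /= andbT; move: tjT; rewrite !inE => ->; rewrite andbT.
    rewrite orbF; case: (boolP (t \in T)) => tT; rewrite ?andbF //.
    rewrite leq_eqVlt; case: (eqVneq j (index t ts)) => //= e.
    by move: ne; rewrite /tj e nth_index ?eqxx // tsm.
  steps; apply: wp_if; sred; rewrite -/j (sk_PW St1 jlt) eD => lt.
    set s2 := Store _ _ _ _.
    have tjS : tj \notin S by move: lt; rewrite ltnNge bsum_ge.
    have tjD : tj \notin D j.+1 by rewrite inE ij ltnn andbF.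
    have DjE : D j = tj |: D j.+1.
      by apply/setP => t; rewrite Dj tjS andbT in_setU1 orbC.
    apply: wp_frame; apply: wp_mono (double_spec s2) => s3 t3 [eL3 a1 a2 le3] [g1 g2 g3] _.
    have eL2 : nvar s2 xL = size Jl by rewrite -eL.
    have eP2 : nvar s2 xP = (2 ^ j)%N by [].
    rewrite eL2 eP2 in eL3 a1 a2 le3.
    have eJ : nvar s3 xJ = j by rewrite (g1 xJ isT).
    pose Jl' := Jl ++ [seq tj |: J | J <- Jl].
    have nJ J : J \in Jl -> tj \notin J.
      by rewrite m => /subsetP JD; apply/negP => /JD; rewrite (negbTE tjD).
    have u' : uniq Jl'.
      rewrite cat_uniq u map_inj_in_uniq ?u ?andbT /=.
        apply/hasPn => J /mapP[J' _ ->]; apply/negP => /nJ; by rewrite setU11.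
      move=> J1 J2 /nJ n1 /nJ n2 e; rewrite -(setU1K n1) -(setU1K n2); congr (_ :\ _).
      exact: e.
    have m' J : (J \in Jl') = (J \subset D j).
      rewrite mem_cat m DjE -subDset; apply/orP/idP.
        case=> [JD|/mapP[J' + ->]]; first by apply: subset_trans JD; exact: subsetDl.
        rewrite m => JD; apply: subset_trans JD; rewrite setDUl setDv set0U; exact: subsetDl.
      case: (boolP (tj \in J)) => tJ JD; last first.
        by left; move: JD; rewrite (setDidPl _) // disjoint_sym disjoints1.
      by right; apply/mapP; exists (J :\ tj); rewrite ?m // setD1K.
    have sz' : size Jl' = (size Jl + size Jl)%N by rewrite size_cat size_map.
    have Jl0 : (0 < size Jl)%N by rewrite (szl _ _ u m) expn_gt0.
    exists (60 * j + 40 * (Fin - size Jl') + 10)%N; last first.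
      by move: (szF _ _ u' m') le le3 Jl0; rewrite sz'; clear; lia.
    exists Jl'; rewrite eJ; split; split=> //.
    + by rewrite nth_cat Jl0.
    + by rewrite eL3 sz'.
    + move=> i ilt; rewrite nth_cat; case: ltnP => il.
        by rewrite a1 // aS.
      have il2 : (i - size Jl < size Jl)%N by move: ilt; rewrite sz' ltn_subLR.
      rewrite (nth_map set0) // -{1}(subnKC il) a2 // aS // tcodeU; last first.
        by rewrite disjoints1 nJ ?mem_nth.
      have tjTT : tj \in T by move: tjT; rewrite !inE => /andP[].
      by rewrite (tcode1 rT pres tjTT) ij addnC.
    + rewrite (g1 xD isT) /s2; sred; rewrite eD bsumS.
      by rewrite (_ : (nth r ts j \in S) = false) ?mul0n ?addn0 //; apply/negbTE.
    + by lia.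
  have tjS : tj \in S by move: lt; rewrite -leqNgt bsum_ge.
  steps; move=> _; exists (60 * j + 40 * (Fin - size Jl) + 10)%N; last by lia.
  have DjE : D j = D j.+1.
    by apply/setP => t; rewrite Dj tjS andbF orbF.
  exists Jl; split; split=> //; sred; rewrite -/j ?DjE //.
  + by rewrite eD bsumS /= (_ : (nth r ts j \in S) = true) // mul1n addnK.
  + by lia.
- move=> s' Bud [Jl [[u m n0 eL aS] [eD jk le]]] Fr; sred => j0; split; first by lia.
  have j0' : nvar s' xJ = 0%N by lia.
  have D0 : D 0 = T' :\: S by apply/setP => t; rewrite !inE andbT.
  move=> t le'; exists Jl; split; split=> //; rewrite ?(szl _ _ u m) ?j0' ?D0 //.
    by move=> J; rewrite m j0' D0.
  by lia.
Qed.

End SubsetLoop.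

Section SetLoop.
Variables (R : realType) (V : finType) (E : {set {set V}}) (c : {set V} -> R).
Variables (T : {set V}) (r : V) (L : V -> {set V} -> R).
Variables (vs : seq V) (es : seq (V * V)) (ts : seq V).
Variables (sv : nat -> nat -> R) (sc : nat -> nat -> nat).
Hypotheses (rT : r \in T) (pres : presents E T r vs es ts).
Local Notation label := (V * {set V})%type.
Local Notation store := (store R).
Local Notation wp := (wp sv sc).
Local Notation T' := (T :\ r).
Local Notation lcode := (lcode T vs ts).
Local Notation valid := (valid T r).
Local Notation static := (static c T r L vs es ts).
Local Notation represents := (represents E T r vs es ts).
Implicit Types (s : store) (d : ds_state R V) (x y : label) (J S : {set V}).

Lemma join_perm (P : {set label}) (x : label) (Jl : seq {set V}) :
  uniq Jl -> (forall J, (J \in Jl) = (J \subset T' :\: x.2)) -> nth set0 Jl 0 = set0 ->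
  perm_eq [seq J <- behead Jl | (x.1, J) \in P]
    (enum [set J : {set V} | [&& J != set0, J \subset T' :\: x.2 & (x.1, J) \in P]]).
Proof.
case: Jl => [|J0 Jl] /=; first by move=> _ /(_ set0); rewrite sub0set.
move=> /andP[n0 u] m e; subst J0; apply: uniq_perm; rewrite ?enum_uniq ?filter_uniq // => J.
rewrite mem_filter mem_enum inE -m inE; case: (eqVneq J set0) => [->|_] /=.
  by rewrite (negbTE n0) andbF.
by rewrite andbC.
Qed.

Lemma set_spec s d x phi gam (Jl : seq {set V}) :
  static s -> represents s d -> heap_ok s phi gam -> valid x -> x \in dP d ->
  nvar s xV = vcode vs x.1 -> nvar s xQ = lcode x ->
  uniq Jl -> (forall J, (J \in Jl) = (J \subset T' :\: x.2)) -> nth set0 Jl 0 = set0 ->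
  nvar s xL = size Jl ->
  (forall i, (i < size Jl)%N -> narr s aSU i = tcode ts (nth set0 Jl i)) ->
  wp set_loop s (fun s' t =>
    [/\ represents s' (foldl (ds_scan_set x) d [seq J <- behead Jl | (x.1, J) \in dP d]),
        heap_ok s' (phi + 5 * size Jl) (gam + size Jl)
      & (t <= 400 * size Jl + 50)%N]).
Proof.
move=> St Re Ho xv xP eV eQ u m n0 eL aS; rewrite /set_loop; steps.
set dfin := foldl _ _ _; set s0 := Store _ _ _ _.
have St0 : static s0 by case: St.
pose Inv s1 Bud := exists d1 phi1 gam1,
  [/\ represents s1 d1, heap_ok s1 phi1 gam1, dP d1 = dP d,
      foldl (ds_scan_set x) d1
        [seq J <- drop (nvar s1 xI) Jl | (x.1, J) \in dP d] = dfin &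
      (0 < nvar s1 xI)%N] /\
  [/\ (phi1 + 5 * (size Jl - nvar s1 xI) <= phi + 5 * size Jl)%N,
      (gam1 + (size Jl - nvar s1 xI) <= gam + size Jl)%N &
      (400 * (size Jl - nvar s1 xI) + 10 <= Bud)%N].
apply: (wp_whilef (I := Inv) (B := (400 * size Jl + 10)%N)).
- exists d, phi, gam; split; split; rewrite ?drop1 //.
  + by apply: rel_ext Re.
  + by rewrite /s0; sred; lia.
  + by rewrite /s0; sred; lia.
  + by rewrite /s0; sred; lia.
- move=> s1 Bud [d1 [phi1 [gam1 [[Re1 Ho1 Pd fo i0] [le1 le2 le3]]]]] Fr.
  have St1 : static s1 by apply: static_frame Fr _ _ _ St0.
  have [f1 f2 f3] := Fr; sred; rewrite (f1 xL isT) {1}/s0; sred; rewrite eL.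
  set i := nvar s1 xI in i0 fo le1 le2 le3 * => ilt.
  rewrite (drop_nth set0 ilt) /= in fo.
  set J := nth set0 Jl i in fo.
  have JJl : J \in Jl by exact: mem_nth.
  have J0 : J != set0.
    by rewrite -n0 /J nth_uniq //; [lia|exact: leq_ltn_trans ilt].
  have [JT Jx] : J \subset T' /\ [disjoint J & x.2] by apply/andP; rewrite -subsetD -m.
  have yv : valid (x.1, J) by [].
  have eS : narr s1 aSU i = tcode ts J by rewrite (f2 aSU isT) aS.
  have eY : (narr s1 aLB (nvar s1 xV) + narr s1 aSU i)%N = lcode (x.1, J).
    by rewrite (f1 xV isT) {1}/s0; sred; rewrite eV (sk_LB St1) eS.
  have eQ1 : nvar s1 xQ = lcode x by rewrite (f1 xQ isT).
  steps; apply: wp_if; sred; rewrite -/i eY -(re_P Re1) // Pd => JP; last first.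
    rewrite (negbTE JP) in fo.
    steps; move=> _; exists (400 * (size Jl - i.+1) + 10)%N; last by clear -le3 ilt; lia.
    exists d1, phi1, gam1; split; split; sred; rewrite ?addn1 //.
    + by apply: rel_ext Re1.
    + by clear -le1 le2 le3 ilt; lia.
    + by clear -le1 le2 le3 ilt; lia.
  rewrite JP /= in fo; rewrite -Pd in JP.
  have wv : valid (x.1, x.2 :|: J) by rewrite /valid subUset; apply/andP.
  have eX : (lcode x + tcode ts J)%N = lcode (x.1, x.2 :|: J).
    by rewrite {2}/lcode /= tcodeU 1?disjoint_sym // addnA.
  have dlx : dl d1 x = (rarr s1 rL (lcode x))%:E.
    rewrite (re_dl Re1) //; have : x \in dP d1 by rewrite Pd.
    by rewrite (re_P Re1) // => /eqP->.
  have dly : dl d1 (x.1, J) = (rarr s1 rL (lcode (x.1, J)))%:E.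
    rewrite (re_dl Re1) //; move: JP.
    by rewrite (re_P Re1) // => /eqP->.
  steps; rewrite -/i ?eY eQ1 eS eX; set s2 := Store _ _ _ _.
  have W2 : (1 < nvar s2 xW)%N by exact (static_W St1).
  have Re2 : represents s2 d1 by apply: rel_ext Re1.
  have Ba : back_args E T r vs es ts s2 [set x; (x.1, J)] (x.1, x.2 :|: J).
    exists x, (x.1, J); split=> //=.
    apply: contraNneq J0 => e; rewrite -setI_eq0 e setIUr setIid in Jx.
    by move: Jx; rewrite setU_eq0 => /andP[_].
  have sE : ds_scan_set x d1 J =
      ds_improve d1 (x.1, x.2 :|: J) (rvar s2 0%N)%:E [set x; (x.1, J)].
    by rewrite /ds_scan_set dlx dly.
  have iR := improve_rel sv sc rT pres W2 Re2 Ho1 wv (erefl _) (erefl _) Ba.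
  apply: wp_frame; apply: wp_mono iR => s3 t3 [le4 Re3 Ho3] [g1 g2 g3].
  steps; move=> _.
  have eI : nvar s3 xI = i by rewrite (g1 xI isT).
  exists (400 * (size Jl - i.+1) + 10)%N; last by clear -le3 ilt le4; lia.
  exists (ds_scan_set x d1 J), (phi1 + 5)%N, gam1.+1; split; split; sred; rewrite ?eI ?addn1 //.
  + by rewrite sE; apply: rel_ext Re3.
  + by rewrite dP_scan_set.
  + by clear -le1 le2 le3 ilt; lia.
  + by clear -le1 le2 le3 ilt; lia.
- move=> s' Bud [d1 [phi1 [gam1 [[Re1 Ho1 Pd fo i0] [le1 le2 le3]]]]] [f1 f2 f3].
  sred; rewrite (f1 xL isT) {1}/s0; sred; rewrite eL => ilt; split; first by lia.
  move=> t le'; split; last by lia.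
    by rewrite -fo drop_oversize; last by lia.
  by apply: heap_ok_le Ho1 _ _; lia.
Qed.

End SetLoop.

(** * The main loop and its global budget *)

Section MainLoop.
Variables (R : realType) (V : finType) (E : {set {set V}}) (c : {set V} -> R).
Variables (T : {set V}) (r : V) (L : V -> {set V} -> R).
Variables (vs : seq V) (es : seq (V * V)) (ts : seq V).
Variables (sv : nat -> nat -> R) (sc : nat -> nat -> nat).
Hypotheses (rT : r \in T) (pres : presents E T r vs es ts).
Local Notation label := (V * {set V})%type.
Local Notation store := (store R).
Local Notation wp := (wp sv sc).
Local Notation T' := (T :\ r).
Local Notation lcode := (lcode T vs ts).
Local Notation valid := (valid T r).
Local Notation static := (static c T r L vs es ts).
Local Notation represents := (represents E T r vs es ts).
Implicit Types (s : store) (d : ds_state R V) (x y : label) (J S : {set V}).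
Hypotheses (SG : simple_graph E) (conn : connected_graph E).
Local Notation nbl := (nbl r es (size es)).
Local Notation init := (ds_init R T r).

(** What the labels not yet settled may still consume. No label is settled twice, so each iteration
    draws its own share, by [remw_rcons]. *)
Definition remw (w : label -> nat) (xs : seq label) :=
  (\sum_(y | valid y && (y \notin xs)) w y)%N.

Lemma remw_rcons w xs x : valid x -> x \notin xs ->
  remw w xs = (w x + remw w (rcons xs x))%N.
Proof.
move=> xv xn; rewrite /remw (bigD1 x) ?xv ?xn //=; congr (_ + _)%N.
apply: eq_bigl => y; rewrite mem_rcons inE negb_or -andbA; congr (_ && _).
by rewrite andbC.
Qed.

(** Bounds the attempted improvements when [x] is settled, and thereby the heap nodes created. *)
Definition fan x := (size (nbl x.1) + 2 ^ #|T' :\: x.2|)%N.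
(* A bound on the time for settling [x], at 200 units per unit of potential.    *)
Definition bud B x :=
  (1400 * size (nbl x.1) + 1460 * 2 ^ #|T' :\: x.2| + (60 * #|T| + 3000 * B + 1400))%N.

Lemma represents_settle s s' d x : represents s d -> x \in dN d ->
  narr s' aST = upd (narr s aST) (lcode x) 2 -> narr s' aBT = narr s aBT ->
  narr s' aBA = narr s aBA -> narr s' aBB = narr s aBB -> rarr s' rL = rarr s rL ->
  represents s' (ds_settle d x).
Proof.
move=> Re xN e1 e2 e3 e4 e5; have xv := re_NP Re xN.
have st1 : narr s aST (lcode x) = 1%N by apply/eqP; rewrite -(re_N Re xv).
have ne y : valid y -> y != x -> lcode y != lcode x.
  by move=> yv; apply: contraNneq => /(lcode_inj rT pres yv xv)->.
case: (Re) => h1 h2 h3 h4 h5 h6 h7; split=> /=.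
- by move=> q; rewrite e1 /upd; case: eqP.
- move=> y yv; rewrite e1 e5 h2 //; case: (eqVneq y x) => [->|yx]; first by rewrite updE st1.
  by rewrite updN ?ne.
- move=> y yv; rewrite e1 in_setD1; case: (eqVneq y x) => [->|yx]; first by rewrite updE.
  by rewrite updN ?ne // h3.
- move=> y yv; rewrite e1 in_setU1; case: (eqVneq y x) => [->|yx]; first by rewrite updE.
  by rewrite updN ?ne //= h4.
- by move=> q; rewrite e1 /upd; case: (eqVneq q (lcode x)) => [-> _|_ /h5//]; exists x.
- by move=> y; rewrite in_setD1 => /andP[_ /h6].
- by move=> y yv; rewrite /back_code e2 e3 e4; exact: h7.
Qed.

Definition logged s xs := nvar s xC = size xs /\
  forall i, (i < size xs)%N -> narr s aXV i = vcode vs (nth (r, set0) xs i).1 /\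
    narr s aXS i = tcode ts (nth (r, set0) xs i).2.

(** [ds_run] grows at the front while the program extends the run at its end; so the past is stated
    by how it prolongs every run starting in [d]. *)
Definition main_inv s d xs phi gam :=
  [/\ static s, represents s d, heap_ok s phi gam, core E T r d xs & closed_run E T r d xs] /\
  [/\ forall ys d', ds_run E c T r L d ys d' -> ds_run E c T r L init (xs ++ ys) d'
    & logged s xs].

(** Two budgets are kept: time, and the number of nodes, existing and still to come, which must stay
    at most 2^B for the rank bound to hold in every extraction. *)
Lemma main_spec s B phi gam : main_inv s init [::] phi gam ->
  (2 * B + 1 < 4 * #|V| + 4 * #|T| + 20)%N ->
  (gam + remw fan [::] <= 2 ^ B)%N ->
  wp main_loop s (fun s' t => exists d xs phi' gam',
    [/\ main_inv s' d xs phi' gam', (r, T') \in dP d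
      & (t <= 200 * phi + remw (bud B) [::] + 50)%N]).
Proof.
move=> Inv0 BW G0.
pose Inv s1 Bud := exists d xs phi1 gam1, [/\ main_inv s1 d xs phi1 gam1,
  (gam1 + remw fan xs <= 2 ^ B)%N & (200 * phi1 + remw (bud B) xs + 20 <= Bud)%N].
have rv : valid (r, T') by exact: subxx.
apply: (wp_whilef (I := Inv) (B := (200 * phi + remw (bud B) [::] + 20)%N)).
- by exists init, [::], phi, gam.
- move=> s1 Bud [d [xs [phi1 [gam1 [[[St Re Ho C Cl] [Run Log]] G le]]]]] _; sred.
  rewrite (sk_FU St) -(re_P Re rv) => nP.
  have [x0 x0N] := progress conn C Cl nP.
  have act0 : exists q : nat, act s1 q.
    by exists (lcode x0); rewrite /act -(re_N Re (re_NP Re x0N)).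
  have W1 : (2 * B + 1 < nvar s1 xW)%N by rewrite (sk_W St).
  have gB : (gam1 <= 2 ^ B)%N by apply: leq_trans G; exact: leq_addr.
  steps; apply: wp_frame; apply: wp_mono (extract_min_spec sv sc Ho gB W1 act0).
  move=> s2 t2 [[aq mn e2] [phi2 [Ho2 le2]]] Fr2.
  have [f1 f2 f3] := Fr2.
  have [x xv eq] : exists2 x, valid x & nvar s2 xQ = lcode x.
    by apply: (re_code Re); move: aq; rewrite /act => /eqP->.
  rewrite eq in aq mn e2.
  have xN : x \in dN d by rewrite (re_N Re xv).
  have St2 : static s2 by apply: static_frame Fr2 _ _ _ St.
  have Re2 : represents s2 (ds_settle d x).
    apply: represents_settle Re xN e2 _ _ _ _.
    - exact: (f2 aBT isT).
    - exact: (f2 aBA isT).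
    - exact: (f2 aBB isT).
    - exact: (f3 rL isT).
  have xxs : x \notin xs.
    by have [_ _] := co_N C xN; rewrite (co_P C) negb_or => /andP[].
  have keyE y : y \in dN d -> ds_key T L d y = (key s1 (lcode y))%:E.
    move=> yN; have yv := re_NP Re yN; rewrite /ds_key (re_dl Re yv).
    have : narr s1 aST (lcode y) == 1%N by rewrite -(re_N Re yv).
    by move/eqP->; rewrite /= /key (sk_L St yv) EFinD.
  have minx y : y \in dN d -> (ds_key T L d x <= ds_key T L d y)%E.
    move=> yN; rewrite !keyE // lee_fin; apply: mn.
    by rewrite /act -(re_N Re (re_NP Re yN)).
  steps; rewrite eq (sk_LV St2 xv) (sk_LS St2 xv) (f1 xC isT).
  have [lc ld] := Log; rewrite lc.
  set s3 := Store _ _ _ _.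
  have St3 : static s3 by case: St2.
  have Re3 : represents s3 (ds_settle d x) by apply: rel_ext Re2.
  have xP3 : x \in dP (ds_settle d x) by rewrite !inE eqxx.
  have Log3 : logged s3 (rcons xs x).
    split; first by rewrite /s3; sred; rewrite size_rcons addn1.
    move=> i; rewrite size_rcons ltnS leq_eqVlt nth_rcons /s3; sred => /orP[/eqP->|il].
      by rewrite ltnn eqxx !updE.
    by rewrite il !updN ?(ltn_eqF il) // (f2 aXV isT) (f2 aXS isT); exact: ld.
  apply: wp_frame.
  apply: wp_mono (edge_spec sv sc rT pres St3 Re3 Ho2 xv xP3 _ _ _) => //.
  move=> s4 t4 [Re4 Ho4 le4] Fr4; have [g1 g2 g3] := Fr4.
  have St4 : static s4 by apply: static_frame Fr4 _ _ _ St3.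
  have eS4 : nvar s4 xS = tcode ts x.2 by rewrite (g1 xS isT).
  apply: wp_seq; apply: wp_frame.
  apply: wp_mono (subset_spec sv sc rT pres St4 xv eS4).
  move=> s5 t5 [Jl [[u m n0 eL aS] [szJ le5]]] Fr5; have [h1 h2 h3] := Fr5.
  have St5 : static s5 by apply: static_frame Fr5 _ _ _ St4.
  set d1 := foldl _ _ _ in Re4.
  have Re5 : represents s5 d1.
    by apply: rel_ext Re4; [exact: (h2 aST isT)|exact: (h2 aBT isT)|exact: (h2 aBA isT)
      |exact: (h2 aBB isT)|exact: (h3 rL isT)].
  have dPE : dP d1 = dP (ds_settle d x).
    rewrite /d1; elim: (map fst _) (ds_settle d x) => //= w ws IH d'.
    by rewrite IH dP_scan_edge.
  have Ho5 : heap_ok s5 (phi2 + 5 * size (nbl x.1)) (gam1 + size (nbl x.1)).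
    move: Ho4; rewrite /heap_ok /heap_of /stk /act /fr /key /hollow /heap_of.
    by rewrite (h2 aSL isT) (h1 xW isT) (h2 aST isT) (h3 rL isT) (h3 rLB isT)
      (h2 aND isT) (h2 aIT isT) (h2 aRK isT) (h2 aBS isT) (h2 aA isT) (h3 rKY isT)
      (h1 xCN isT) (h1 xNB isT) (h2 aSK isT) (h1 xSP isT).
  have xP5 : x \in dP d1 by rewrite dPE.
  have eV5 : nvar s5 xV = vcode vs x.1 by rewrite (h1 xV isT) (g1 xV isT).
  have eQ5 : nvar s5 xQ = lcode x by rewrite (h1 xQ isT) (g1 xQ isT).
  apply: wp_frame.
  apply: wp_mono (set_spec sv sc rT pres St5 Re5 Ho5 xv xP5 eV5 eQ5 u m n0 eL aS).
  move=> s6 t6 [Re6 Ho6 le6] Fr6 _; have [k1 k2 k3] := Fr6.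
  have St6 : static s6 by apply: static_frame Fr6 _ _ _ St5.
  set d2 := foldl _ _ _ in Re6.
  have step : ds_step E c T r L d x d2.
    split=> //; exists (map fst (nbl x.1)), [seq J <- behead Jl | (x.1, J) \in dP (ds_settle d x)].
    split; [exact: (nbl_perm SG pres)| |by rewrite /d2 dPE].
    exact: join_perm.
  have [C2 Cl2] := step_inv SG C Cl step.
  have Grem := remw_rcons fan xv xxs; have Brem := remw_rcons (bud B) xv xxs.
  rewrite szJ in Ho6 le6.
  exists (200 * (phi2 + 5 * size (nbl x.1) + 5 * 2 ^ #|T' :\: x.2|)
          + remw (bud B) (rcons xs x) + 20)%N.
    exists d2, (rcons xs x), (phi2 + 5 * size (nbl x.1) + 5 * 2 ^ #|T' :\: x.2|)%N,
      (gam1 + size (nbl x.1) + 2 ^ #|T' :\: x.2|)%N.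
    split=> //; last by move: G; rewrite Grem /fan !addnA.
    split; split=> //.
      by move=> ys d' ru; rewrite cat_rcons; apply: Run; exact: ds_run_iter step ru.
    have [lc3 ld3] := Log3; split.
      by rewrite (k1 xC isT) (h1 xC isT) (g1 xC isT).
    by move=> i il; rewrite (k2 aXV isT) (h2 aXV isT) (g2 aXV isT) (k2 aXS isT)
      (h2 aXS isT) (g2 aXS isT); exact: ld3.
  (* Here 1400 is 400 steps plus 5 units of potential at 200 steps each, per edge; 1460 has 60 more
     for listing a subset. The rest covers the extraction and the scan of the digits. *)
  have bE : bud B x = (1400 * size (nbl x.1) + 1460 * 2 ^ #|T' :\: x.2|
    + (60 * #|T| + 3000 * B + 1400))%N by [].
  rewrite Brem bE in le.
  move: le le2 le4 le5 le6; move: (remw _ (rcons _ _)) (size (nbl _)) (2 ^ #|_|)%N => w1 w2 w3.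
  clear; lia.
- move=> s' Bud [d [xs [phi1 [gam1 [[[St Re Ho C Cl] [Run Log]] G le]]]]] _; sred.
  rewrite (sk_FU St) -(re_P Re rv) negbK => xP; split; first by move: le; clear; lia.
  move=> t le'; exists d, xs, phi1, gam1; split=> //.
  by move: le le'; clear; lia.
Qed.

End MainLoop.

(** * Backtracking by marks *)

Section BackLoop.
Variables (R : realType) (V : finType) (E : {set {set V}}) (c : {set V} -> R).
Variables (T : {set V}) (r : V) (L : V -> {set V} -> R).
Variables (vs : seq V) (es : seq (V * V)) (ts : seq V).
Variables (sv : nat -> nat -> R) (sc : nat -> nat -> nat).
Hypotheses (rT : r \in T) (pres : presents E T r vs es ts).
Local Notation label := (V * {set V})%type.
Local Notation store := (store R).
Local Notation wp := (wp sv sc).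
Local Notation T' := (T :\ r).
Local Notation lcode := (lcode T vs ts).
Local Notation valid := (valid T r).
Local Notation static := (static c T r L vs es ts).
Implicit Types (s : store) (d : ds_state R V) (x y : label) (J S : {set V}).
Local Notation main_inv := (main_inv E c T r L vs es ts).
Local Notation eindex e := (index e [seq edge_of p | p <- es]).

Lemma run_nil d d' : ds_run E c T r L d [::] d' -> d' = d.
Proof. by move=> ru; inversion ru. Qed.

(** Invariant: an edge belongs to the result iff it is already output or is contributed by a marked
    label among those not yet scanned. Handling a label passes its mark to its predecessors, which
    are still to come in the reverse scan; so each label is treated once, even if several labels
    share it. *)
Lemma back_spec s d xs phi gam : main_inv s d xs phi gam -> (r, T') \in dP d ->
  (forall i, narr s aF i = 0%N) -> (forall i, narr s aMK i = 0%N) ->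
  wp back_loop s (fun s' t => exists F,
    [/\ ds_backtrack d (r, T') F, F \subset E,
        forall e, e \in E -> narr s' aF (eindex e) = (e \in F)
      & (t <= 100 * size xs + 50)%N]).
Proof.
move=> [[St Re Ho C Cl] [Run [lc ld]]] rP F0 M0; rewrite /back_loop; steps.
rewrite lc (sk_FU St); set s0 := Store _ _ _ _.
have xsv x : x \in xs -> valid x by case/(co_xs C).
have St0 : static s0 by case: St.
have [F [Frun FE Feq]] : exists F, [/\ ds_backtrack d (r, T') F, F \subset E &
    forall e, (e \in F) <-> exists x, [/\ x \in xs, x = (r, T') &
      e \in btree d (size xs) x]].
  have := rP; rewrite (co_P C); have [T0 _|nT0 /= rxs] := eqVneq T' set0.
    (* With the root as only terminal, the target has the empty set: it is in P initially but never
       among the chosen labels, and its backtracking is empty. *)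
    have xs0 : xs = [::].
      case: (xs) C => // a l Ca; have := co_xs Ca (mem_head _ _).
      by rewrite T0 subset0 => -[->].
    have de : d = ds_init R T r.
      by apply: run_nil; have := Run [::] d (ds_run_exit _ _ _ rP); rewrite xs0.
    exists set0; split; last by move=> e; rewrite inE; split=> // -[x []]; rewrite xs0.
      have -> : set0 = \bigcup_(y in db d (r, T')) (set0 : {set {set V}}).
        by rewrite de /= big_set0.
      apply: ds_backtrack_union; rewrite de /=; last by move=> y; rewrite inE.
      by move=> w /setP/(_ (w, T')); rewrite set11 inE.
    exact: sub0set.
  have ir : (index (r, T') xs < size xs)%N by rewrite index_mem.
  have [b1 b2] := btree_run C rxs ir.
  exists (btree d (size xs) (r, T')); split=> // e; split=> [eb|[x [_ -> //]]].
  by exists (r, T').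
pose Inv s1 Bud := [/\ (nvar s1 xI <= size xs)%N,
  forall j, (narr s1 aF j <= 1)%N,
  forall e, e \in E -> (e \in F) <-> (narr s1 aF (eindex e) = 1%N \/
    exists x, [/\ x \in take (nvar s1 xI) xs, narr s1 aMK (lcode x) <> 0%N &
      e \in btree d (size xs) x])
  & (100 * nvar s1 xI + 10 <= Bud)%N].
apply: (wp_whilef (I := Inv) (B := (100 * size xs + 10)%N)).
- split=> //; first by move=> j; rewrite /s0; sred; rewrite F0.
  move=> e eE; rewrite /s0; sred.
  rewrite take_size Feq F0; split=> [[x [xxs xr ex]]|[//|[x [xxs mx ex]]]].
    by right; exists x; split=> //; rewrite xr updE.
  exists x; split=> //; apply: (lcode_inj rT pres (xsv _ xxs)); first exact: subxx.
  by move: mx; rewrite /upd; case: eqP.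
- move=> s1 Bud [il Fb Fe le] Fr; sred => i0; have [f1 f2 f3] := Fr.
  have St1 : static s1 by apply: static_frame Fr _ _ _ St0.
  set i := (nvar s1 xI - 1)%N; have iE : nvar s1 xI = i.+1 by rewrite /i; lia.
  rewrite iE in il Fe le.
  set x := nth (r, set0) xs i.
  have xxs : x \in xs by exact: mem_nth.
  have ix : index x xs = i by rewrite index_uniq // (co_uniq C).
  have [lv lS] := ld i il.
  have eX : (narr s1 aLB (narr s1 aXV i) + narr s1 aXS i)%N = lcode x.
    by rewrite (f2 aXV isT) (f2 aXS isT) /s0; sred; rewrite lv lS (sk_LB St1).
  have bk : back_code E T r vs es ts s1 (lcode x) (db d x) x.
    move: (re_back Re (xsv _ xxs)); rewrite /back_code.
    by rewrite (f2 aBT isT) (f2 aBA isT) (f2 aBB isT).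
  have tk : take i.+1 xs = rcons (take i xs) x by rewrite (take_nth (r, set0)).
  have dbt y : y \in db d x -> y \in take i xs by rewrite -{1}ix; exact: (co_dbP C xxs).
  have Bud' : (100 * i + 10 + 100 <= Bud)%N by lia.
  (* Once its own contribution has been passed on, [x] may be dropped. *)
  have keep (s2 : store) : nvar s2 xI = i -> (forall j, (narr s2 aF j <= 1)%N) ->
      (forall e, e \in E -> (narr s1 aF (eindex e) = 1%N \/
        (narr s1 aMK (lcode x) <> 0%N /\ e \in btree d (size xs) x) \/
        exists y, [/\ y \in take i xs, narr s1 aMK (lcode y) <> 0%N &
          e \in btree d (size xs) y]) <->
        (narr s2 aF (eindex e) = 1%N \/ exists y, [/\ y \in take i xs,
          narr s2 aMK (lcode y) <> 0%N & e \in btree d (size xs) y])) ->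
      forall t, (t <= 99)%N -> exists2 B', Inv s2 B' & (t + B' < Bud)%N.
    move=> eI Fb2 H t tle; exists (100 * i + 10)%N; last by lia.
    split; rewrite ?eI //; first exact: ltnW.
    move=> e eE; rewrite (Fe e eE) -(H e eE) tk; split.
      case=> [|[y [yt my ey]]]; first by left.
      move: yt; rewrite mem_rcons inE => /orP[/eqP yx|yt]; first by right; left; rewrite -yx.
      by right; right; exists y.
    case=> [|[[mx ex]|[y [yt my ey]]]]; first by left.
      by right; exists x; rewrite mem_rcons mem_head.
    by right; exists y; rewrite mem_rcons inE yt orbT.
  have eidx e e' : e \in E -> e' \in E -> eindex e = eindex e' -> e = e'.
    rewrite -!(mem_es pres) => m1 m2 ee.
    by rewrite -(nth_index set0 m1) ee nth_index.
  have lin y z : y \in take i xs -> valid z -> (lcode y == lcode z) = (y == z).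
    move=> yt zv; apply/eqP/eqP => [|->//].
    exact: (lcode_inj rT pres (xsv _ (mem_take yt))).
  steps; rewrite -/i eX; apply: wp_if; sred => mk; last first.
    steps; move=> _; apply: keep => //; sred => e eE; rewrite -/i.
    have {}mk : narr s1 aMK (lcode x) = 0%N by lia.
    by rewrite mk; split=> [[|[[]|]]|[|]]; auto.
  have mx : narr s1 aMK (lcode x) <> 0%N by lia.
  rewrite /back_code in bk; apply: wp_if; sred => bt.
    rewrite (eqP bt) in bk; have [w [wE eA eB eD]] := bk.
    have wt : (w, x.2) \in take i xs by apply: dbt; rewrite eD set11.
    have wv := xsv _ (mem_take wt).
    steps; rewrite eA eB => _; apply: keep => //; sred.
      by move=> j; rewrite /upd; case: eqP.
    move=> e eE; rewrite (btree_edge C xxs eD) -/i; split.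
      case=> [Fe1|[[_ ]|[y [yt my ey]]]].
      - by left; rewrite /upd; case: eqP.
      - rewrite in_setU1 => /orP[/eqP->|ew]; first by left; rewrite updE.
        by right; exists (w, x.2); rewrite updE.
      - by right; exists y; split=> //; rewrite /upd; case: eqP.
    case=> [|[y [yt my ey]]].
      rewrite /upd; case: (eqVneq (eindex e) _) => [ee _|_ ->]; last by left.
      by right; left; split=> //; rewrite (eidx _ _ eE wE ee) setU11.
    move: my; rewrite /upd lin //; case: (eqVneq y (w, x.2)) => [yw _|_ my].
      by right; left; split=> //; rewrite in_setU1 -yw ey orbT.
    by right; right; exists y.
  apply: wp_if; sred => bt2.
    rewrite (eqP bt2) in bk; have [y [z [[yv zv] nyx eA eB eD]]] := bk.
    have yt : y \in take i xs by apply: dbt; rewrite eD set21.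
    have zt : z \in take i xs by apply: dbt; rewrite eD set22.
    have ns w : db d x <> [set (w, x.2)].
      move=> e; have : y \in db d x by rewrite eD set21.
      by rewrite e inE => /eqP yw; rewrite yw eqxx in nyx.
    have bx : btree d (size xs) x = btree d (size xs) y :|: btree d (size xs) z.
      rewrite (btree_union C xxs ns) eD; apply/setP => e; rewrite in_setU.
      apply/bigcupP/orP => [[u + eu]|[]]; rewrite ?inE.
      - by case/orP => /eqP <-; [left|right].
      - by exists y; rewrite ?set21.
      - by exists z; rewrite ?set22.
    steps; rewrite eA eB => _; apply: keep => //; sred => e eE; rewrite bx -/i; split.
      case=> [Fe1|[[_ ]|[u [ut mu eu]]]]; first by left.
      - rewrite in_setU => /orP[ey|ez]; right; first exists y; last exists z.
          by split=> //; rewrite /upd eqxx; case: eqP.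
        by split=> //; rewrite updE.
      - by right; exists u; split=> //; rewrite /upd; case: eqP => //; case: eqP.
    case=> [|[u [ut mu eu]]]; first by left.
    move: mu; rewrite /upd !lin //; case: (eqVneq u z) => [uz _|_].
      by right; left; split=> //; rewrite in_setU -uz eu orbT.
    case: (eqVneq u y) => [uy _|_ mu].
      by right; left; split=> //; rewrite in_setU -uy eu.
    by right; right; exists u.
  have d0 : db d x = set0 by case: (narr s1 aBT (lcode x)) bk bt bt2 => [|[|[|]]].
  have bx : btree d (size xs) x = set0.
    rewrite (btree_union C xxs); first by rewrite d0 big_set0.
    by move=> w; rewrite d0 => /setP/(_ (w, x.2)); rewrite set11 inE.
  steps; move=> _; apply: keep => //; sred => e eE; rewrite -/i bx.
  by split=> [[|[[_ ]|]]|[|]]; rewrite ?inE; auto.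
- move=> s' Bud [il Fb Fe le] _; sred => i0; split; first by move: le; clear; lia.
  have z : nvar s' xI = 0%N by move: i0; clear; lia.
  move=> t le'; exists F; split=> //; last by move: le le'; rewrite z; clear; lia.
  move=> e eE; have := Fe e eE; rewrite z take0; have := Fb (eindex e).
  case: (narr s' aF (eindex e)) => [|[|]] // _ [h1 h2].
    by case: (boolP (e \in F)) => // /h1[//|[x []]].
  by rewrite h2 //; left.
Qed.

End BackLoop.

(** * Building the tables *)

Section Setup.
Variables (R : realType) (V : finType) (r : V).
Variables (vs : seq V) (es : seq (V * V)).
Variables (sv : nat -> nat -> R) (sc : nat -> nat -> nat) (fL : nat).
Local Notation store := (store R).
Local Notation wp := (wp sv sc).
Hypothesis scle : forall i J, (sc i J <= fL)%N.
Implicit Types (s : store).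

Lemma power_spec s k : nvar s xT = k -> (0 < k)%N ->
  wp power_loop s (fun s' t => [/\ nvar s' xK = (2 ^ k.-1)%N,
    forall j, (j < k.-1)%N -> narr s' aPW j = (2 ^ j)%N & (t <= 30 * k + 30)%N]).
Proof.
move=> ek k0; rewrite /power_loop; steps; set s0 := Store _ _ _ _.
pose Inv s1 Bud := [/\ nvar s1 xK = (2 ^ nvar s1 xJ)%N, (nvar s1 xJ <= k.-1)%N,
  forall j, (j < nvar s1 xJ)%N -> narr s1 aPW j = (2 ^ j)%N
  & (30 * (k - nvar s1 xJ) + 10 <= Bud)%N].
apply: (wp_whilef (I := Inv) (B := (30 * k + 10)%N)).
- by split=> //; rewrite /s0; sred; rewrite subn0.
- move=> s1 Bud [eK jk pw le] [f1 f2 f3]; sred.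
  rewrite (f1 xT isT) /s0; sred; rewrite ek => lt.
  steps; move=> _; exists (30 * (k - (nvar s1 xJ).+1) + 10)%N.
    split; sred; rewrite ?addn1 //.
    + by rewrite expnS eK addnn mul2n.
    + by move: lt k0; clear; lia.
    + move=> j; rewrite ltnS leq_eqVlt => /orP[/eqP->|jl]; first by rewrite updE eK.
      by rewrite updN ?pw // ltn_eqF.
  by move: lt le; clear; lia.
- move=> s' Bud [eK jk pw le] [f1 f2 f3]; sred.
  rewrite (f1 xT isT) /s0; sred; rewrite ek => lt; split; first by move: le; clear; lia.
  have e : nvar s' xJ = k.-1 by move: lt jk; clear; lia.
  move=> t le'; split; [by rewrite eK e|by rewrite -e|].
  by move: le le'; clear; lia.
Qed.

Lemma row_spec s : wp row_loop s (fun s' t =>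
  let q := nvar s xQ in let K := nvar s xK in
  [/\ nvar s' xQ = (q + K)%N,
      forall J, (J < K)%N -> [/\ narr s' aLV (q + J)%N = nvar s xV, narr s' aLS (q + J)%N = J
        & rarr s' rLB (q + J)%N = sv (nvar s xV) (K + K - 1 - J)],
      forall i, (i < q)%N -> [/\ narr s' aLV i = narr s aLV i, narr s' aLS i = narr s aLS i
        & rarr s' rLB i = rarr s rLB i]
    & (t <= (60 + fL) * K + 30)%N]).
Proof.
rewrite /row_loop; steps; set s0 := Store _ _ _ _; set q := nvar s xQ; set K := nvar s xK.
pose Inv s1 Bud := [/\ nvar s1 xQ = (q + nvar s1 xI)%N, (nvar s1 xI <= K)%N,
  forall J, (J < nvar s1 xI)%N -> [/\ narr s1 aLV (q + J)%N = nvar s xV,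
    narr s1 aLS (q + J)%N = J & rarr s1 rLB (q + J)%N = sv (nvar s xV) (K + K - 1 - J)],
  forall i, (i < q)%N -> [/\ narr s1 aLV i = narr s aLV i, narr s1 aLS i = narr s aLS i
        & rarr s1 rLB i = rarr s rLB i]
  & ((60 + fL) * (K - nvar s1 xI) + 10 <= Bud)%N].
apply: (wp_whilef (I := Inv) (B := ((60 + fL) * K + 10)%N)).
- by split=> //; rewrite /s0; sred; rewrite ?addn0 ?subn0.
- move=> s1 Bud [eQ iK hi lo le] [f1 f2 f3]; sred.
  rewrite (f1 xK isT) {1}/s0; sred; rewrite -/K => lt.
  steps; move=> _; exists ((60 + fL) * (K - (nvar s1 xI).+1) + 10)%N.
    rewrite (f1 xV isT) (f1 xK isT) /s0; sred; rewrite -/K.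
    split; sred; rewrite ?addn1 // eQ ?addnS //.
    + move=> J; rewrite ltnS leq_eqVlt => /orP[/eqP->|jl]; first by rewrite !updE.
      have ne : (q + J != q + nvar s1 xI)%N by rewrite eqn_add2l ltn_eqF.
      by rewrite !updN //; exact: hi.
    + move=> i iq; have ne : (i != q + nvar s1 xI)%N by rewrite ltn_eqF // ltn_addr.
      by rewrite !updN //; exact: lo.
  move: (scle (nvar s1 xV) (nvar s1 xK + nvar s1 xK - 1 - nvar s1 xI)) le.
  have -> : (K - nvar s1 xI)%N = (K - (nvar s1 xI).+1).+1 by move: lt; clear; lia.
  rewrite mulnS; move: ((60 + fL) * _)%N (sc _ _) => a b; clear; lia.
- move=> s' Bud [eQ iK hi lo le] [f1 f2 f3]; sred.
  rewrite (f1 xK isT) {1}/s0; sred; rewrite -/K => lt; split; first by move: le; clear; lia.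
  have e : nvar s' xI = K by move: lt iK; clear; lia.
  rewrite e in hi eQ; move=> t le'; split=> //; move: le le'.
  by move: ((60 + fL) * _)%N ((60 + fL) * _)%N => a b; clear; lia.
Qed.

Lemma label_spec s n K : nvar s xN = n -> nvar s xK = K -> (0 < K)%N ->
  (forall i, narr s aST i = 0%N) ->
  wp label_loop s (fun s' t =>
    [/\ forall i, (i < n)%N -> narr s' aLB i = (i * K)%N,
        forall i J, (i < n)%N -> (J < K)%N -> [/\ narr s' aLV (i * K + J)%N = i,
          narr s' aLS (i * K + J)%N = J
          & rarr s' rLB (i * K + J)%N = sv i (K + K - 1 - J)],
        forall i, (i < n)%N -> narr s' aST (i * K)%N = 2%N,
        forall q, narr s' aST q = 0%N \/ exists2 i, (i < n)%N & q = (i * K)%N /\ narr s' aST q = 2%N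
      & (t <= n * ((60 + fL) * K + 100) + 30)%N]).
Proof.
move=> eN eK K0 st0; rewrite /label_loop; steps; set s0 := Store _ _ _ _.
pose Inv s1 Bud := [/\ nvar s1 xQ = (nvar s1 xV * K)%N /\ (nvar s1 xV <= n)%N,
  forall i, (i < nvar s1 xV)%N -> narr s1 aLB i = (i * K)%N,
  forall i J, (i < nvar s1 xV)%N -> (J < K)%N -> [/\ narr s1 aLV (i * K + J)%N = i,
          narr s1 aLS (i * K + J)%N = J
          & rarr s1 rLB (i * K + J)%N = sv i (K + K - 1 - J)],
  forall i, (i < nvar s1 xV)%N -> narr s1 aST (i * K)%N = 2%N
  & forall q, narr s1 aST q = 0%N \/
      exists2 i, (i < nvar s1 xV)%N & q = (i * K)%N /\ narr s1 aST q = 2%N] /\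
  ((n - nvar s1 xV) * ((60 + fL) * K + 100) + 10 <= Bud)%N.
apply: (wp_whilef (I := Inv) (B := (n * ((60 + fL) * K + 100) + 10)%N)).
- split; last by rewrite /s0; sred; rewrite subn0.
  by split=> // q; left; rewrite /s0; sred.
- move=> s1 Bud [[[eQ vn] lb row st stz] le] [f1 f2 f3]; sred.
  rewrite (f1 xN isT) {1}/s0; sred; rewrite eN => lt.
  set i := nvar s1 xV in eQ vn lb row st stz le lt *.
  steps; set s2 := Store _ _ _ _.
  apply: wp_frame; apply: wp_mono (row_spec s2) => s3 t3 [eQ3 hi lo le3] [g1 g2 g3].
  have eK2 : nvar s2 xK = K by rewrite /s2; sred; rewrite (f1 xK isT).
  have eQ2 : nvar s2 xQ = (i * K)%N by [].
  rewrite eK2 eQ2 -[nvar s2 xV]/i in eQ3 hi lo le3.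
  have eV3 : nvar s3 xV = i by rewrite (g1 xV isT).
  steps; move=> _; rewrite eV3; exists ((n - i.+1) * ((60 + fL) * K + 100) + 10)%N; last first.
    move: le le3; have -> : (n - i)%N = (n - i.+1).+1 by move: lt; clear; lia.
    rewrite mulSn; move: ((60 + fL) * K)%N => a; move: (_ * (a + 100))%N => b; clear; lia.
  split; sred; rewrite ?addn1 //; split; sred; rewrite ?addn1.
  + by rewrite eQ3 mulSn addnC.
  + move=> j; rewrite ltnS leq_eqVlt (g2 aLB isT) /s2; sred => /orP[/eqP->|jl].
      by rewrite updE eQ.
    by rewrite updN ?lb // ltn_eqF.
  + move=> j J; rewrite ltnS leq_eqVlt => /orP[/eqP->|jl] JK; first exact: hi.
    have [|a b d] := lo (j * K + J)%N.
      apply: leq_trans (_ : j.+1 * K <= _)%N; first by rewrite mulSn addnC ltn_add2r.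
      by rewrite leq_mul2r jl orbT.
    by rewrite a b d; exact: row.
  + move=> j; rewrite ltnS leq_eqVlt (g2 aST isT) /s2; sred => /orP[/eqP->|jl].
      by rewrite eQ updE.
    by rewrite updN ?st // eQ eqn_pmul2r // ltn_eqF.
  + move=> q; rewrite (g2 aST isT) /s2; sred; rewrite /upd eQ.
    case: eqP => [->|_]; first by right; exists i.
    by case: (stz q) => [|[j jl [a b]]]; [left|right; exists j => //; exact: ltnW].
- move=> s' Bud [[[eQ vn] lb row st stz] le] [f1 f2 f3]; sred.
  rewrite (f1 xN isT) {1}/s0; sred; rewrite eN => lt; split; first by move: le; move: (_ * (_ + 100))%N => a; clear; lia.
  have e : nvar s' xV = n by move: lt vn; clear; lia.
  rewrite e in lb row st stz; move=> t le'; split=> //; move: le le'.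
  by move: (_ * (_ + 100))%N (_ * (_ + 100))%N => a b; clear; lia.
Qed.

(** All lists use half-edges below [xH] only, so the next one is new to every list and prepending it
    leaves the others intact. *)
Definition adj_ok s (f : V -> seq (V * nat)) := (0 < nvar s xH)%N /\
  forall v, exists hs, [/\ all (fun h => h < nvar s xH)%N hs,
    chain (narr s aNX) (narr s aHD (vcode vs v)) hs
    & [seq (narr s aTG h, narr s aHE h) | h <- hs] = [seq (vcode vs p.1, p.2) | p <- f v]].

Lemma chain_ext nx nx' h hs : {in hs, nx =1 nx'} -> chain nx h hs -> chain nx' h hs.
Proof.
elim: hs h => //= a hs IH h e [-> a0 ch]; split=> //.
rewrite -e ?mem_head //; apply: IH ch => b bs; apply: e; by rewrite inE bs orbT.
Qed.

Lemma half_spec s a b u w f : injective (vcode vs) -> adj_ok s f ->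
  (a, b) \in [:: (aE1, aE2); (aE2, aE1)] ->
  narr s a (nvar s xI) = vcode vs u -> narr s b (nvar s xI) = vcode vs w ->
  wp (half_edge a b) s (fun s' t => adj_ok s'
    (fun v => (if u == v then [:: (w, nvar s xI)] else [::]) ++ f v) /\ (t <= 60)%N).
Proof.
move=> vinj [H0 ad] abin eu ew; rewrite /half_edge.
set H := nvar s xH in H0 ad; set f' := fun v => _ ++ _.
suff key s' : nvar s' xH = (H + 1)%N ->
    narr s' aTG = upd (narr s aTG) H (vcode vs w) ->
    narr s' aHE = upd (narr s aHE) H (nvar s xI) ->
    narr s' aNX = upd (narr s aNX) H (narr s aHD (vcode vs u)) ->
    narr s' aHD = upd (narr s aHD) (vcode vs u) H -> adj_ok s' f'.
  by move: abin eu ew; rewrite !inE => /orP[]/eqP[-> ->] eu ew;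
    steps; rewrite eu ew; split=> //; apply: key.
move=> eH eT eE eN eD; split; first by rewrite eH addn1.
move=> v; have [hs [hlt ch mp]] := ad v.
have ne h : h \in hs -> (h == H) = false.
  by move/(allP hlt) => lt; rewrite ltn_eqF.
have hlt' : all (fun h => h < H + 1)%N hs.
  by apply: sub_all hlt => h lt; rewrite addn1 ltnW.
have ext nx : {in hs, nx =1 upd nx (H) (narr s aHD (vcode vs u))}.
  by move=> h hin; rewrite updN ?ne.
have mp' x y : [seq (upd (narr s aTG) (H) x h, upd (narr s aHE) (H) y h) | h <- hs]
    = [seq (vcode vs p.1, p.2) | p <- f v].
  by rewrite -mp; apply/eq_in_map => h hin; rewrite !updN ?ne.
rewrite /f'; case: (eqVneq u v) => [uv|uv].
  exists (H :: hs); rewrite eH eT eE eN eD; split.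
  - by rewrite /= addn1 ltnSn /= -addn1.
  - rewrite -uv updE /=; split=> //; first by move: H0; clear; lia.
    by rewrite updE; apply: chain_ext (ext _) _; rewrite uv.
  - by rewrite /= !updE mp'.
exists hs; rewrite eH eT eE eN eD; split=> //.
- rewrite updN; first by apply: chain_ext (ext _) _.
  by apply: contraNneq uv => /vinj->.
Qed.

Lemma adjacency_spec s : injective (vcode vs) -> nvar s xM = size es ->
  (forall j, (j < size es)%N -> narr s aE1 j = vcode vs (nth (r, r) es j).1) ->
  (forall j, (j < size es)%N -> narr s aE2 j = vcode vs (nth (r, r) es j).2) ->
  (forall i, narr s aHD i = 0%N) ->
  wp adjacency_loop s (fun s' t => adj_ok s' (nbl r es (size es)) /\
    (t <= 200 * size es + 50)%N).
Proof.
move=> vinj eM e1 e2 hd0; rewrite /adjacency_loop; steps; set s0 := Store _ _ _ _.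
pose Inv s1 Bud := [/\ adj_ok s1 (nbl r es (nvar s1 xI)), (nvar s1 xI <= size es)%N
  & (200 * (size es - nvar s1 xI) + 20 <= Bud)%N].
apply: (wp_whilef (I := Inv) (B := (200 * size es + 20)%N)).
- split=> //; last by rewrite /s0; sred; rewrite subn0.
  by split=> // v; exists [::]; split=> //=; rewrite /s0; sred; rewrite hd0.
- move=> s1 Bud [ad il le] [f1 f2 f3]; sred.
  rewrite (f1 xM isT) {1}/s0; sred; rewrite eM => lt.
  set i := nvar s1 xI in ad il le lt.
  have E1 : narr s1 aE1 i = vcode vs (nth (r, r) es i).1 by rewrite (f2 aE1 isT) e1.
  have E2 : narr s1 aE2 i = vcode vs (nth (r, r) es i).2 by rewrite (f2 aE2 isT) e2.
  apply: wp_seq; apply: wp_frame.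
  apply: wp_mono (half_spec vinj ad _ E1 E2) => //.
  move=> s2 t2 [ad2 le2] [g1 g2 g3]; apply: wp_seq; apply: wp_frame.
  have i2 : nvar s2 xI = i by rewrite (g1 xI isT).
  have E1' : narr s2 aE1 (nvar s2 xI) = vcode vs (nth (r, r) es i).1 by rewrite i2 (g2 aE1 isT).
  have E2' : narr s2 aE2 (nvar s2 xI) = vcode vs (nth (r, r) es i).2 by rewrite i2 (g2 aE2 isT).
  apply: wp_mono (half_spec vinj ad2 _ E2' E1') => //.
  move=> s3 t3 [ad3 le3] [h1 h2 h3]; steps; move=> _.
  have i3 : nvar s3 xI = i by rewrite (h1 xI isT) i2.
  rewrite i3; exists (200 * (size es - i.+1) + 20)%N; last by move: le le2 le3 lt; clear; lia.
  split; sred; rewrite ?addn1 //.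
  by move: ad3; rewrite i2.
- move=> s' Bud [ad il le] [f1 f2 f3]; sred.
  rewrite (f1 xM isT) {1}/s0; sred; rewrite eM => lt; split; first by move: le; clear; lia.
  have e : nvar s' xI = size es by move: lt il; clear; lia.
  rewrite e in ad; move=> t le'; split=> //; move: le le'; clear; lia.
Qed.

End Setup.

Section TerminalLoop.
Variables (R : realType) (V : finType) (E : {set {set V}}) (c : {set V} -> R).
Variables (T : {set V}) (r : V) (L : V -> {set V} -> R).
Variables (vs : seq V) (es : seq (V * V)) (ts : seq V).
Variables (sv : nat -> nat -> R) (sc : nat -> nat -> nat).
Hypotheses (rT : r \in T) (pres : presents E T r vs es ts).
Local Notation label := (V * {set V})%type.
Local Notation store := (store R).
Local Notation wp := (wp sv sc).
Local Notation K := (2 ^ #|T|.-1)%N.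
Local Notation T' := (T :\ r).
Local Notation lcode := (lcode T vs ts).
Local Notation valid := (valid T r).
Local Notation represents := (represents E T r vs es ts).
Implicit Types (s : store) (d : ds_state R V) (x y : label) (J S : {set V}).

(** Interpolates between the state without queued labels and [ds_init], so that initialization can
    be done by calling [improve] with value 0, one terminal at a time. *)
Definition partial_init (A : {set V}) : ds_state R V :=
  {| dl := fun x => if (x.2 == set0) || ((x.1 \in A) && (x.2 == [set x.1]))
                    then 0%E else +oo%E;
     db := fun=> set0;
     dN := [set (s, [set s]) | s in A];
     dP := [set (v, set0) | v : V] |}.

Lemma represents_eq s d d' : dl d =1 dl d' -> db d =1 db d' -> dN d = dN d' ->
  dP d = dP d' -> represents s d -> represents s d'.
Proof.
move=> e1 e2 e3 e4 [h1 h2 h3 h4 h5 h6 h7]; split; rewrite -?e3 -?e4 //.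
- by move=> x xv; rewrite -e1 h2.
- by move=> x xv; rewrite -e2; exact: h7.
Qed.

Lemma partial_step s (A : {set V}) t : t \in T' -> t \notin A ->
  represents s (ds_improve (partial_init A) (t, [set t]) 0%:E set0) ->
  represents s (partial_init (t |: A)).
Proof.
move=> tT tA.
have t0 : ([set t] == set0) = false by apply/negbTE/set0Pn; exists t; rewrite set11.
rewrite /ds_improve /= t0 (negbTE tA) /= ltry /=.
have -> : (t, [set t]) \notin [set (v, set0 : {set V}) | v : V].
  by apply/negP => /imsetP[v _ [_ e]]; move: t0; rewrite e eqxx.
apply: represents_eq => //=.
- move=> [v I] /=; rewrite /upd in_setU1 xpair_eqE.
  case: (eqVneq v t) => [->|] //=; case: (eqVneq I [set t]) => [->|] /=; rewrite ?t0 ?orbT ?orbF //.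
  by rewrite andbF orbF.
- by move=> x; rewrite /upd; case: ifP.
- by rewrite imsetU1.
Qed.

Lemma terminal_spec s : represents s (partial_init set0) -> heap_ok s 0 1 ->
  (1 < nvar s xW)%N -> nvar s xT = #|T| ->
  (forall v, narr s aLB (vcode vs v) = (vcode vs v * K)%N) ->
  (forall j, (j < #|T|.-1)%N -> narr s aPW j = (2 ^ j)%N) ->
  (forall j, (j < #|T|)%N -> narr s aTE j = vcode vs (nth r ts j)) ->
  wp terminal_loop s (fun s' t => [/\ represents s' (ds_init R T r),
    heap_ok s' (5 * #|T|) #|T| & (t <= 300 * #|T| + 50)%N]).
Proof.
move=> Re Ho W2 eT lb pw te; rewrite /terminal_loop; steps; set s0 := Store _ _ _ _.
have [uts tsm szts irts tlt] := ts_props rT pres.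
have k0 := k_gt0 rT.
pose A j := [set t in T' | (index t ts < j)%N].
pose Inv s1 Bud := [/\ represents s1 (partial_init (A (nvar s1 xJ))),
  heap_ok s1 (5 * nvar s1 xJ) (nvar s1 xJ).+1, (nvar s1 xJ <= #|T|.-1)%N
  & (300 * (#|T| - nvar s1 xJ) + 10 <= Bud)%N].
apply: (wp_whilef (I := Inv) (B := (300 * #|T| + 10)%N)).
- split=> //; last by rewrite /s0; sred; rewrite subn0.
  rewrite /s0; sred; rewrite (_ : A 0%N = set0); last first.
    by apply/setP => t; rewrite inE ltn0 andbF inE.
  by apply: rel_ext Re.
- move=> s1 Bud [Re1 Ho1 jk le] [f1 f2 f3]; sred.
  rewrite (f1 xT isT) {1}/s0; sred; rewrite eT.
  set j := nvar s1 xJ in Re1 Ho1 jk le * => lt.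
  have jlt : (j < #|T|.-1)%N by move: lt; clear; lia.
  have jlt2 : (j < #|T|)%N by move: lt; clear; lia.
  set t := nth r ts j.
  have ij : index t ts = j by rewrite index_uniq ?szts.
  have tTT : t \in T by rewrite -tsm mem_nth ?szts.
  have tT : t \in T'.
    rewrite !inE tTT andbT; apply/eqP => e; move: irts; rewrite -e ij => ej.
    by move: jlt; rewrite ej ltnn.
  have tv : valid (t, [set t]) by rewrite /valid sub1set.
  have eX : (narr s1 aLB (narr s1 aTE j) + narr s1 aPW j)%N = lcode (t, [set t]).
    rewrite (f2 aLB isT) (f2 aTE isT) (f2 aPW isT) /s0; sred.
    by rewrite te // lb pw // /lcode /= (tcode1 rT pres tTT) ij.
  steps; rewrite -/j eX; set s2 := Store _ _ _ _.
  have W2' : (1 < nvar s2 xW)%N by rewrite /s2; sred; rewrite (f1 xW isT).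
  have Re2 : represents s2 (partial_init (A j)) by apply: rel_ext Re1.
  have Ba : back_args E T r vs es ts s2 set0 (t, [set t]).
    by rewrite /back_args /s2; sred; rewrite (f1 xBT isT).
  have iR := improve_rel sv sc rT pres W2' Re2 Ho1 tv (erefl _) (erefl _) Ba.
  apply: wp_frame; apply: wp_mono iR => s3 t3 [le4 Re3 Ho3] [g1 g2 g3].
  have eJ : nvar s3 xJ = j by rewrite (g1 xJ isT).
  steps; move=> _; rewrite eJ; exists (300 * (#|T| - j.+1) + 10)%N; last first.
    by move: le le4 lt; clear; lia.
  split; sred; rewrite ?addn1 //.
  + have -> : A j.+1 = t |: A j.
      apply/setP => z; rewrite !inE; case: (eqVneq z t) => [->|zt] /=.
        by rewrite ij ltnSn andbT; move: tT; rewrite !inE.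
      case: (boolP (z \in T)) => zT; rewrite ?andbF //=.
      rewrite ltnS leq_eqVlt; case: (eqVneq (index z ts) j) => // e.
      by move: zt; rewrite /t -e nth_index ?eqxx // tsm.
    apply: partial_step => //; first by rewrite inE ij ltnn andbF.
    by apply: rel_ext Re3.
  + by move: Ho3; rewrite mulnS addnC.
- move=> s' Bud [Re1 Ho1 jk le] [f1 f2 f3]; sred.
  rewrite (f1 xT isT) {1}/s0; sred; rewrite eT => lt; split; first by move: le; clear; lia.
  have e : nvar s' xJ = #|T|.-1 by move: lt jk; clear; lia.
  rewrite e in Re1 Ho1; move=> t le'; split.
  + suff eA : A #|T|.-1 = T' by rewrite eA in Re1.
    apply/setP => z; rewrite inE; apply/andP/idP => [[]//|zT]; split=> //; exact: tlt.
  + by apply: heap_ok_le Ho1 _ _; rewrite ?prednK // leq_mul2l leq_pred orbT.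
  + by move: le le'; clear; lia.
Qed.

End TerminalLoop.

(** * The running time *)

Section Count.
Variables (V : finType) (E : {set {set V}}) (T : {set V}) (r : V).
Variables (vs : seq V) (es : seq (V * V)) (ts : seq V).
Hypotheses (SG : simple_graph E) (rT : r \in T) (pres : presents E T r vs es ts).
Local Notation label := (V * {set V})%type.
Local Notation K := (2 ^ #|T|.-1)%N.
Local Notation T' := (T :\ r).
Local Notation valid := (valid T r).
Local Notation remw := (remw T r).
Local Notation nbl := (nbl r es (size es)).

Lemma card_T' : #|T'| = #|T|.-1.
Proof. by rewrite (cardsD1 r T) rT. Qed.

Lemma remw_sum (f : V -> nat) (g : {set V} -> nat) :
  remw (fun x => f x.1 + g x.2)%N [::] =
  (K * \sum_v f v + #|V| * \sum_(I : {set V} | I \subset T') g I)%N.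
Proof.
rewrite /remw (eq_bigl (fun y : label => true && (y.2 \subset T'))); last first.
  by move=> y; rewrite andbT.
rewrite -(pair_big xpredT (fun I : {set V} => I \subset T') (fun v I => f v + g I)%N) /=.
rewrite (eq_bigr (fun v => K * f v + \sum_(I : {set V} | I \subset T') g I)%N).
  by rewrite big_split /= -big_distrr /= sum_nat_const.
move=> v _; rewrite big_split /= sum_nat_const; congr (_ * _ + _)%N.
by rewrite -card_T' -card_powerset; apply: eq_card => I; rewrite powersetE.
Qed.

Lemma remw_fan : remw (fan T r es) [::] = (2 * K * #|E| + #|V| * 3 ^ #|T|.-1)%N.
Proof.
rewrite (remw_sum (fun v => size (nbl v)) (fun I => 2 ^ #|T' :\: I|)%N).
by rewrite (nbl_sum rT pres) sum_subsets card_T' mulnCA mulnA.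
Qed.

Lemma remw_bud B : remw (bud T r es B) [::] = (2800 * (K * #|E|) +
  1460 * (#|V| * 3 ^ #|T|.-1) + #|V| * K * (60 * #|T| + 3000 * B + 1400))%N.
Proof.
pose w := (60 * #|T| + 3000 * B + 1400)%N.
transitivity (remw (fun x : label => 1400 * size (nbl x.1) +
    (1460 * 2 ^ #|T' :\: x.2| + w))%N [::]).
  by apply: eq_bigr => x _; rewrite /bud -addnA.
rewrite (remw_sum (fun v => 1400 * size (nbl v))%N (fun I => 1460 * 2 ^ #|T' :\: I| + w)%N).
rewrite -big_distrr big_split /= -big_distrr /= (nbl_sum rT pres) sum_subsets card_T'.
have -> : (\sum_(I : {set V} | I \subset T') w = K * w)%N.
  rewrite sum_nat_const -card_T' -card_powerset; congr (_ * _)%N.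
  by apply: eq_card => I; rewrite powersetE.
by rewrite -/w; move: (#|T|.-1) (#|E|) (#|V|) w => p q n w'; clear; lia.
Qed.

Lemma settled_size (xs : seq label) : uniq xs -> (forall x, x \in xs -> valid x) ->
  (size xs <= #|V| * K)%N.
Proof.
move=> u v; rewrite -(size_map (lcode T vs ts)) -(size_iota 0 (#|V| * K)).
apply: uniq_leq_size.
  rewrite map_inj_in_uniq // => x y /v xv /v yv; exact: (lcode_inj rT pres xv yv).
by move=> q /mapP[x /v xv ->]; rewrite mem_iota /= add0n; exact: (lcode_lt rT pres xv).
Qed.

(** The left side counts the dummy and the initial terminals, then all attempted insertions. With N
    = 2^(log n + 1) > n and Q = 2^(k-1), each of its three summands is at most N^2 Q^2, by k <= n,
    2m <= n^2 and 3 <= 2^2; the exponent is that of 4 N^2 Q^2. *)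
Lemma pow_bound : (#|T| + remw (fan T r es) [::] <=
  2 ^ (2 * #|T| + 2 * trunc_log 2 #|V| + 2))%N.
Proof.
rewrite remw_fan; set n := #|V|; set k := #|T|; set l := trunc_log 2 n.
have k0 : (0 < k)%N by apply/card_gt0P; exists r.
have kn : (k <= n)%N by exact: max_card.
have nN : (n < 2 ^ l.+1)%N by apply: trunc_log_ltn.
have mE := card_E SG rT; rewrite -/n in mE.
move: nN; set N := (2 ^ l.+1)%N => nN; set Q := (2 ^ k.-1)%N.
have Q0 : (0 < Q)%N by rewrite expn_gt0.
have -> : (2 ^ (2 * k + 2 * l + 2) = 4 * (N ^ 2 * Q ^ 2))%N.
  rewrite /N /Q -!expnM -expnD (_ : 4 = 2 ^ 2)%N // -expnD; congr (2 ^ _)%N.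
  by move: k0; clear; lia.
have t1 : (k <= N ^ 2 * Q ^ 2)%N.
  apply: leq_trans kn _; apply: leq_trans (ltnW nN) _.
  rewrite -[leqLHS]muln1 leq_mul ?expn_gt0 ?Q0 // expnS expn1 leq_pmulr //.
  exact: leq_ltn_trans nN.
have t2 : (2 * Q * #|E| <= N ^ 2 * Q ^ 2)%N.
  rewrite mulnAC leq_mul //.
    by apply: leq_trans mE _; rewrite leq_exp2r // ltnW.
  by rewrite expnS expn1 leq_pmulr.
have t3 : (n * 3 ^ k.-1 <= N ^ 2 * Q ^ 2)%N.
  apply: leq_mul; first by apply: leq_trans (ltnW nN) _; rewrite expnS expn1 leq_pmulr //;
    exact: leq_ltn_trans nN.
  rewrite /Q -expnM mulnC expnM (_ : 2 ^ 2 = 4)%N //.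
  by case: (k.-1) => // j; rewrite leq_exp2r.
move: t1 t2 t3; move: (N ^ 2 * Q ^ 2)%N (2 * Q * _)%N (n * _)%N => a b d; clear; lia.
Qed.

End Count.

(** The left side is the linear term in the expansion of (1 + 2)^k. It absorbs the share of k in the
    queue cost of each label into 3^k n. *)
Lemma mul_exp2_le k : (k * 2 ^ k.-1 <= 3 ^ k)%N.
Proof.
case: k => // k /=; elim: k => // k IH.
have e := expnS 2 k; have : (2 ^ k.+1 <= 3 ^ k.+1)%N by rewrite leq_exp2r.
by rewrite (expnS 3 k.+1) e; move: IH; move: (2 ^ k)%N (3 ^ k.+1)%N => a b; clear; lia.
Qed.

(** * Assembling the program *)

Section Program.
Variables (R : realType) (V : finType) (E : {set {set V}}) (c : {set V} -> R).
Variables (T : {set V}) (r : V) (L : V -> {set V} -> R).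
Variables (vs : seq V) (es : seq (V * V)) (ts : seq V).
Variables (tL : V -> {set V} -> nat) (fL : nat).
Hypotheses (SG : simple_graph E) (conn : connected_graph E) (rT : r \in T).
Hypothesis pres : presents E T r vs es ts.
Hypothesis tLle : forall v (I : {set V}), I \subset T -> (tL v I <= fL)%N.
Local Notation sv := (fun i J => L (vdecode r vs i) (tdecode ts J)).
Local Notation sc := (fun i J => tL (vdecode r vs i) (tdecode ts J)).
Local Notation wp := (wp sv sc).
Local Notation K := (2 ^ #|T|.-1)%N.
Local Notation T' := (T :\ r).
Local Notation lcode := (lcode T vs ts).
Local Notation valid := (valid T r).
Local Notation B := (2 * #|T| + 2 * trunc_log 2 #|V| + 2)%N.
Local Notation s_in := (input_store c vs es ts).

Lemma program_spec : wp program s_in (fun s' t => exists xs d F,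
  [/\ ds_run E c T r L (ds_init R T r) xs d, ds_backtrack d (r, T') F,
      outputs E r vs es ts s' xs F
    & (t <= #|V| * ((60 + fL) * K + 100) + 200 * #|E| + 2000 * #|T|
        + remw T r (bud T r es B) [::] + 100 * (#|V| * K) + 500)%N]).
Proof.
have [uts tsm szts irts tlt] := ts_props rT pres.
have k0 := k_gt0 rT.
have K0 : (0 < K)%N by rewrite expn_gt0.
have vinj := vcode_inj pres.
have sVs := size_vs pres; have sEs := size_es pres.
have scle i J : (sc i J <= fL)%N.
  by apply: tLle; apply/subsetP => t; rewrite inE tsm => /andP[].
have n1 : nvar s_in xT = #|T| by rewrite /= szts.
rewrite /program; apply: wp_seq; apply: wp_frame.
apply: wp_mono (power_spec sv sc n1 k0) => s1 t1 [eK pw le1] [f1 f2 f3].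
steps; rewrite (f1 xN isT) (f1 xT isT); set s2 := Store _ _ _ _.
have st2 i : narr s2 aST i = 0%N by rewrite /s2; sred; rewrite (f2 aST isT) /= nth_nil.
have n2 : nvar s2 xN = #|V| by rewrite /s2; sred; rewrite (f1 xN isT) /= sVs.
apply: wp_frame.
apply: wp_mono (label_spec sv scle n2 (eK : nvar s2 xK = K) K0 st2).
move=> s3 t3 [lb3 row3 st3 stz3 le3] [g1 g2 g3].
apply: wp_seq; apply: wp_frame.
have n3 : nvar s3 xM = size es by rewrite (g1 xM isT) /s2; sred; rewrite (f1 xM isT).
have e31 j : (j < size es)%N -> narr s3 aE1 j = vcode vs (nth (r, r) es j).1.
  move=> lt; rewrite (g2 aE1 isT) /s2; sred; rewrite (f2 aE1 isT) /=.
  by rewrite (nth_map (r, r)).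
have e32 j : (j < size es)%N -> narr s3 aE2 j = vcode vs (nth (r, r) es j).2.
  move=> lt; rewrite (g2 aE2 isT) /s2; sred; rewrite (f2 aE2 isT) /=.
  by rewrite (nth_map (r, r)).
have hd3 i : narr s3 aHD i = 0%N.
  by rewrite (g2 aHD isT) /s2; sred; rewrite (f2 aHD isT) /= nth_nil.
apply: wp_mono (adjacency_spec sv sc vinj n3 e31 e32 hd3) => s4 t4 [ad4 le4] [h1 h2 h3].
have inA (a : nat) : ~~ namod power_loop a -> ~~ namod label_loop a ->
    ~~ namod adjacency_loop a -> narr s4 a = narr s_in a.
  by move=> a1 a2 a3; rewrite (h2 _ a3) (g2 _ a2) /s2; sred; rewrite (f2 _ a1).
have zA (a : nat) : ~~ namod power_loop a -> ~~ namod label_loop a ->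
    ~~ namod adjacency_loop a -> (2 < a)%N -> forall i, narr s4 a i = 0%N.
  move=> a1 a2 a3; case: a a1 a2 a3 => [|[|[|a]]] // a1 a2 a3 _ i.
  by rewrite inA //= !nth_nil.
have zR i : rarr s4 rL i = 0.
  by rewrite (h3 rL isT) (g3 rL isT) /s2; sred; rewrite (f3 rL isT) /= nth_nil.
have W4 : nvar s4 xW = (4 * #|V| + 4 * #|T| + 20)%N.
  rewrite (h1 xW isT) (g1 xW isT) /s2; sred; rewrite /= sVs szts.
  by move: (#|V|) (#|T|) => a b; clear; lia.
have lb4 v : narr s4 aLB (vcode vs v) = (vcode vs v * K)%N.
  by rewrite (h2 aLB isT) lb3 // (vcode_lt pres).
have K4 : nvar s4 xK = K by rewrite (h1 xK isT) (g1 xK isT).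
have T4 : nvar s4 xT = #|T|.
  by rewrite (h1 xT isT) (g1 xT isT) /s2; sred; rewrite (f1 xT isT).
have pw4 j : (j < #|T|.-1)%N -> narr s4 aPW j = (2 ^ j)%N.
  by move=> jl; rewrite (h2 aPW isT) (g2 aPW isT) /s2; sred; exact: pw.
have te4 j : (j < #|T|)%N -> narr s4 aTE j = vcode vs (nth r ts j).
  by move=> jl; rewrite inA //= (nth_map r) ?szts.
have C4 j : (j < size es)%N -> rarr s4 rC j = c (edge_of (nth (r, r) es j)).
  move=> jl; rewrite (h3 rC isT) (g3 rC isT) /s2; sred; rewrite (f3 rC isT) /=.
  by rewrite (nth_map (r, r)).
have stE4 x : valid x -> narr s4 aST (lcode x) = if x.2 == set0 then 2%N else 0%N.
  case: x => v I xv; rewrite (h2 aST isT) /=.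
  case: (eqVneq I set0) => [I0|I0].
    by rewrite /lcode /= I0 tcode0 addn0 st3 // (vcode_lt pres).
  case: (stz3 (lcode (v, I))) => // -[i il [e _]].
  have e' : lcode (v, I) = lcode (vdecode r vs i, set0).
    by rewrite e /lcode /= tcode0 addn0 (vdecodeK pres).
  have zv : valid (vdecode r vs i, set0) by rewrite /valid sub0set.
  by case: (lcode_inj rT pres xv zv e') I0 => _ ->; rewrite eqxx.
have Re4 : represents E T r vs es ts s4 (partial_init R set0).
  split=> /=.
  - move=> q; rewrite (h2 aST isT).
    by case: (stz3 q) => [->|[i _ [_ ->]]].
  - move=> x xv; rewrite stE4 // inE andFb orbF zR.
    by case: ifP.
  - by move=> x xv; rewrite stE4 // imset0 inE; case: ifP.
  - move=> [v I] xv; rewrite stE4 //=; case: (eqVneq I set0) => [->|I0] /=.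
      by apply/imsetP; exists v.
    by apply/negP => /imsetP[w _ [_ e]]; rewrite e eqxx in I0.
  - move=> q; rewrite (h2 aST isT); case: (stz3 q) => [->//|[i il [-> _]] _].
    exists (vdecode r vs i, set0); first by rewrite /valid sub0set.
    by rewrite /lcode /= tcode0 addn0 (vdecodeK pres).
  - by move=> x; rewrite imset0 inE.
  - by move=> x _; rewrite /back_code zA.
have Ho4 : heap_ok s4 0 1.
  have cn4 : nvar s4 xCN = 1%N by rewrite (h1 xCN isT) (g1 xCN isT).
  have nb4 : nvar s4 xNB = nvar s4 xW.
    by rewrite (h1 xNB isT) (g1 xNB isT) (h1 xW isT) (g1 xW isT).
  have sp4 : nvar s4 xSP = 0%N.
    by rewrite (h1 xSP isT) (g1 xSP isT) /s2; sred; rewrite (f1 xSP isT).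
  split; first exact: zA.
  exists [::]; split; rewrite ?cn4 ?sp4 //.
  have na q : act s4 q = false.
    rewrite /act (h2 aST isT); case: (stz3 q) => [->|[i _ [_ ->]]] //.
  split=> //=; rewrite ?cn4 ?nb4.
  - by move=> f; rewrite /stk sp4 !big_nil.
  - by case=> [|u] [|v].
  - by case=> // _; rewrite zA.
  - by rewrite zA.
  - by move=> x; rewrite na.
  - by move=> x _; rewrite zA.
have W4' : (1 < nvar s4 xW)%N by rewrite W4 ltn_addl.
apply: wp_seq; apply: wp_frame.
apply: wp_mono (terminal_spec sv sc rT pres Re4 Ho4 W4' T4 lb4 pw4 te4).
move=> s5 t5 [Re5 Ho5 le5] [k1 k2 k3].
steps; set s6 := Store _ _ _ _.
have St6 : static c T r L vs es ts s6.
  split; rewrite /s6; sred.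
  - by rewrite (k1 xK isT).
  - by rewrite (k1 xT isT).
  - by rewrite (k1 xW isT).
  - rewrite (k1 xT isT) T4 (k1 xK isT) K4 (k2 aTE isT) (k2 aLB isT) te4; last first.
      by move: k0; clear; lia.
    have nr : nth r ts (#|T| - 1) = r by rewrite subn1 -irts nth_index // tsm.
    by rewrite nr lb4 /lcode /= (tcode_T' rT pres).
  - by move=> v; rewrite (k2 aLB isT).
  - move=> x xv; rewrite (k2 aLV isT) (h2 aLV isT) /lcode.
    by case: (row3 _ _ (vcode_lt pres x.1) (tcode_lt rT pres xv)).
  - move=> x xv; rewrite (k2 aLS isT) (h2 aLS isT) /lcode.
    by case: (row3 _ _ (vcode_lt pres x.1) (tcode_lt rT pres xv)).
  - by move=> j jl; rewrite (k2 aPW isT) pw4.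
  - move=> v; have [_ adv] := ad4; have [hs [_ ch mp]] := adv v.
    exists hs; first by rewrite (k2 aNX isT) (k2 aHD isT).
    by rewrite (k2 aTG isT) (k2 aHE isT).
  - by move=> j jl; rewrite (k3 rC isT) C4.
  - move=> x xv; rewrite (k3 rLB isT) (h3 rLB isT) /lcode.
    have [_ _ ->] := row3 _ _ (vcode_lt pres x.1) (tcode_lt rT pres xv).
    rewrite (vcodeK pres) addnn -mul2n -expnS prednK //.
    by rewrite -(tcode_compl rT pres (sub_T xv)) (tcodeK rT pres) // subsetDl.
have Re6 : represents E T r vs es ts s6 (ds_init R T r) by apply: rel_ext Re5.
have Inv6 : main_inv E c T r L vs es ts s6 (ds_init R T r) [::] (5 * #|T|) #|T|.
  split; split=> //.
  - exact: init_core.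
  - exact: init_closed.
  - split=> //; rewrite /s6; sred; rewrite (k1 xC isT) (h1 xC isT) (g1 xC isT) /s2; sred.
    by rewrite (f1 xC isT).
(* Reduces to log n < 2^(log n) <= n. *)
have BW : (2 * B + 1 < 4 * #|V| + 4 * #|T| + 20)%N.
  have V0 : (0 < #|V|)%N by apply/card_gt0P; exists r.
  have := trunc_logP (isT : (1 < 2)%N) V0.
  have := ltn_expl (trunc_log 2 #|V|) (isT : (1 < 2)%N).
  by move: (trunc_log 2 _) (2 ^ _)%N => l p; clear; lia.
apply: wp_frame.
apply: wp_mono (main_spec sv sc rT pres SG conn Inv6 BW (pow_bound SG rT pres)).
move=> s7 t7 [d [xs [phi [gam [Inv7 rP le7]]]]] [m1 m2 m3].
have F7 i : narr s7 aF i = 0%N.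
  by rewrite (m2 aF isT) /s6; sred; rewrite (k2 aF isT) zA.
have M7 i : narr s7 aMK i = 0%N.
  by rewrite (m2 aMK isT) /s6; sred; rewrite (k2 aMK isT) zA.
apply: wp_frame.
apply: wp_mono (back_spec sv sc rT pres Inv7 rP F7 M7).
move=> s8 t8 [F [bF FE Fe le8]] [o1 o2 o3].
case: Inv7 => [[St7 Re7 Ho7 C7 Cl7] [Run7 [lc7 ld7]]].
exists xs, d, F; split=> //.
- by have := Run7 [::] d (ds_run_exit _ _ _ rP); rewrite cats0.
- split=> //; first by rewrite (o1 xC isT).
  by move=> i il; rewrite (o2 aXV isT) (o2 aXS isT); have [-> ->] := ld7 i il.
- have := settled_size rT pres (co_uniq C7) (fun x xx => proj1 (co_xs C7 xx)).
  rewrite sEs in le4; move: le1 le3 le4 le5 le7 le8.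
  move: (remw _ _ _ _) => a; move: (#|V| * ((60 + fL) * K + 100))%N => b.
  move: (#|V| * K)%N => x; clear; lia.
Qed.

End Program.

(* The program and the constant hidden in O(.) are the same for all instances. *)
(* trunc_log 2 n, the integer part of log_2 n, is within a factor 2 of log_2 n.*)
Theorem theorem2 (R : realType) :
  exists (p : com) (C : nat),
    forall (V : finType) (E : {set {set V}}) (c : {set V} -> R)
           (T : {set V}) (r : V) (L : V -> {set V} -> R)
           (tL : V -> {set V} -> nat) (fL n m k : nat),
      simple_graph E -> connected_graph E ->
      (forall e, e \in E -> 0 < c e) ->
      r \in T ->
      valid_lower_bound E c T r L ->
      (forall v (I : {set V}), I \subset T -> (tL v I <= fL)%N) ->
      n = #|V| -> m = #|E| -> k = #|T| ->
      implements_ds E c T r L tL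
        (C * (3 ^ k * n + 2 ^ k * (n * trunc_log 2 n + m) + 2 ^ k * n * fL))%N p.
Proof.
(* A generous constant: by the estimates below, the terms charged to 3^k n have coefficients summing
   to less than 18000, and those charged to the other two terms are smaller. *)
exists program, (100 * 300)%N.
move=> V E c T r L tL fL n m k SG conn _ rT _ tLle nE mE kE vs es ts pres.
have [t [s [ex [xs [d [F [run bt out le]]]]]]] :=
  program_spec c L SG conn rT pres tLle.
exists t, s, xs, d, F; split=> //; apply: leq_trans le _.
have k0 : (0 < k)%N by rewrite kE; exact: k_gt0 rT.
have kn : (k <= n)%N by rewrite kE nE; exact: max_card.
rewrite (remw_bud rT pres) -nE -mE -kE; set l := trunc_log 2 n.
set X := (3 ^ k * n)%N; set Y := (2 ^ k * (n * l + m))%N; set Z := (2 ^ k * n * fL)%N.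
set Q := (2 ^ k.-1)%N.
have QE : (2 ^ k = 2 * Q)%N by rewrite /Q -expnS prednK.
have Q3 : (2 * Q <= 3 ^ k)%N by rewrite -QE; case: (k) => // j; rewrite leq_exp2r.
have Q0 : (0 < Q)%N by rewrite expn_gt0.
have nX : (n <= X)%N by rewrite leq_pmull // expn_gt0.
have nQ : (n * Q <= X)%N by rewrite mulnC leq_mul2r; apply/orP; right; lia.
have nQk : (n * Q * k <= X)%N.
  by rewrite mulnC mulnCA mulnC leq_mul2r mul_exp2_le orbT.
have n3 : (n * 3 ^ k.-1 <= X)%N by rewrite mulnC leq_mul2r leq_exp2l // leq_pred orbT.
have YE : Y = (2 * (n * Q * l) + 2 * (Q * m))%N by rewrite /Y QE; lia.
have ZE : Z = (2 * (n * Q * fL))%N by rewrite /Z QE; lia.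
have mQ : (m <= Q * m)%N by rewrite leq_pmull.
have -> : (n * ((60 + fL) * Q + 100) = 60 * (n * Q) + n * Q * fL + 100 * n)%N by lia.
have budE (w i j : nat) : (w * (60 * i + 3000 * (2 * i + 2 * j + 2) + 1400) =
  60 * (w * i) + 3000 * (2 * (w * i) + 2 * (w * j) + 2 * w) + 1400 * w)%N by clear; lia.
rewrite budE.
(* For n = 1 both n log n and m vanish, so additive constants are charged to 3^k n. *)
have X1 : (0 < X)%N by lia.
move: nX nQ nQk n3 mQ X1 kn; rewrite YE ZE.
move: (n * Q * fL)%N (n * Q * k)%N (n * Q * l)%N => a1 a2 a3.
move: (n * Q)%N (Q * m)%N (n * _)%N X => a4 a5 a6 X'; clear; lia.
Qed.
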